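(* The contravariant functors $\mathcal{P}:\mathbf{SDS}\to\mathbf{OBD}_{\mathrm{po}}$ and $\mathcal{V}:\mathbf{OBD}_{\mathrm{po}}\to\mathbf{SDS}$ are equivalences of categories which are inverse to each other, with respect to the natural isomorphisms $\tau$ between $1_{\mathbf{OBD}_{\mathrm{po}}}$ and $\mathcal{P}\mathcal{V}$ (with components $\tau_B:B\to\mathcal{P}(\mathcal{V}(B))$) and $\sigma$ between $1_{\mathbf{SDS}}$ and $\mathcal{V}\mathcal{P}$ (with components $\sigma_{\mathcal{X}}:\mathcal{X}\to\mathcal{V}(\mathcal{P}(\mathcal{X}))$).
   Context: **Bratteli diagrams.** A Bratteli diagram $(V,E)$ consists of a vertex set $V=V_0\sqcup V_1\sqcup\cdots$ with each $V_n$ finite and non-empty and $V_0$ a singleton, and an edge set $E=E_1\sqcup E_2\sqcup\cdots$ with each $E_n$ finite and non-empty, together with maps $r,s:E\to V$ (range, source) such that $r(E_n)\subseteq V_n$, $s(E_n)\subseteq V_{n-1}$, $s^{-1}\{v\}\neq\varnothing$ for all $v\in V$ and $r^{-1}\{v\}\ne\varnothing$ for all $v\in V\setminus V_0$. An ordered Bratteli diagram $(V,E,\geq)$ is a Bratteli diagram with a partial order on $E$ such that $e,e'$ are comparable iff $r(e)=r(e')$. It is properly ordered if there is exactly one infinite path $x_{\max}=(e_1,e_2,\ldots)$ ($e_i\in E_i$, $r(e_i)=s(e_{i+1})$) consisting of maximal edges, and exactly one, $x_{\min}$, consisting of minimal edges. **Edge sets.** An ordered edge set from a finite set $S$ to a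 finite set $T$ is a finite set $F$ with maps $s:F\to S$, $r:F\to T$ and a linear order on each $r^{-1}\{w\}$, $w\in T$. If $G$ is an ordered edge set from $T$ to $U$, then $F\circ G=\{(e,g)\in F\times G: r(e)=s(g)\}$, with source $s(e)$, range $r(g)$, and order: for $r(g)=r(g')$, $(e,g)<(e',g')$ iff $g<g'$, or $g=g'$ and $e<e'$. Write $F\cong F'$ if there is a bijection $F\to F'$ preserving sources, ranges and order. For $k<l$, $E_{k,l}=E_{k+1}\circ\cdots\circ E_l$; $E_{k,k}$ consists of one edge from $v$ to $v$ for each $v\in V_k$. **The category $\mathbf{OBD}$.** Objects: ordered Bratteli diagrams. An ordered premorphism $f:B=(V,E,\ge)\to C=(W,S,\ge)$ is a triple $(F,(f_n)_{n\ge0},\geq)$ where $(f_n)$ is an unbounded sequence of integers with $0=f_0\le f_1\le\cdots$, and $F=F_0\sqcup F_1\sqcup\cdots$ where each $F_n$ is a non-empty finite ordered edge set from $V_n$ to $W_{f_n}$ such that every $v\in V_n$ is the source of some edge of $F_n$ (that is, $s^{-1}\{v\}\neq\varnothing$ for all $v\in V$) and every $w\in W_{f_n}$ is the range of some edge of $F_n$, $F_0$ is a singleton, and $E_{n+1}\circ F_{n+1}\cong F_n\circ S_{f_n,f_{n+1}}$ for all $n\ge0$. The composition of $f:B\to C$ and $g=(G,(g_n),\ge):C\to D$ is $gf=(H,(h_n),\ge)$ with $h_n=g_{f_n}$, $H_n=F_n\circ G_{f_n}$. Premorphisms $f,g:B\to C$ are equivalent if there are positive integers $n_1<m_1<n_2<m_2<\cdots$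 with $f_{n_k}<g_{m_k}<f_{n_{k+1}}$ and, for all $k\ge1$, $E_{n_k,m_k}\circ G_{m_k}\cong F_{n_k}\circ S_{f_{n_k},g_{m_k}}$ and $E_{m_k,n_{k+1}}\circ F_{n_{k+1}}\cong G_{m_k}\circ S_{g_{m_k},f_{n_{k+1}}}$. Morphisms in $\mathbf{OBD}$ are equivalence classes $[f]$, with $[g][f]=[gf]$. $\mathbf{OBD}_{\mathrm{po}}$ is the full subcategory of properly ordered Bratteli diagrams. **The category $\mathbf{SDS}$.** An essentially minimal totally disconnected dynamical system $(X,\varphi,x_0)$ consists of a metrizable compact totally disconnected space $X$, a homeomorphism $\varphi$ of $X$ such that $(X,\varphi)$ has a unique minimal (non-empty closed invariant) subset, and a point $x_0$ of that subset. A Kakutani–Rokhlin partition for it is a finite partition $P=\{Z(k,j): 1\le k\le K,\ 1\le j\le J(k)\}$ of $X$ into non-empty clopen sets with $\varphi(Z(k,j))=Z(k,j+1)$ for $1\le j<J(k)$, and such that the top $Z=\bigcup_kZ(k,J(k))$ contains $x_0$ and $\varphi(Z)=\bigcup_kZ(k,1)$; the sequences $(Z(k,1),\ldots,Z(k,J(k)))$ are its towers. A system of Kakutani–Rokhlin partitions is a sequence $\mathcal{R}=(P_n)_{n\ge0}$ of such partitions with $P_0=\{X\}$, $P_{n+1}$ refining $P_n$ (written $P_n\le P_{n+1}$), the tops $Z_n$ of $P_n$ ($n\ge1$) decreasing with intersection $\{x_0\}$, and $\bigcup_nP_n$ a basis for the topology of $X$. Objects of $\mathbf{SDS}$ are quadruples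 $(X,\varphi,x_0,\mathcal{R})$; morphisms $(X,\varphi,x_0,\mathcal{R})\to(Y,\psi,y_0,\mathcal{S})$ are continuous maps $\alpha:X\to Y$ with $\alpha\circ\varphi=\psi\circ\alpha$ and $\alpha(x_0)=y_0$. **The edge set $E(P,Q)$.** If $P\le Q$ are Kakutani–Rokhlin partitions and the top of $P$ contains the top of $Q$, $E(P,Q)$ is the set of triples $(S,T,k)$ with $S=(Z_1,\ldots,Z_n)$ a tower of $P$, $T=(Y_1,\ldots,Y_m)$ a tower of $Q$, $k\ge0$ an integer with $Y_{k+j}\subseteq Z_j$ for $1\le j\le n$; source $S$, range $T$, and $(S,T,k)\le(S',T',k')$ iff $T=T'$ and $k\le k'$. **The functor $\mathcal{P}$.** On objects with $\mathcal{R}=(P_n)$: $\mathcal{P}(X,\varphi,x_0,\mathcal{R})$ has $V_n=\{(n,T): T\text{ a tower of }P_n\}$ and $E_n$ the copy $\{(n,S,T,k):(S,T,k)\in E(P_{n-1},P_n)\}$ of $E(P_{n-1},P_n)$ with its order; it is a properly ordered Bratteli diagram. For a morphism $\alpha:(X,\varphi,x_0,(P_n))\to(Y,\psi,y_0,(Q_n))$, let $\alpha^{-1}(Q_n)$ be the set of inverse images of elements of $Q_n$, a Kakutani–Rokhlin partition for $(X,\varphi,x_0)$; for a tower $S=(Z_1,\ldots,Z_m)$ of $Q_n$ write $\alpha^{-1}(S)=(\alpha^{-1}(Z_1),\ldots,\alpha^{-1}(Z_m))$. Choose integers $0=f_0\le f_1\le\cdots$, unbounded, with $\alpha^{-1}(Q_n)\le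 P_{f_n}$ and the top of $\alpha^{-1}(Q_n)$ containing the top of $P_{f_n}$; let $F_n=\{(n,S,T,k):(\alpha^{-1}(S),T,k)\in E(\alpha^{-1}(Q_n),P_{f_n})\}$ with source $(n,S)$, range $(f_n,T)$ and the induced order ($F_0$ a single edge). Then $f=(\bigsqcup F_n,(f_n),\ge)$ is an ordered premorphism $\mathcal{P}(Y,\psi,y_0,(Q_n))\to\mathcal{P}(X,\varphi,x_0,(P_n))$ and $\mathcal{P}(\alpha)=[f]$. **The functor $\mathcal{V}$.** For $B=(V,E,\ge)$ properly ordered, $X_B$ is the space of infinite paths $(e_1,e_2,\ldots)$ with basis of open sets the cylinders $U(e_1,\ldots,e_k)$ of paths beginning with $e_1,\ldots,e_k$. The Vershik map $\lambda_B$: $\lambda_B(x_{\max})=x_{\min}$; for other $x=(e_1,e_2,\ldots)$, if $k$ is least with $e_k$ not maximal, $f_k$ is the successor of $e_k$ in $r^{-1}\{r(e_k)\}$ and $(f_1,\ldots,f_{k-1})$ is the path of minimal edges from $V_0$ to $s(f_k)$, then $\lambda_B(x)=(f_1,\ldots,f_k,e_{k+1},\ldots)$. Let $P_0=\{X_B\}$ and, for $n\ge1$, $P_n=\{U(e_1,\ldots,e_n):(e_1,\ldots,e_n)\in E_{0,n}\}$, with one tower $T_v$ for each $v\in V_n$ consisting of those $U(e_1,\ldots,e_n)$ with $r(e_n)=v$ (in the order of $E_{0,n}$); $\mathcal{R}_B=(P_n)$. Then $\mathcal{V}(B)=(X_B,\lambda_B,x_{\max},\mathcal{R}_B)\in\mathbf{SDS}$.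 Let $f_B:B\to\mathcal{P}(\mathcal{V}(B))$ be the premorphism with $f_n=n$ and $F_n$ consisting of exactly one edge from $v$ to $(n,T_v)$ for each $v\in V_n$; $\tau_B=[f_B]$ is an isomorphism in $\mathbf{OBD}$. For a morphism $h:B\to C$, $\mathcal{V}(h):\mathcal{V}(C)\to\mathcal{V}(B)$ is the unique morphism $\alpha$ in $\mathbf{SDS}$ with $\mathcal{P}(\alpha)=\tau_Ch\tau_B^{-1}$. For $\mathcal{X}\in\mathbf{SDS}$, $\sigma_{\mathcal{X}}:\mathcal{X}\to\mathcal{V}(\mathcal{P}(\mathcal{X}))$ is the unique isomorphism with $\mathcal{P}(\sigma_{\mathcal{X}})=\tau_{\mathcal{P}(\mathcal{X})}^{-1}$.
   Formalization: As P(α) is undefined for non-surjective α, the theorem is proved in two versions: with morphisms of SDS required to be surjective, and with all morphisms of SDS but without requiring in premorphisms that every vertex of V_n be the source of an edge of F_n. *)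

(* Defs.v *)
From HB Require Import structures.
From mathcomp Require Import all_boot all_order all_algebra finmap.
From mathcomp Require Import boolp classical_sets functions reals topology.
From mathcomp Require Import Rstruct.

Set Implicit Arguments.
Unset Strict Implicit.
Unset Printing Implicit Defensive.

Local Open Scope classical_set_scope.

Record category := Category {
  obj :> Type;
  hom : obj -> obj -> Type;
  idm : forall A, hom A A;
  comp : forall A B C, hom B C -> hom A B -> hom A C;
  compm1 : forall A B (f : hom A B), comp f (idm A) = f;
  comp1m : forall A B (f : hom A B), comp (idm B) f = f;
  compmA : forall A B C D (h : hom C D) (g : hom B C) (f : hom A B),
    comp h (comp g f) = comp (comp h g) f }.

Arguments hom {c} _ _.
Arguments idm {c} _.
Arguments comp {c A B C} _ _.

Notation "g \oc f" := (comp g f) (at level 50, left associativity).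

Record iso (C : category) (A B : C) := Iso {
  iso_hom :> hom A B;
  iso_inv : hom B A;
  iso_invK : iso_inv \oc iso_hom = idm A;
  iso_homK : iso_hom \oc iso_inv = idm B }.

Section FullSubcategory.
Variables (C : category) (P : C -> Prop).

Definition full_subcategory : category :=
  @Category {A : C | P A} (fun A B => @hom C (sval A) (sval B))
    (fun A => idm (sval A)) (fun A B D g f => g \oc f)
    (fun A B f => compm1 f) (fun A B f => comp1m f)
    (fun A B D E h g f => compmA h g f).

End FullSubcategory.

(* Contravariant, with prescribed action [F0] on objects. *)
Record cofunctor (C D : category) (F0 : C -> D) := Cofunctor {
  fmap : forall A B : C, hom A B -> hom (F0 B) (F0 A);
  fmap_id : forall A, fmap (idm A) = idm (F0 A);
  fmap_comp : forall A B E (g : hom B E) (f : hom A B),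
    fmap (g \oc f) = fmap f \oc fmap g }.

Arguments fmap {C D F0} _ {A B} _.

(* [F] and [G] are equivalences of categories, inverse to each other with respect to
   the natural isomorphisms [eta : 1 -> G F] and [eps : 1 -> F G]. *)
Definition inverse_equivalences (C D : category) (F0 : C -> D) (G0 : D -> C)
    (F : cofunctor F0) (G : cofunctor G0)
    (eta : forall A : C, iso A (G0 (F0 A))) (eps : forall B : D, iso B (F0 (G0 B))) :
    Prop :=
  (forall (A A' : C) (f : hom A A'), eta A' \oc f = fmap G (fmap F f) \oc eta A) /\
  (forall (B B' : D) (g : hom B B'), eps B' \oc g = fmap F (fmap G g) \oc eps B).

Record eset (S T : finType) := ESet {
  edge :> finType;
  src : edge -> S;
  rng : edge -> T;
  ele : rel edge }.

Arguments src {S T} _ _.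
Arguments rng {S T} _ _.
Arguments ele {S T} _ _ _.

Section EdgeSets.
Implicit Types S T U : finType.

(* Comparability being equality of ranges, this is a linear order on each fibre of the
   range map. *)
Definition ordered S T (F : eset S T) : Prop :=
  [/\ reflexive (ele F), antisymmetric (ele F), transitive (ele F) &
      forall e e', (ele F e e' || ele F e' e) = (rng F e == rng F e')].

Definition src_onto S T (F : eset S T) : Prop := forall v, exists e, src F e = v.
Definition rng_onto S T (F : eset S T) : Prop := forall w, exists e, rng F e = w.

Definition ecomp S T U (F : eset S T) (G : eset T U) : eset S U :=
  @ESet S U {p : F * G | rng F p.1 == src G p.2}
    (fun p => src F (val p).1) (fun p => rng G (val p).2)
    (fun p q => ((val p).2 != (val q).2) && ele G (val p).2 (val q).2
             || ((val p).2 == (val q).2) && ele F (val p).1 (val q).1).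

Definition eiso S T (F G : eset S T) : Prop :=
  exists phi : F -> G,
    [/\ bijective phi, forall e, src G (phi e) = src F e,
        forall e, rng G (phi e) = rng F e &
        forall e e', ele G (phi e) (phi e') = ele F e e'].

(* One edge from [v] to [v] for each [v] when [k = l]; empty when [k != l]. *)
Definition eid (V : nat -> finType) (k l : nat) : eset (V k) (V l) :=
  @ESet (V k) (V l)
    {p : V k * V l | Tagged (fun n => V n : Type) p.1 == Tagged (fun n => V n : Type) p.2}
    (fun p => (val p).1) (fun p => (val p).2) (fun p q => p == q).

End EdgeSets.

Infix "\oe" := ecomp (at level 50, left associativity).
Infix "\iso" := eiso (at level 70).

(* [arr B n] is the edge set usually indexed by [n.+1]. *)
Record diagram := Diagram {
  vert : nat -> finType;
  arr : forall n, eset (vert n) (vert n.+1) }.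

Definition ordered_bratteli (B : diagram) : Prop :=
  #|vert B 0| = 1 /\
  forall n, [/\ 0 < #|vert B n|, 0 < #|arr B n|, src_onto (arr B n),
                rng_onto (arr B n) & ordered (arr B n)].

(* Composed from the left starting with [eid k k], so that [epath B k k.+1] is
   isomorphic to [arr B k] (see [epath1]) but not equal to it; empty when [l < k]. *)
Fixpoint epath (B : diagram) (k l : nat) : eset (vert B k) (vert B l) :=
  match l with
  | 0 => eid (vert B) k 0
  | l'.+1 => if k <= l' then epath B k l' \oe arr B l' else eid (vert B) k l'.+1
  end.

Section EdgeSetLemmas.
Implicit Types S T U W : finType.

Lemma eisoI S T (F G : eset S T) (phi : F -> G) :
  injective phi -> (forall g, exists e, phi e = g) ->
  (forall e, src G (phi e) = src F e) -> (forall e, rng G (phi e) = rng F e) ->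
  (forall e e', ele G (phi e) (phi e') = ele F e e') -> F \iso G.
Proof.
move=> inj sur hs hr he; exists phi; split=> //.
have [psi psiK] := choice sur.
by exists psi => // x; apply: inj; rewrite psiK.
Qed.

Lemma eiso_refl S T (F : eset S T) : F \iso F.
Proof. by apply: (@eisoI _ _ F F id) => // e; exists e. Qed.

Lemma eiso_sym S T (F G : eset S T) : F \iso G -> G \iso F.
Proof.
move=> [phi [[psi K1 K2] hs hr he]].
apply: (@eisoI _ _ G F psi); first exact: can_inj K2.
- by move=> e; exists (phi e).
- by move=> e; rewrite -hs K2.
- by move=> e; rewrite -hr K2.
- by move=> e e'; rewrite -he !K2.
Qed.

Lemma eiso_trans S T (F G H : eset S T) : F \iso G -> G \iso H -> F \iso H.
Proof.
move=> [f [[f' K1 K2] hs hr he]] [g [[g' L1 L2] ks kr ke]].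
apply: (@eisoI _ _ F H (g \o f)).
- exact: inj_comp (can_inj L1) (can_inj K1).
- by move=> e; exists (f' (g' e)) => /=; rewrite K2 L2.
- by move=> e /=; rewrite ks hs.
- by move=> e /=; rewrite kr hr.
- by move=> e e' /=; rewrite ke he.
Qed.

Lemma ecomp_iso S T U (F F' : eset S T) (G G' : eset T U) :
  F \iso F' -> G \iso G' -> F \oe G \iso F' \oe G'.
Proof.
move=> [f [[f' K1 K2] hs hr he]] [g [[g' L1 L2] ks kr ke]].
have P (p : F \oe G) : rng F' (f (val p).1) == src G' (g (val p).2).
  by rewrite hr ks (valP p).
apply: (@eisoI _ _ (F \oe G) (F' \oe G')
  (fun p => exist _ (f (val p).1, g (val p).2) (P p))).
- move=> [[a b] H] [[c d] H'] /(congr1 val) /= [/(can_inj K1) E /(can_inj L1) E'].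
  by apply: val_inj; rewrite /= E E'.
- move=> [[a b] H].
  have Q : rng F (f' a) == src G (g' b).
    by rewrite -hr -ks K2 L2.
  by exists (exist _ (f' a, g' b) Q); apply: val_inj => /=; rewrite K2 L2.
- by move=> e /=; rewrite hs.
- by move=> e /=; rewrite kr.
- by move=> e e' /=; rewrite ke he !(can_eq L1).
Qed.

Lemma ecompA S T U W (F : eset S T) (G : eset T U) (H : eset U W) :
  F \oe G \oe H \iso F \oe (G \oe H).
Proof.
have P1 (p : F \oe G \oe H) : rng G (val (val p).1).2 == src H (val p).2.
  exact: (valP p).
have P2 (p : F \oe G \oe H) :
    rng F (val (val p).1).1 == src (G \oe H) (exist _ (_, _) (P1 p)).
  exact: (valP (val p).1).
apply: (@eisoI _ _ (F \oe G \oe H) (F \oe (G \oe H))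
  (fun p => exist _ (_, _) (P2 p))).
- move=> [[[[a b] i] c] j] [[[[a' b'] i'] c'] j'] /= [E1 E2 E3].
  by apply: val_inj; congr (_, _) => //; apply: val_inj; congr (_, _).
- move=> [[a [[b c] i]] j] /=.
  exists (exist _ (exist _ (a, b) j, c) i).
  by apply: val_inj; congr (_, _); apply: val_inj.
- by [].
- by [].
- move=> [[[[a b] i] c] j] [[[[a' b'] i'] c'] j'] /=.
  rewrite -!val_eqE /= !xpair_eqE /=.
  by case: (eqVneq c c') => [?|?]; case: (eqVneq b b') => [?|?] //=;
    rewrite ?andbF ?andbT ?orbF.
Qed.

Lemma eid_rngE (V : nat -> finType) k (p : eid V k k) : (val p).1 = (val p).2.
Proof.
by case: p => [[a b] /= /eqP H]; exact: eq_from_Tagged H.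
Qed.

Lemma ecomp_idl (V : nat -> finType) k T (F : eset (V k) T) :
  ordered F -> eid V k k \oe F \iso F.
Proof.
move=> [rF _ _ _].
have E (p : eid V k k \oe F) : (val (val p).1) = (src F (val p).2, src F (val p).2).
  case: p => [[p e] /= /eqP <-]; have := eid_rngE p.
  by case: p => [[a b] /= _] ->.
apply: (@eisoI _ _ (eid V k k \oe F) F (fun p => (val p).2)).
- move=> p q pq; apply: val_inj; move: (E p) (E q).
  case: (val p) (val q) pq => [a b] [c d] /= bd aE cE.
  by congr (_, _) => //; apply: val_inj; rewrite /= aE cE bd.
- move=> e.
  have Q : Tagged (fun n => V n : Type) (src F e, src F e).1
           == Tagged (fun n => V n : Type) (src F e, src F e).2 by [].
  by exists (exist _ (exist _ (src F e, src F e) Q, e) (eqxx _)).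
- by move=> p /=; rewrite E.
- by [].
- move=> p q /=; case: (eqVneq (val p).2 (val q).2) => [pq|] /=.
    by rewrite pq rF; apply/esym/eqP/val_inj; rewrite !E pq.
  by rewrite orbF.
Qed.

Lemma ecomp_idr (V : nat -> finType) k S (F : eset S (V k)) :
  ordered F -> F \oe eid V k k \iso F.
Proof.
move=> [_ _ _ cF].
have E (p : F \oe eid V k k) : (val (val p).2) = (rng F (val p).1, rng F (val p).1).
  case: p => [[e p] /= /eqP ->]; have := eid_rngE p.
  by case: p => [[a b] /= _] ->.
apply: (@eisoI _ _ (F \oe eid V k k) F (fun p => (val p).1)).
- move=> p q pq; apply: val_inj; move: (E p) (E q).
  case: (val p) (val q) pq => [a b] [c d] /= ac bE dE.
  by congr (_, _) => //; apply: val_inj; rewrite /= bE dE ac.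
- move=> e.
  have Q : Tagged (fun n => V n : Type) (rng F e, rng F e).1
           == Tagged (fun n => V n : Type) (rng F e, rng F e).2 by [].
  by exists (exist _ (e, exist _ (rng F e, rng F e) Q) (eqxx _)).
- by [].
- by move=> p /=; rewrite E.
- move=> p q /=; rewrite andNb /=.
  case: (eqVneq (val p).2 (val q).2) => //= pq.
  case le: (ele F (val p).1 (val q).1) => //.
  move: (cF (val p).1 (val q).1); rewrite le /= => /esym/eqP r.
  by case/eqP: pq; apply: val_inj; rewrite !E r.
Qed.

Lemma ecomp_ordered S T U (F : eset S T) (G : eset T U) :
  ordered F -> ordered G -> ordered (F \oe G).
Proof.
move=> [rF aF tF cF] [rG aG tG cG].
have sub (e e' : F \oe G) : (val e).2 = (val e').2 ->
    rng F (val e).1 = rng F (val e').1.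
  by move=> ee; rewrite (eqP (valP e)) (eqP (valP e')) ee.
split=> /=.
- by move=> p /=; rewrite eqxx rF.
- move=> p q /=; rewrite [(val q).2 == _]eq_sym.
  case: (eqVneq (val p).2 (val q).2) => [pq|pq] /=.
    move=> /aF pq1; apply: val_inj.
    by rewrite [LHS]surjective_pairing [RHS]surjective_pairing pq pq1.
  by rewrite !orbF => /aG /eqP; rewrite (negPf pq).
- move=> q p r /=.
  case: (eqVneq (val p).2 (val q).2) => [->|pq] /=.
    case: (eqVneq (val q).2 (val r).2) => [_|_ _] /=; first exact: tF.
    by [].
  rewrite orbF => lpq.
  case: (eqVneq (val q).2 (val r).2) => [<- _|qr] /=.
    by rewrite pq lpq.
  rewrite orbF => lqr; rewrite (tG _ _ _ lpq lqr) andbT.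
  case: (eqVneq (val p).2 (val r).2) => //= pr.
  case/eqP: pq; apply: aG; rewrite lpq /=.
  by rewrite pr.
- move=> p q /=; rewrite [(val q).2 == _]eq_sym.
  case: (eqVneq (val p).2 (val q).2) => [pq|pq] /=.
    by rewrite cF pq eqxx; apply/eqP/sub.
  by rewrite !orbF cG.
Qed.

Lemma ecomp_src_onto S T U (F : eset S T) (G : eset T U) :
  src_onto F -> src_onto G -> src_onto (F \oe G).
Proof.
move=> sF sG v; have [e ev] := sF v; have [g ge] := sG (rng F e).
by exists (exist _ (e, g) (introT eqP (esym ge))).
Qed.

Lemma ecomp_rng_onto S T U (F : eset S T) (G : eset T U) :
  rng_onto F -> rng_onto G -> rng_onto (F \oe G).
Proof.
move=> rF rG v; have [g gv] := rG v; have [e eg] := rF (src G g).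
by exists (exist _ (e, g) (introT eqP eg)).
Qed.

Let eid_edge (V : nat -> finType) k (v : V k) : eid V k k :=
  exist _ (v, v) (eqxx _).

Lemma eid_eqE (V : nat -> finType) k (p q : eid V k k) :
  (rng (eid V k k) p == rng (eid V k k) q) = (p == q).
Proof.
move: (eid_rngE p) (eid_rngE q); case: p q => [[a b] i] [[c d] j] /= ab cd.
apply/eqP/eqP => [bd|[_ ->] //]; apply: val_inj => /=.
by rewrite ab cd bd.
Qed.

Lemma eid_ordered (V : nat -> finType) k : ordered (eid V k k).
Proof.
split=> /=; first by move=> p; exact: eqxx.
- by move=> p q /andP[/eqP].
- by move=> q p r /eqP ->.
- by move=> p q; rewrite eid_eqE [q == p]eq_sym orbb.
Qed.

Lemma eid_src_onto (V : nat -> finType) k : src_onto (eid V k k).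
Proof. by move=> v; exists (eid_edge v). Qed.

Lemma eid_rng_onto (V : nat -> finType) k : rng_onto (eid V k k).
Proof. by move=> v; exists (eid_edge v). Qed.

Lemma card_eid (V : nat -> finType) k : #|eid V k k| = #|V k|.
Proof.
apply: (@bij_eq_card _ _ (src (eid V k k))).
exists (@eid_edge V k) => // p.
by apply: val_inj; move: (eid_rngE p); case: p => [[a b] i] /= ->.
Qed.

End EdgeSetLemmas.

Section PathLemmas.
Variable B : diagram.
Hypothesis bratB : ordered_bratteli B.

Let arrO n : ordered (arr B n). Proof. by case: bratB => _ /(_ n) []. Qed.

Lemma epathS k l : k <= l -> epath B k l.+1 = epath B k l \oe arr B l.
Proof. by move=> /= ->. Qed.

Lemma epath_id k : epath B k k = eid (vert B) k k.
Proof. by case: k => //= k; rewrite ltnn. Qed.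

Lemma epath_ordered k l : k <= l -> ordered (epath B k l).
Proof.
elim: l => [|l IHl]; first by rewrite leqn0 => /eqP ->; exact: eid_ordered.
rewrite leq_eqVlt => /predU1P[->|]; first by rewrite epath_id; exact: eid_ordered.
by rewrite ltnS => kl; rewrite epathS //; apply: ecomp_ordered => //; exact: IHl.
Qed.

Lemma epath_src_onto k l : k <= l -> src_onto (epath B k l).
Proof.
elim: l => [|l IHl]; first by rewrite leqn0 => /eqP ->; exact: eid_src_onto.
rewrite leq_eqVlt => /predU1P[->|]; first by rewrite epath_id; exact: eid_src_onto.
rewrite ltnS => kl; rewrite epathS //; apply: ecomp_src_onto => //; first exact: IHl.
by case: bratB => _ /(_ l) [].
Qed.

Lemma epath_rng_onto k l : k <= l -> rng_onto (epath B k l).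
Proof.
elim: l => [|l IHl]; first by rewrite leqn0 => /eqP ->; exact: eid_rng_onto.
rewrite leq_eqVlt => /predU1P[->|]; first by rewrite epath_id; exact: eid_rng_onto.
rewrite ltnS => kl; rewrite epathS //; apply: ecomp_rng_onto => //; first exact: IHl.
by case: bratB => _ /(_ l) [].
Qed.

Lemma epath1 k : epath B k k.+1 \iso arr B k.
Proof. by rewrite epathS // epath_id; exact: ecomp_idl. Qed.

Lemma epath_cat k l m : k <= l -> l <= m ->
  epath B k l \oe epath B l m \iso epath B k m.
Proof.
move=> kl; elim: m => [|m IHm].
  by rewrite leqn0 => /eqP l0; subst l; rewrite epath_id; exact/ecomp_idr/epath_ordered.
rewrite leq_eqVlt => /predU1P[lm|].
  by subst l; rewrite epath_id; exact/ecomp_idr/epath_ordered.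
rewrite ltnS => lm; rewrite epathS // epathS ?(leq_trans kl) //.
apply: eiso_trans (eiso_sym (ecompA _ _ _)) _.
by apply: ecomp_iso (eiso_refl _); exact: IHm.
Qed.

End PathLemmas.

Record obd := Obd { diag :> diagram; diagP : ordered_bratteli diag }.

Record prearrow (B C : diagram) := Prearrow {
  lev : nat -> nat;
  pre : forall n, eset (vert B n) (vert C (lev n)) }.

(* [strict] selects one of two versions of both categories.  With [strict = true] every
   vertex of [B] has to be the source of an edge of the premorphism, and the morphisms
   of systems in [sds_hom] have to be onto; with [strict = false] neither is required.
   The two conditions go together: if [alpha : X -> Y] is not onto, some floors in [Y]
   have an empty preimage, and their towers are not the source of any edge of the
   prearrow [Parrow alpha f].  For instance, the inclusion of the fixed point in the
   one-point compactification of the integers with the shift is not induced by any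
   premorphism for which every vertex is a source. *)
Record is_premorphism (strict : bool) (B C : diagram) (f : prearrow B C) : Prop := {
  lev0 : lev f 0 = 0;
  lev_mono : forall n, lev f n <= lev f n.+1;
  lev_unbounded : forall N, exists n, N <= lev f n;
  pre_nonempty : forall n, 0 < #|pre f n|;
  pre_ordered : forall n, ordered (pre f n);
  pre_src : strict -> forall n, src_onto (pre f n);
  pre_rng : forall n, rng_onto (pre f n);
  pre0 : #|pre f 0| = 1;
  pre_comm : forall n,
    arr B n \oe pre f n.+1 \iso pre f n \oe epath C (lev f n) (lev f n.+1) }.

Record premorphism (strict : bool) (B C : obd) := Premorphism {
  prearr :> prearrow B C;
  prearrP : is_premorphism strict prearr }.

Definition pequiv (B C : diagram) (f g : prearrow B C) : Prop :=
  exists n m : nat -> nat,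
    [/\ 0 < n 0,
        forall k, n k < m k < n k.+1,
        forall k, lev f (n k) < lev g (m k) < lev f (n k.+1),
        forall k, epath B (n k) (m k) \oe pre g (m k) \iso
                  pre f (n k) \oe epath C (lev f (n k)) (lev g (m k)) &
        forall k, epath B (m k) (n k.+1) \oe pre f (n k.+1) \iso
                  pre g (m k) \oe epath C (lev g (m k)) (lev f (n k.+1))].

Definition precomp (B C D : diagram) (g : prearrow C D) (f : prearrow B C) :
  prearrow B D :=
  @Prearrow B D (fun n => lev g (lev f n)) (fun n => pre f n \oe pre g (lev f n)).

Definition preid (B : diagram) : prearrow B B :=
  @Prearrow B B id (fun n => eid (vert B) n n).

Section Premorphisms.
Variable strict : bool.
Local Notation premorphism := (premorphism strict).

Section LevLemmas.
Variables (B C : obd) (f : premorphism B C).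

Lemma lev_homo i j : i <= j -> lev f i <= lev f j.
Proof.
move: i j; apply: (@homo_leq _ _ leq) => //; first by move=> ? ? ?; exact: leq_trans.
exact: lev_mono (prearrP f).
Qed.

Lemma lev_large N M : exists2 n, M <= n & N < lev f n.
Proof.
have [n Nn] := lev_unbounded (prearrP f) N.+1.
by exists (maxn M n); rewrite ?leq_maxl // (leq_trans Nn) // lev_homo // leq_maxr.
Qed.

Lemma pre_commP n m : n <= m ->
  epath B n m \oe pre f m \iso pre f n \oe epath C (lev f n) (lev f m).
Proof.
have bB := diagP B; have bC := diagP C.
have fo := pre_ordered (prearrP f).
elim: m => [|m IHm].
  rewrite leqn0 => /eqP ->; rewrite !epath_id.
  by apply: eiso_trans (ecomp_idl _) _ => //; apply: eiso_sym; exact: ecomp_idr.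
rewrite leq_eqVlt => /predU1P[->|].
  rewrite !epath_id.
  by apply: eiso_trans (ecomp_idl _) _ => //; apply: eiso_sym; exact: ecomp_idr.
rewrite ltnS => nm; rewrite epathS //.
apply: eiso_trans (ecompA _ _ _) _.
apply: eiso_trans (ecomp_iso (eiso_refl _) (pre_comm (prearrP f) m)) _.
apply: eiso_trans (eiso_sym (ecompA _ _ _)) _.
apply: eiso_trans (ecomp_iso (IHm nm) (eiso_refl _)) _.
apply: eiso_trans (ecompA _ _ _) _.
by apply: ecomp_iso (eiso_refl _) _; apply: epath_cat => //; apply: lev_homo.
Qed.

End LevLemmas.

(* By [pequivP] below, equivalence amounts to the commutation of all squares with one
   side far enough to the right. *)
Definition dominated (B C : obd) (f g : prearrow B C) : Prop :=
  forall n, exists N, forall m, N <= m -> n <= m /\ lev f n <= lev g m /\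
    epath B n m \oe pre g m \iso pre f n \oe epath C (lev f n) (lev g m).

Lemma square_dominated (B C : obd) (f g : premorphism B C) :
  (forall N, exists n m, [/\ N <= n, n <= m, lev f n <= lev g m &
     epath B n m \oe pre g m \iso pre f n \oe epath C (lev f n) (lev g m)]) ->
  dominated f g.
Proof.
have bB := diagP B; have bC := diagP C.
move=> H n; have [p [q [np pq fg sq]]] := H n.
exists q => m qm; have nm : n <= m := leq_trans np (leq_trans pq qm).
have fgm : lev f p <= lev g m by apply: leq_trans fg _; exact: lev_homo.
split=> //; split; first by apply: leq_trans fgm; exact: lev_homo.
have nq := leq_trans np pq.
apply: eiso_trans (ecomp_iso (eiso_sym (epath_cat bB nq qm)) (eiso_refl _)) _.
apply: eiso_trans (ecompA _ _ _) _.
apply: eiso_trans (ecomp_iso (eiso_refl _) (pre_commP g qm)) _.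
apply: eiso_trans (eiso_sym (ecompA _ _ _)) _.
apply: eiso_trans (ecomp_iso (ecomp_iso (eiso_sym (epath_cat bB np pq)) (eiso_refl _)) (eiso_refl _)) _.
apply: eiso_trans (ecomp_iso (ecompA _ _ _) (eiso_refl _)) _.
apply: eiso_trans (ecomp_iso (ecomp_iso (eiso_refl _) sq) (eiso_refl _)) _.
apply: eiso_trans (ecomp_iso (eiso_sym (ecompA _ _ _)) (eiso_refl _)) _.
apply: eiso_trans (ecomp_iso (ecomp_iso (pre_commP f np) (eiso_refl _)) (eiso_refl _)) _.
apply: eiso_trans (ecompA _ _ _) _.
apply: eiso_trans (ecompA _ _ _) _.
apply: ecomp_iso (eiso_refl _) _.
have gqm : lev g q <= lev g m := lev_homo g qm.
apply: eiso_trans (ecomp_iso (eiso_refl _) (epath_cat bC fg gqm)) _.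
by apply: epath_cat => //; exact: lev_homo.
Qed.

Lemma pequivP (B C : obd) (f g : premorphism B C) :
  pequiv f g <-> dominated f g /\ dominated g f.
Proof.
split=> [[n [m [n0 nm fg sq1 sq2]]]|[fg gf]].
  have nk k : k <= n k.
    elim: k => // k IHk; have /andP[h1 h2] := nm k.
    exact: leq_ltn_trans IHk (ltn_trans h1 h2).
  split; apply: square_dominated => N.
    have /andP[h1 _] := nm N; have /andP[h2 _] := fg N.
    by exists (n N), (m N); split=> //; exact: ltnW.
  have /andP[h1 h1'] := nm N; have /andP[_ h2'] := fg N.
  exists (m N), (n N.+1); split=> //; [|exact: ltnW|exact: ltnW].
  exact: leq_trans (nk N) (ltnW h1).
have step (h h' : premorphism B C) : dominated h h' -> forall n, exists m,
    [/\ n < m, lev h n < lev h' m &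
    epath B n m \oe pre h' m \iso pre h n \oe epath C (lev h n) (lev h' m)].
  move=> hh n; have [N HN] := hh n.
  have [m Nm hm] := lev_large h' (lev h n) (maxn N n.+1).
  rewrite geq_max in Nm; case/andP: Nm => Nm nm.
  by exists m; split=> //; have [_ []] := HN m Nm.
have [a Ha] := choice (step f g fg); have [b Hb] := choice (step g f gf).
pose n := fix n k := if k is k'.+1 then b (a (n k')) else 1.
exists n, (fun k => a (n k)); split=> // k.
- by have [-> _ _] := Ha (n k); have [/= -> _ _] := Hb (a (n k)).
- by have [_ -> _] := Ha (n k); have [_ /= -> _] := Hb (a (n k)).
- by have [] := Ha (n k).
- by have [] := Hb (a (n k)).
Qed.

Lemma dominated_refl (B C : obd) (f : premorphism B C) : dominated f f.
Proof.
move=> n; exists n => m nm; split=> //; split; first exact: lev_homo.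
exact: pre_commP.
Qed.

Lemma dominated_trans (B C : obd) (f g h : premorphism B C) :
  dominated f g -> dominated g h -> dominated f h.
Proof.
have bB := diagP B; have bC := diagP C.
move=> fg gh; apply: square_dominated => n.
have [N /(_ N (leqnn N)) [nN [fgN sq]]] := fg n.
have [M /(_ M (leqnn M)) [NM [ghM sq']]] := gh N.
exists n, M; split=> //; [exact: leq_trans NM | exact: leq_trans ghM |].
apply: eiso_trans (ecomp_iso (eiso_sym (epath_cat bB nN NM)) (eiso_refl _)) _.
apply: eiso_trans (ecompA _ _ _) _.
apply: eiso_trans (ecomp_iso (eiso_refl _) sq') _.
apply: eiso_trans (eiso_sym (ecompA _ _ _)) _.
apply: eiso_trans (ecomp_iso sq (eiso_refl _)) _.
apply: eiso_trans (ecompA _ _ _) _.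
exact: ecomp_iso (eiso_refl _) (epath_cat bC fgN ghM).
Qed.

Lemma pequiv_refl (B C : obd) (f : premorphism B C) : pequiv f f.
Proof. by apply/pequivP; split; exact: dominated_refl. Qed.

Lemma pequiv_sym (B C : obd) (f g : premorphism B C) : pequiv f g -> pequiv g f.
Proof. by move=> /pequivP[? ?]; apply/pequivP. Qed.

Lemma pequiv_trans (B C : obd) (f g h : premorphism B C) :
  pequiv f g -> pequiv g h -> pequiv f h.
Proof.
move=> /pequivP[fg gf] /pequivP[gh hg]; apply/pequivP.
by split; [exact: dominated_trans gh | exact: dominated_trans gf].
Qed.

Lemma precompP (B C D : obd) (g : premorphism C D) (f : premorphism B C) :
  is_premorphism strict (precomp g f).
Proof.
have bC := diagP C; have bD := diagP D.
split=> /=.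
- by rewrite (lev0 (prearrP f)) (lev0 (prearrP g)).
- by move=> n; apply: lev_homo; exact: lev_mono (prearrP f) n.
- move=> N; have [m Nm] := lev_unbounded (prearrP g) N.
  have [n mn] := lev_unbounded (prearrP f) m.
  by exists n; apply: leq_trans Nm _; exact: lev_homo.
- move=> n; have /card_gt0P[e _] := pre_nonempty (prearrP g) (lev f n).
  have [e' ee'] := pre_rng (prearrP f) (src _ e).
  by apply/card_gt0P; exists (exist _ (e', e) (introT eqP ee')).
- by move=> n; apply: ecomp_ordered; [exact: pre_ordered (prearrP f) n
    | exact: pre_ordered (prearrP g) _].
- move=> s n; apply: ecomp_src_onto; [exact: pre_src (prearrP f) s n
    | exact: pre_src (prearrP g) s _].
- by move=> n; apply: ecomp_rng_onto; [exact: pre_rng (prearrP f) n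
    | exact: pre_rng (prearrP g) _].
- have f1 := pre0 (prearrP f).
  have g1 : #|pre g (lev f 0)| = 1 by rewrite (lev0 (prearrP f)); exact: pre0 (prearrP g).
  apply/eqP; rewrite eqn_leq; apply/andP; split.
    apply: leq_trans (_ : #|{: pre f 0 * pre g (lev f 0)}| <= 1).
      exact: leq_card val_inj.
    by rewrite card_prod f1 g1.
  have /card_gt0P[e _] : 0 < #|pre g (lev f 0)| by rewrite g1.
  have [e' ee'] := pre_rng (prearrP f) (src _ e).
  by apply/card_gt0P; exists (exist _ (e', e) (introT eqP ee')).
- move=> n.
  apply: eiso_trans (eiso_sym (ecompA _ _ _)) _.
  apply: eiso_trans (ecomp_iso (pre_comm (prearrP f) n) (eiso_refl _)) _.
  apply: eiso_trans (ecompA _ _ _) _.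
  apply: eiso_trans (ecomp_iso (eiso_refl _) (pre_commP g _)) _; last first.
    exact: eiso_sym (ecompA _ _ _).
  exact: lev_mono (prearrP f) n.
Qed.

Lemma preidP (B : obd) : is_premorphism strict (preid B).
Proof.
have bB := diagP B; have [b0 bn] := bB.
split=> //=.
- by move=> N; exists N.
- by move=> n; rewrite card_eid; case: (bn n).
- by move=> n; exact: eid_ordered.
- by move=> _ n; exact: eid_src_onto.
- by move=> n; exact: eid_rng_onto.
- by rewrite card_eid.
- move=> n; rewrite leqnn.
  have bo : ordered (arr B n) by case: (bn n).
  apply: eiso_trans (ecomp_idr bo) _.
  apply: eiso_sym; apply: eiso_trans (ecomp_idl _) _.
    by apply: ecomp_ordered => //; exact: epath_ordered.
  by rewrite epath_id; exact: ecomp_idl.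
Qed.

Definition pcomp (B C D : obd) (g : premorphism C D) (f : premorphism B C) :
  premorphism B D := Premorphism (precompP g f).

Definition pid (B : obd) : premorphism B B := Premorphism (preidP B).

Lemma pequiv_pcomp (B C D : obd) (g g' : premorphism C D) (f f' : premorphism B C) :
  pequiv g g' -> pequiv f f' -> pequiv (pcomp g f) (pcomp g' f').
Proof.
have bB := diagP B; have bC := diagP C; have bD := diagP D.
have half (h h' : premorphism C D) (k k' : premorphism B C) :
    dominated h h' -> dominated k k' -> dominated (pcomp h k) (pcomp h' k').
  move=> hh kk; apply: square_dominated => n.
  have [N HN] := hh (lev k n); have [M HM] := kk n.
  have [m Mm Nm] := lev_large k' N M.
  have [nm [klm sq]] := HM m Mm.
  have [_ [hlm sq']] := HN _ (ltnW Nm).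
  exists n, m; split=> //=.
  apply: eiso_trans (eiso_sym (ecompA _ _ _)) _.
  apply: eiso_trans (ecomp_iso sq (eiso_refl _)) _.
  apply: eiso_trans (ecompA _ _ _) _.
  apply: eiso_trans (ecomp_iso (eiso_refl _) sq') _.
  exact: eiso_sym (ecompA _ _ _).
move=> /pequivP[g1 g2] /pequivP[f1 f2]; apply/pequivP; split; exact: half.
Qed.

Lemma eid_square (V W : nat -> finType) k l (F G : eset (V k) (W l)) :
  ordered F -> ordered G -> G \iso F -> eid V k k \oe G \iso F \oe eid W l l.
Proof.
move=> oF oG GF; apply: eiso_trans (ecomp_idl oG) _.
exact: eiso_trans GF (eiso_sym (ecomp_idr oF)).
Qed.

Lemma pequiv_levelwise (B C : obd) (f g : premorphism B C) (l : nat -> nat)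
    (F G : forall n, eset (vert B n) (vert C (l n))) :
  prearr f = Prearrow F -> prearr g = Prearrow G ->
  (forall n, F n \iso G n) -> pequiv f g.
Proof.
move=> fE gE FG.
have oF : forall n, ordered (F n) by have := pre_ordered (prearrP f); rewrite fE.
have oG : forall n, ordered (G n) by have := pre_ordered (prearrP g); rewrite gE.
apply/pequivP; split; apply: square_dominated => n; exists n, n; split=> //;
  rewrite fE gE // !epath_id; apply: eid_square => //.
exact: eiso_sym.
Qed.

Lemma pequiv_pcompA (B C D E : obd) (h : premorphism D E) (g : premorphism C D)
    (f : premorphism B C) :
  pequiv (pcomp h (pcomp g f)) (pcomp (pcomp h g) f).
Proof.
apply: (@pequiv_levelwise _ _ (pcomp h (pcomp g f)) (pcomp (pcomp h g) f) _ _ _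
  erefl erefl) => n.
exact: ecompA.
Qed.

Lemma pequiv_pcompm1 (B C : obd) (f : premorphism B C) : pequiv (pcomp f (pid B)) f.
Proof.
case: f => [[l F] fP].
set f := Premorphism fP.
apply: (@pequiv_levelwise _ _ (pcomp f (pid B)) f _ _ _ erefl erefl) => n.
exact: ecomp_idl (pre_ordered fP n).
Qed.

Lemma pequiv_pcomp1m (B C : obd) (f : premorphism B C) : pequiv (pcomp (pid C) f) f.
Proof.
case: f => [[l F] fP].
set f := Premorphism fP.
apply: (@pequiv_levelwise _ _ (pcomp (pid C) f) f _ _ _ erefl erefl) => n.
exact: ecomp_idr (pre_ordered fP n).
Qed.

Record obd_hom (B C : obd) := ObdHom {
  class_of :> premorphism B C -> Prop;
  class_ofP : exists f : premorphism B C, class_of = (fun g => pequiv f g) }.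

Definition pclass (B C : obd) (f : premorphism B C) : obd_hom B C :=
  @ObdHom B C (fun g => pequiv f g) (ex_intro _ f erefl).

Definition repr (B C : obd) (F : obd_hom B C) : premorphism B C :=
  sval (cid (class_ofP F)).

Lemma pclassP (B C : obd) (f g : premorphism B C) :
  pclass f = pclass g <-> pequiv f g.
Proof.
split=> [[/(congr1 (fun A => A g)) /= ->]|fg]; first exact: pequiv_refl.
have E : (fun h : premorphism B C => pequiv f h) = (fun h => pequiv g h).
  apply: functional_extensionality_dep => h; apply: propositional_extensionality.
  split; [exact/pequiv_trans/pequiv_sym | exact: pequiv_trans].
rewrite /pclass; move: (ex_intro _ f _) (ex_intro _ g _) => /=.
by rewrite E => p q; congr ObdHom; exact: Prop_irrelevance.
Qed.

Lemma reprK (B C : obd) (F : obd_hom B C) : pclass (repr F) = F.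
Proof.
rewrite /repr; case: cid => f /=; case: F => F HF /= E.
rewrite /pclass; move: (ex_intro _ f _) => /=.
by subst F => p; congr ObdHom; exact: Prop_irrelevance.
Qed.

(* Independent of the representatives by [obd_compE]. *)
Definition obd_comp (B C D : obd) (G : obd_hom C D) (F : obd_hom B C) :
  obd_hom B D := pclass (pcomp (repr G) (repr F)).

Lemma obd_compE (B C D : obd) (g : premorphism C D) (f : premorphism B C) :
  obd_comp (pclass g) (pclass f) = pclass (pcomp g f).
Proof. by apply/pclassP/pequiv_pcomp; apply/pclassP; rewrite reprK. Qed.

Lemma obd_compm1 (B C : obd) (F : obd_hom B C) : obd_comp F (pclass (pid B)) = F.
Proof. by rewrite -[F]reprK obd_compE; apply/pclassP/pequiv_pcompm1. Qed.

Lemma obd_comp1m (B C : obd) (F : obd_hom B C) : obd_comp (pclass (pid C)) F = F.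
Proof. by rewrite -[F]reprK obd_compE; apply/pclassP/pequiv_pcomp1m. Qed.

Lemma obd_compmA (B C D E : obd) (H : obd_hom D E) (G : obd_hom C D)
    (F : obd_hom B C) :
  obd_comp H (obd_comp G F) = obd_comp (obd_comp H G) F.
Proof.
rewrite -[F]reprK -[G]reprK -[H]reprK !obd_compE.
by apply/pclassP/pequiv_pcompA.
Qed.

Definition OBD : category :=
  @Category obd obd_hom (fun B => pclass (pid B)) obd_comp
    obd_compm1 obd_comp1m obd_compmA.

End Premorphisms.

Record ipath (B : diagram) := IPath {
  ipath_edge :> forall n, arr B n;
  ipathP : forall n, rng _ (ipath_edge n) = src _ (ipath_edge n.+1) }.

Definition max_edge S T (F : eset S T) (e : F) : Prop :=
  forall e', ele F e e' -> e' = e.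
Definition min_edge S T (F : eset S T) (e : F) : Prop :=
  forall e', ele F e' e -> e' = e.
Definition succ_edge S T (F : eset S T) (e e' : F) : Prop :=
  [/\ ele F e e', e' != e &
      forall e'', ele F e e'' -> e'' != e -> ele F e' e''].

Definition max_path (B : diagram) (x : ipath B) : Prop := forall n, max_edge (x n).
Definition min_path (B : diagram) (x : ipath B) : Prop := forall n, min_edge (x n).

Definition properly_ordered (B : diagram) : Prop :=
  (exists! x : ipath B, max_path x) /\ (exists! x : ipath B, min_path x).

Definition OBDpo (strict : bool) : category :=
  @full_subcategory (OBD strict) (fun B : obd => properly_ordered B).

(* A tower is the sequence of its floors, from bottom to top.  A Kakutani-Rokhlin
   partition is given by its set of towers, which its set of floors need not determine. *)
Definition towers (X : Type) := {fset seq (set X)}.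

Section Towers.
Variable X : topologicalType.
Implicit Types P Q : towers X.

Definition top_of P : set X := [set x | exists2 T, T \in P & last set0 T x].
Definition bottom_of P : set X := [set x | exists2 T, T \in P & head set0 T x].

Record KR_partition (phi : X -> X) (x0 : X) P : Prop := {
  KR_height : forall T, T \in P -> T != [::];
  KR_clopen : forall T Z, T \in P -> Z \in T -> clopen Z /\ Z !=set0;
  KR_disjoint : forall S T i j, S \in P -> T \in P -> i < size S -> j < size T ->
    nth set0 S i `&` nth set0 T j !=set0 -> S = T /\ i = j;
  KR_cover : forall x : X, exists T Z, [/\ T \in P, Z \in T & Z x];
  KR_shift : forall T i, T \in P -> i.+1 < size T ->
    phi @` nth set0 T i = nth set0 T i.+1;
  KR_base : top_of P x0;
  KR_top : phi @` top_of P = bottom_of P }.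

Definition refines P Q : Prop :=
  forall T Y, T \in Q -> Y \in T -> exists S Z, [/\ S \in P, Z \in S & Y `<=` Z].

Record KR_system (phi : X -> X) (x0 : X) (R : nat -> towers X) : Prop := {
  KRs_0 : R 0 = [fset [:: setT]]%fset;
  KRs_part : forall n, KR_partition phi x0 (R n);
  KRs_refines : forall n, refines (R n) (R n.+1);
  KRs_top : forall n, 0 < n -> top_of (R n.+1) `<=` top_of (R n);
  KRs_cap : \bigcap_(n in [set n | 0 < n]) top_of (R n) = [set x0];
  KRs_basis : basis [set Z | exists n, exists2 T, T \in R n & Z \in T] }.

Definition metrizable : Prop :=
  exists d : X -> X -> Rdefinitions.R,
    [/\ forall x y, d x y = 0%R <-> x = y,
        forall x y, d x y = d y x,
        forall x y z, (d x z <= d x y + d y z)%R &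
        forall x, nbhs x = filter_from [set e | (0 < e)%R]
                                       (fun e => [set y | (d x y < e)%R])].

Definition homeomorphism (phi : X -> X) : Prop :=
  continuous phi /\
  exists psi : X -> X, [/\ continuous psi, cancel phi psi & cancel psi phi].

Definition closed_invariant (phi : X -> X) (A : set X) : Prop :=
  [/\ A !=set0, closed A & phi @` A = A].

Definition minimal_set (phi : X -> X) (A : set X) : Prop :=
  closed_invariant phi A /\ forall A', closed_invariant phi A' -> A' `<=` A -> A' = A.

Definition essentially_minimal (phi : X -> X) (x0 : X) : Prop :=
  exists M, [/\ minimal_set phi M, forall M', minimal_set phi M' -> M' = M & M x0].

End Towers.

Record system := System {
  space :> topologicalType;
  dyn : space -> space;
  base : space;
  parts : nat -> towers space }.

Record is_sds (X : system) : Prop := {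
  sds_metrizable : metrizable X;
  sds_compact : compact [set: X];
  sds_tdisc : totally_disconnected [set: X];
  sds_homeo : homeomorphism (@dyn X);
  sds_minimal : essentially_minimal (@dyn X) (base X);
  sds_parts : KR_system (@dyn X) (base X) (parts X) }.

Record sds := Sds { sys :> system; sysP : is_sds sys }.

Record sds_hom (strict : bool) (X Y : sds) := SdsHom {
  sds_map :> X -> Y;
  sds_map_cont : continuous sds_map;
  sds_map_dyn : forall x, sds_map (dyn x) = dyn (sds_map x);
  sds_map_base : sds_map (base X) = base Y;
  sds_map_onto : strict -> forall y, exists x, sds_map x = y }.

Section SdsCategory.
Variable strict : bool.

Lemma sds_homP (X Y : sds) (f g : sds_hom strict X Y) : f =1 g -> f = g.
Proof.
case: f g => [f a b c d] [g a' b' c' d'] /= /funext fg; subst g.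
by congr SdsHom; exact: Prop_irrelevance.
Qed.

Definition sds_id (X : sds) : sds_hom strict X X :=
  @SdsHom strict X X id (fun x => cvg_id) (fun=> erefl) erefl
    (fun _ y => ex_intro _ y erefl).

Lemma sds_comp_cont (X Y Z : sds) (g : sds_hom strict Y Z) (f : sds_hom strict X Y) :
  continuous (g \o f).
Proof. by move=> x; apply: continuous_comp; exact: sds_map_cont. Qed.

Lemma sds_comp_dyn (X Y Z : sds) (g : sds_hom strict Y Z) (f : sds_hom strict X Y) x :
  (g \o f) (dyn x) = dyn ((g \o f) x).
Proof. by rewrite /= !sds_map_dyn. Qed.

Lemma sds_comp_base (X Y Z : sds) (g : sds_hom strict Y Z) (f : sds_hom strict X Y) :
  (g \o f) (base X) = base Z.
Proof. by rewrite /= !sds_map_base. Qed.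

Lemma sds_comp_onto (X Y Z : sds) (g : sds_hom strict Y Z) (f : sds_hom strict X Y) :
  strict -> forall z, exists x, (g \o f) x = z.
Proof.
move=> s z; have [y <-] := sds_map_onto g s z; have [x <-] := sds_map_onto f s y.
by exists x.
Qed.

Definition sds_comp (X Y Z : sds) (g : sds_hom strict Y Z) (f : sds_hom strict X Y) :
  sds_hom strict X Z :=
  SdsHom (@sds_comp_cont X Y Z g f) (@sds_comp_dyn X Y Z g f)
    (@sds_comp_base X Y Z g f) (@sds_comp_onto X Y Z g f).

Lemma sds_compm1 (X Y : sds) (f : sds_hom strict X Y) : sds_comp f (sds_id X) = f.
Proof. exact: sds_homP. Qed.

Lemma sds_comp1m (X Y : sds) (f : sds_hom strict X Y) : sds_comp (sds_id Y) f = f.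
Proof. exact: sds_homP. Qed.

Lemma sds_compmA (X Y Z W : sds) (h : sds_hom strict Z W) (g : sds_hom strict Y Z)
    (f : sds_hom strict X Y) :
  sds_comp h (sds_comp g f) = sds_comp (sds_comp h g) f.
Proof. exact: sds_homP. Qed.

Definition SDS : category :=
  @Category sds (sds_hom strict) sds_id sds_comp sds_compm1 sds_comp1m sds_compmA.

End SdsCategory.

(* The triples [(i, T, k)] with [Y_(k+j)] contained in [Z_j] for all [j], where
   [tow i = (Z_1, ..., Z_n)] and [T = (Y_1, ..., Y_m)] is in [Q]; such a [k] is less
   than [m].  Floors are numbered from 0 here. *)
Definition tower_edges (X : Type) (I : finType) (tow : I -> seq (set X))
    (Q : towers X) : eset I Q :=
  @ESet I Q
    {t : I * {T : Q & 'I_(size (val T))} |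
      let Z := tow t.1 in let Y := val (tag t.2) in let k := tagged t.2 : nat in
      `[< k + size Z <= size Y /\
          forall j, j < size Z -> nth set0 Y (k + j) `<=` nth set0 Z j >]}
    (fun t => (val t).1) (fun t => tag (val t).2)
    (fun t t' => (tag (val t).2 == tag (val t').2) &&
                 (tagged (val t).2 <= tagged (val t').2)).

Definition Pdiagram (X : system) : diagram :=
  @Diagram (fun n => parts X n : finType)
    (fun n => tower_edges (fun S : parts X n => val S) (parts X n.+1)).

Definition preimage_tower X Y (alpha : X -> Y) (S : seq (set Y)) : seq (set X) :=
  [seq alpha @^-1` Z | Z <- S].

(* When [alpha] is not onto, some of these towers may consist of empty sets. *)
Definition preimage_towers X Y (alpha : X -> Y) (Q : towers Y) : towers X :=
  [fset preimage_tower alpha S | S in Q]%fset.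

Definition admissible (X Y : system) (alpha : X -> Y) (f : nat -> nat) : Prop :=
  [/\ f 0 = 0, forall n, f n <= f n.+1, forall N, exists n, N <= f n,
      forall n, refines (preimage_towers alpha (parts Y n)) (parts X (f n)) &
      forall n, top_of (parts X (f n)) `<=` top_of (preimage_towers alpha (parts Y n))].

Definition Parrow (X Y : system) (alpha : X -> Y) (f : nat -> nat) :
  prearrow (Pdiagram Y) (Pdiagram X) :=
  @Prearrow (Pdiagram Y) (Pdiagram X) f
    (fun n => tower_edges (fun S : parts Y n => preimage_tower alpha (val S))
                          (parts X (f n))).

Fixpoint begins (B : diagram) (x : ipath B) (n : nat) : epath B 0 n -> Prop :=
  match n with
  | 0 => fun _ => True
  | m.+1 => fun p => begins x (val p).1 /\ x m = (val p).2
  end.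

Definition cylinder (B : diagram) n (p : epath B 0 n) : set (ipath B) :=
  [set x | begins x p].

Lemma begins_eq (B : diagram) (x y : ipath B) n (p : epath B 0 n) :
  begins x p -> (begins y p <-> forall i, i < n -> y i = x i).
Proof.
elim: n p => [|n IHn] //= p [xp xn]; rewrite (IHn _ xp); split.
  move=> [yx yn] i; rewrite ltnS leq_eqVlt => /predU1P[->|]; last exact: yx.
  by rewrite yn -xn.
by move=> yx; split=> [i ilt|]; rewrite -?xn yx // ltnW.
Qed.

Section PathSpace.
Variable B : diagram.

Definition ipath_open (A : set (ipath B)) : Prop :=
  forall x, A x -> exists n (p : epath B 0 n), cylinder p x /\ cylinder p `<=` A.

Lemma ipath_openT : ipath_open setT.
Proof.
move=> x _; exists 0; exists (exist _ (src _ (x 0), src _ (x 0)) (eqxx _)).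
by split.
Qed.

Lemma ipath_openI : setI_closed ipath_open.
Proof.
move=> A A' oA oA' x [Ax A'x].
have [n [p [px pA]]] := oA x Ax; have [m [q [qx qA]]] := oA' x A'x.
case: (leqP n m) => [nm|/ltnW mn]; [exists m; exists q | exists n; exists p].
  split=> // y qy; split; last exact: qA.
  apply: pA; apply/(begins_eq y px) => i im.
  exact: ((begins_eq y qx).1 qy) (leq_trans im nm).
split=> // y py; split; first exact: pA.
apply: qA; apply/(begins_eq y qx) => i im.
exact: ((begins_eq y px).1 py) (leq_trans im mn).
Qed.

Lemma ipath_open_bigU (I : Type) (f : I -> set (ipath B)) :
  (forall i, ipath_open (f i)) -> ipath_open (\bigcup_i f i).
Proof.
move=> of_ x [i _ /(of_ i)[n [p [px pf]]]]; exists n; exists p; split=> //.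
by move=> y /pf fy; exists i.
Qed.

HB.instance Definition _ := gen_eqMixin (ipath B).
HB.instance Definition _ := gen_choiceMixin (ipath B).
HB.instance Definition _ :=
  isOpenTopological.Build (ipath B) ipath_openT ipath_openI ipath_open_bigU.

Definition vershik_spec (x y : ipath B) : Prop :=
  (max_path x /\ min_path y) \/
  exists k,
    [/\ forall i, i < k -> max_edge (x i) /\ min_edge (y i),
        ~ max_edge (x k), succ_edge (x k) (y k) &
        forall i, k < i -> y i = x i].

Definition vershik (x : ipath B) : ipath B := xget x (vershik_spec x).

(* The floors of [T_v], in the order of the edges of [epath B 0 n] with range [v]. *)
Definition Vtower n (v : vert B n) : seq (set (ipath B)) :=
  [seq cylinder p | p <- sort (ele (epath B 0 n))
                              [seq p <- enum (epath B 0 n) | rng _ p == v]].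

(* For [n = 0] the only cylinder is the whole space. *)
Definition Vparts n : towers (ipath B) := [fset Vtower v | v in vert B n]%fset.

Lemma Vtower_mem n (v : vert B n) : Vtower v \in Vparts n.
Proof. exact: in_imfset. Qed.

End PathSpace.

Definition xmax (B : diagram) (poB : properly_ordered B) : ipath B :=
  sval (cid poB.1).

Definition Vsystem (B : diagram) (poB : properly_ordered B) : system :=
  @System (ipath B) (@vershik B) (xmax poB) (@Vparts B).

Definition tau_arrow (B : diagram) (poB : properly_ordered B) :
  prearrow B (Pdiagram (Vsystem poB)) :=
  @Prearrow B (Pdiagram (Vsystem poB)) id
    (fun n => @ESet (vert B n) (Vparts B n) (vert B n) id
                (fun v => [` Vtower_mem v]%fset) (fun v w => v == w)).

Definition P_well_defined : Prop := forall X : sds,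
  ordered_bratteli (Pdiagram X) /\ properly_ordered (Pdiagram X).

Definition V_well_defined : Prop :=
  forall (B : obd) (poB : properly_ordered B), is_sds (Vsystem poB).

Section Equivalence.
Variables (strict : bool) (HP : P_well_defined) (HV : V_well_defined).

Definition Pob (X : SDS strict) : OBDpo strict :=
  exist _ (Obd (HP X).1) (HP X).2.

Definition Vob (B : OBDpo strict) : SDS strict := Sds (HV (svalP B)).

Variables (P : cofunctor Pob) (V : cofunctor Vob).
Variable tau : forall B : OBDpo strict, iso B (Pob (Vob B)).
Variable sigma : forall X : SDS strict, iso X (Vob (Pob X)).

Definition P_spec : Prop := forall (X Y : SDS strict) (alpha : hom X Y),
  (exists f, @admissible X Y (sds_map alpha) f) /\
  forall f, @admissible X Y (sds_map alpha) f ->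
    exists Hf : is_premorphism strict (@Parrow X Y (sds_map alpha) f),
      fmap P alpha = pclass (@Premorphism strict (sval (Pob Y)) (sval (Pob X)) _ Hf).

Definition tau_spec : Prop := forall B : OBDpo strict,
  exists Hf : is_premorphism strict (tau_arrow (svalP B)),
    iso_hom (tau B) =
    pclass (@Premorphism strict (sval B) (sval (Pob (Vob B))) _ Hf).

Definition V_spec : Prop := forall (B C : OBDpo strict) (h : hom B C),
  fmap P (fmap V h) = tau C \oc h \oc iso_inv (tau B) /\
  forall alpha : hom (Vob C) (Vob B),
    fmap P alpha = tau C \oc h \oc iso_inv (tau B) -> alpha = fmap V h.

Definition sigma_spec : Prop := forall X : SDS strict,
  fmap P (sigma X) = iso_inv (tau (Pob X)) /\
  forall s : iso X (Vob (Pob X)),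
    fmap P s = iso_inv (tau (Pob X)) -> iso_hom s = sigma X.

End Equivalence.

(* Main.v *)
(* An ordered edge set is determined up to isomorphism by its words: for each vertex of
   the target, the list of the sources of its incoming edges, in order.  Composition of
   edge sets is substitution of words.  The word of a tower [T] in the edge set between
   two Kakutani-Rokhlin partitions is the itinerary of [T], the only sequence of coarse
   towers whose concatenation contains [T] floor by floor, so all squares built from
   such edge sets commute because both sides spell an itinerary.

   The functor [P] is faithful because the itineraries at all levels determine the image
   of a point.  It is full because a premorphism assigns to each floor of [X] a floor of
   [Y] at every level; these floors are nested, and by compactness they shrink to the
   image of a point.  Since [tau] is an isomorphism, [V] and [sigma] then come out
   formally.  The Vershik map sends [x] to [y] exactly if, at every level, the initial
   path of [y] is the successor of that of [x], or that of [x] is maximal and that of [y]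
   minimal. *)
From HB Require Import structures.
From mathcomp Require Import all_boot all_order all_algebra finmap.
From mathcomp Require Import boolp classical_sets functions reals topology.
From mathcomp Require Import Rstruct.
Require Import Defs.

Set Implicit Arguments.
Unset Strict Implicit.
Unset Printing Implicit Defensive.

Local Open Scope classical_set_scope.
Import Order.TTheory GRing.Theory Num.Theory.

(** * Words of ordered edge sets *)

(** If a morphism is not onto, the preimages of the towers of [Y] need not form a Kakutani-Rokhlin
    partition: floors may be empty, and distinct towers may have equal preimages. Itineraries are
    therefore developed for [tower_family], which is indexed and whose conditions are pointwise, so
    that they survive taking preimages. Nonempty floors are required of the fine towers only, and
    this already makes readings unique. In the proof [strict] enters through the source condition
    and surjectivity, each derived from the other in [Parrow_premorphism] and [limit_map_onto].

    The delicate point of fullness is equivariance of the limit map. At one level, an itinerary does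
    not tell where the dynamics leads from the end of a coarse tower, only that a top floor is
    followed by a bottom floor. If this happens at cofinally many levels, the point and its
    successor are pinned down by the intersections of the tops and of the bottoms; otherwise all
    fine enough levels determine the successor. *)

Definition fibre S T (F : eset S T) (t : T) : seq F :=
  sort (ele F) [seq e <- enum F | rng F e == t].

Definition word S T (F : eset S T) (t : T) : seq S := [seq src F e | e <- fibre F t].

Section Fibres.
Variables (S T : finType) (F : eset S T).
Implicit Types (e : F) (t : T).

Lemma mem_fibre e t : (e \in fibre F t) = (rng F e == t).
Proof. by rewrite mem_sort mem_filter mem_enum andbT. Qed.

Lemma fibre_uniq t : uniq (fibre F t).
Proof. by rewrite sort_uniq filter_uniq // enum_uniq. Qed.

Lemma mem_word s t : reflect (exists2 e, src F e = s & rng F e = t) (s \in word F t).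
Proof.
apply: (iffP mapP) => [[e]|[e <- et]].
  by rewrite mem_fibre => /eqP et ->; exists e.
by exists e => //; rewrite mem_fibre et.
Qed.

Lemma src_onto_word : src_onto F <-> forall s, exists t, s \in word F t.
Proof.
split=> H s; first by have [e es] := H s; exists (rng F e); apply/mem_word; exists e.
by have [t /mem_word[e es et]] := H s; exists e.
Qed.

Lemma rng_onto_word : rng_onto F <-> forall t, word F t != [::].
Proof.
split=> H t.
  have [e et] := H t; apply/negP => /eqP w0.
  by have: src F e \in word F t by [apply/mem_word; exists e]; rewrite w0.
case E: (word F t) (H t) => [//|s w] _.
have /mem_word[e es et] : s \in word F t by rewrite E mem_head.
by exists e.
Qed.

Hypothesis oF : ordered F.

Lemma fibre_sorted t : sorted (ele F) (fibre F t).
Proof.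
case: oF => rF aF tF cF.
apply: (sort_sorted_in (P := [pred e | rng F e == t])).
  by move=> e e' /eqP et /eqP et'; rewrite cF et et'.
by apply/allP => e; rewrite mem_filter => /andP[].
Qed.

Lemma fibre_eq t (L : seq F) : uniq L -> sorted (ele F) L ->
  (forall e, (e \in L) = (rng F e == t)) -> fibre F t = L.
Proof.
case: oF => rF aF tF cF uL sL mL; apply: (sorted_eq tF aF (fibre_sorted t) sL).
by apply: uniq_perm => // [|e]; rewrite ?fibre_uniq // mem_fibre mL.
Qed.

Lemma ele_index t e e' : rng F e = t -> rng F e' = t ->
  ele F e e' = (index e (fibre F t) <= index e' (fibre F t)).
Proof.
case: oF => rF aF tF cF et e't.
have me : e \in fibre F t by rewrite mem_fibre et.
have me' : e' \in fibre F t by rewrite mem_fibre e't.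
have st := fibre_sorted t.
apply/idP/idP => [le|]; last exact: (sorted_leq_index tF rF st _ _ me me').
rewrite leqNgt; apply/negP => lt; have le' := sorted_ltn_index tF st _ _ me' me lt.
have E : e = e' by apply: aF; rewrite le le'.
by rewrite E ltnn in lt.
Qed.

End Fibres.

(** The order leaves no choice: edges over [t] must correspond by their position in [fibre].
    Equality of words says that the two fibres have the same length and that edges in the same
    position have the same source. *)
Lemma word_iso S T (F G : eset S T) : ordered F -> ordered G ->
  F \iso G <-> forall t, word F t = word G t.
Proof.
move=> oF oG; have [_ aF _ cF] := oF; have [_ aG tG cG] := oG; split.
  move=> [f [[f' K1 K2] hs hr he]] t.
  rewrite /word (_ : fibre G t = map f (fibre F t)).
    by rewrite -map_comp; apply: eq_map => e /=; rewrite hs.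
  apply: fibre_eq => //.
  - by rewrite map_inj_uniq ?fibre_uniq //; exact: can_inj K1.
  - rewrite sorted_map; have := fibre_sorted oF t; apply: sub_sorted => e e' /=.
    by rewrite he.
  - move=> g; rewrite -[g]K2 mem_map ?mem_fibre ?hr //; exact: can_inj K1.
move=> FG.
have sz t : size (fibre F t) = size (fibre G t).
  by have := congr1 size (FG t); rewrite !size_map.
have idx e : index e (fibre F (rng F e)) < size (fibre F (rng F e)).
  by rewrite index_mem mem_fibre.
have idxG g : index g (fibre G (rng G g)) < size (fibre G (rng G g)).
  by rewrite index_mem mem_fibre.
have ex e : exists g : G, [/\ rng G g = rng F e, src G g = src F e &
    index g (fibre G (rng G g)) = index e (fibre F (rng F e))].
  have lt := idx e; have ltG := lt; rewrite sz in ltG.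
  have : index e (fibre F (rng F e)) < size (fibre G (rng F e)) by [].
  case E : (fibre G (rng F e)) ltG => [//|g0 s] ltG _; rewrite -E in ltG.
  exists (nth g0 (fibre G (rng F e)) (index e (fibre F (rng F e)))).
  have gr : rng G (nth g0 (fibre G (rng F e)) (index e (fibre F (rng F e)))) = rng F e.
    by apply/eqP; rewrite -mem_fibre mem_nth.
  rewrite gr index_uniq ?fibre_uniq //; split=> //.
  rewrite -(nth_map g0 (src F e) (src G)) // -/(word G _) -FG.
  by rewrite (nth_map e) // nth_index // mem_fibre.
have [phi Hphi] := choice ex.
apply: (@eisoI _ _ F G phi).
- move=> e e' E; have [r _ i] := Hphi e; have [r' _ i'] := Hphi e'.
  have rr : rng F e = rng F e' by rewrite -r -r' E.
  have : index e (fibre F (rng F e)) = index e' (fibre F (rng F e)).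
    by rewrite -i [in RHS]rr -i' E.
  by apply: (index_inj e); rewrite mem_fibre // rr.
- move=> g; have lt := idxG g; rewrite -sz in lt.
  case E : (fibre F (rng G g)) (lt) => [//|e0 s] _.
  pose e := nth e0 (fibre F (rng G g)) (index g (fibre G (rng G g))).
  have er : rng F e = rng G g by apply/eqP; rewrite -mem_fibre mem_nth.
  have [r _ i] := Hphi e; exists e.
  rewrite r er [in RHS]index_uniq ?fibre_uniq // in i.
  by apply: (index_inj g) i; rewrite mem_fibre // r er.
- by move=> e; have [] := Hphi e.
- by move=> e; have [] := Hphi e.
- move=> e e'; have [r _ i] := Hphi e; have [r' _ i'] := Hphi e'.
  case: (eqVneq (rng F e) (rng F e')) => rr.
    have rG : rng G (phi e') = rng G (phi e) by rewrite r r'.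
    rewrite (ele_index oF (erefl _) (esym rr)) (ele_index oG (erefl _) rG) i.
    by rewrite -rG i' -rr.
  have N1 : ele F e e' = false.
    by apply: contraNF rr => le; rewrite -cF le.
  rewrite N1; apply: contraNF rr => le; by rewrite -r -r' -cG le.
Qed.

(** Both lists have the same members and are sorted for [lex], the order of [F \oe G] extended to
    all pairs, composable or not. Since [lex] is transitive and antisymmetric, they coincide. *)
Lemma fibre_comp S T U (F : eset S T) (G : eset T U) u : ordered F -> ordered G ->
  [seq val p | p <- fibre (F \oe G) u] =
  [seq (e, g) | g <- fibre G u, e <- fibre F (src G g)].
Proof.
move=> oF oG; have [rF aF tF cF] := oF; have [rG aG tG cG] := oG.
pose lex (p q : F * G) :=
  (p.2 != q.2) && ele G p.2 q.2 || (p.2 == q.2) && ele F p.1 q.1.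
have lexA : antisymmetric lex.
  move=> [a b] [c d]; rewrite /lex /= [d == b]eq_sym.
  case: (eqVneq b d) => [->|bd] /=; first by move=> /aF ->.
  by rewrite !orbF => /aG E; rewrite E eqxx in bd.
have lexT : transitive lex.
  move=> [c d] [a b] [e f]; rewrite /lex /=.
  case: (eqVneq b d) => [->|bd] /=.
    by case: (eqVneq d f) => [_|_ _] //=; exact: tF.
  rewrite orbF => lbd.
  case: (eqVneq d f) => [<- _|df] /=; first by rewrite bd lbd.
  rewrite orbF => ldf; rewrite (tG _ _ _ lbd ldf) andbT.
  case: (eqVneq b f) => //= bf; subst f.
  by case/eqP: bd; apply: aG; rewrite lbd ldf.
pose L := [seq (e, g) | g <- fibre G u, e <- fibre F (src G g)].
rewrite -/L; have oFG := ecomp_ordered oF oG.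
apply: (sorted_eq lexT lexA).
- by rewrite sorted_map; exact: fibre_sorted.
- rewrite /L; have := fibre_uniq G u; have := fibre_sorted oG u.
  rewrite !sorted_pairwise // uniq_pairwise.
  elim: (fibre G u) => //= g s IHs /andP[gs ss] /andP[us uss].
  rewrite pairwise_cat IHs // andbT; apply/andP; split.
    apply/allrelP => p q /mapP[e _ ->] /allpairsPdep[g' [e' [g's _ ->]]].
    by rewrite /lex /=; have /= -> := allP us _ g's; rewrite (allP gs _ g's).
  rewrite -sorted_pairwise // sorted_map.
  have := fibre_sorted oF (src G g); apply: sub_sorted => e e' /=.
  by rewrite /lex /= eqxx.
- apply: uniq_perm; first by rewrite (map_inj_uniq val_inj); exact: fibre_uniq.
    apply: allpairs_uniq_dep; rewrite ?fibre_uniq //.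
      by move=> g _; exact: fibre_uniq.
    by move=> [g e] [g' e'] _ _ /= [-> ->].
  move=> [e g]; apply/mapP/allpairsPdep.
    move=> [p pu E]; exists g, e; have Hp := valP p; rewrite -E /= in Hp.
    by have := mem_fibre (p : F \oe G) u; rewrite pu !mem_fibre /= -E Hp => /esym.
  move=> [g' [e' [+ + [-> ->]]]]; rewrite !mem_fibre => gu eg.
  exists (exist _ (e', g') eg : F \oe G) => //.
  by have -> := mem_fibre (exist _ (e', g') eg : F \oe G) u.
Qed.

Lemma word_comp S T U (F : eset S T) (G : eset T U) u : ordered F -> ordered G ->
  word (F \oe G) u = flatten [seq word F t | t <- word G u].
Proof.
move=> oF oG.
have -> : word (F \oe G) u = [seq src F p.1 | p <- [seq val p | p <- fibre (F \oe G) u]].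
  by rewrite -map_comp.
rewrite fibre_comp // map_flatten -map_comp /word -!map_comp; congr flatten.
by apply: eq_map => g /=; rewrite -map_comp.
Qed.

Lemma word_eid (V : nat -> finType) k (v : V k) : word (eid V k k) v = [:: v].
Proof.
have Q : Tagged (fun n => V n : Type) (v, v).1 == Tagged (fun n => V n : Type) (v, v).2.
  by [].
rewrite /word (@fibre_eq _ _ (eid V k k) _ v [:: exist _ (v, v) Q : eid V k k]) //.
  exact: eid_ordered.
move=> p; rewrite inE -val_eqE; move: (eid_rngE p); case: p => [[a b] i] /= ->.
by rewrite xpair_eqE andbb.
Qed.

Lemma epath_onto_word (B : diagram) k l v : ordered_bratteli B -> k <= l ->
  word (epath B k l) v != [::].
Proof. by move=> bB kl; apply: (rng_onto_word _).1; exact: epath_rng_onto. Qed.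

(** * Itineraries of towers *)

Definition floorwise X (Y Z : seq (set X)) : Prop :=
  size Y = size Z /\ forall i, i < size Y -> nth set0 Y i `<=` nth set0 Z i.

(** The defining property of an itinerary [w] of [Y]. As a mere family of inclusions it can be
    substituted ([reads_flatten]) and pulled back along a map ([reads_preimage]); uniqueness comes
    separately, in [reads_unique]. *)
Definition reads X I (tow : I -> seq (set X)) (w : seq I) (Y : seq (set X)) : Prop :=
  floorwise Y (flatten [seq tow i | i <- w]).

Section Readings.
Variable X : Type.
Implicit Types (Y Z : seq (set X)).

Lemma floorwise_refl Y : floorwise Y Y. Proof. by split=> // i _ x. Qed.

Lemma floorwise_trans Y Z W : floorwise Y Z -> floorwise Z W -> floorwise Y W.
Proof.
move=> [s1 h1] [s2 h2]; split; first by rewrite s1 s2.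
by move=> i iY; apply: subset_trans (h1 i iY) (h2 i _); rewrite -s1.
Qed.

Lemma floorwise_cat Y Y' Z Z' :
  floorwise Y Z -> floorwise Y' Z' -> floorwise (Y ++ Y') (Z ++ Z').
Proof.
move=> [s1 h1] [s2 h2]; split; first by rewrite !size_cat s1 s2.
move=> i; rewrite size_cat => iYY; rewrite !nth_cat -s1.
case: (ltnP i (size Y)) => iY; first exact: h1.
by apply: h2; rewrite ltn_subLR.
Qed.

Lemma floorwise_drop k Y Z : floorwise Y Z -> floorwise (drop k Y) (drop k Z).
Proof.
move=> [s h]; split; first by rewrite !size_drop s.
by move=> i; rewrite size_drop !nth_drop ltn_subRL => ?; exact: h.
Qed.

(** The counterpart of [word_comp] for itineraries: both are substitution, so words of composites
    are itineraries as soon as the words of the factors are. *)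
Lemma reads_flatten I J (tow : I -> seq (set X)) (tow' : J -> seq (set X))
    (W : J -> seq I) (w : seq J) Y :
  (forall j, reads tow (W j) (tow' j)) -> reads tow' w Y ->
  reads tow (flatten [seq W j | j <- w]) Y.
Proof.
move=> HW rY; apply: floorwise_trans rY _; elim: w => [|j w IHw] /=; first exact: floorwise_refl.
by rewrite map_cat flatten_cat; apply: floorwise_cat => //; exact: HW.
Qed.

Lemma reads_preimage X' (alpha : X' -> X) I (tow : I -> seq (set X)) w Y :
  reads tow w Y ->
  reads (fun i => preimage_tower alpha (tow i)) w (preimage_tower alpha Y).
Proof.
rewrite /reads => [[s h]].
have E : flatten [seq preimage_tower alpha (tow i) | i <- w] =
    preimage_tower alpha (flatten [seq tow i | i <- w]).
  by rewrite /preimage_tower map_flatten -map_comp.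
rewrite E; split; first by rewrite !size_map.
move=> i; rewrite size_map => iY; rewrite !(nth_map set0) -?s //.
by apply: preimage_subset; exact: h.
Qed.

Section Offsets.
Variables (I : eqType) (tow : I -> seq (set X)).
Hypothesis tow0 : forall i, tow i != [::].

Lemma size_gt0 i : 0 < size (tow i).
Proof. by rewrite lt0n size_eq0. Qed.

(** The blocks of [w] with their starting positions. In [reads_word] this list is matched with the
    edges into a tower, each given by its source and its offset. *)
Fixpoint offsets (k : nat) (w : seq I) : seq (I * nat) :=
  if w is i :: w' then (i, k) :: offsets (k + size (tow i)) w' else [::].

Lemma offsets_fst k w : [seq p.1 | p <- offsets k w] = w.
Proof. by elim: w k => //= i w IHw k; rewrite IHw. Qed.

Lemma offsets_sorted k w : sorted (fun p q : I * nat => p.2 < q.2) (offsets k w).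
Proof.
have P p w' : path (fun p q : I * nat => p.2 < q.2) p
    (offsets (p.2 + size (tow p.1)) w').
  elim: w' p => //= i w' IHw p; apply/andP; split=> /=.
    by rewrite -addn1 leq_add2l size_gt0.
  exact: (IHw (i, _)).
by case: w => //= i w; exact: (P (i, k)).
Qed.

Lemma mem_offsets k w i l : (i, l) \in offsets k w <-> exists u v,
  w = u ++ i :: v /\ l = k + size (flatten [seq tow j | j <- u]).
Proof.
elim: w k l => /= [|j w IHw] k l; first by split=> // -[[|? ?] [? []]].
rewrite inE; split.
  case/orP => [/eqP[-> ->]|/(IHw _ _).1[u [v [-> ->]]]].
    by exists [::], w; rewrite addn0.
  by exists (j :: u), v; rewrite /= size_cat addnA.
move=> [[|j' u] [v [/= [-> Ew] ->]]].
  by rewrite addn0 eqxx.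
by apply/orP; right; apply: (IHw _ _).2; exists u, v; rewrite size_cat addnA.
Qed.

End Offsets.

Lemma flatten_pos I (tow : I -> seq (set X)) w k :
  k < size (flatten [seq tow i | i <- w]) -> exists u i v l,
  [/\ w = u ++ i :: v, l < size (tow i) &
      k = size (flatten [seq tow i | i <- u]) + l].
Proof.
elim: w k => //= i w IHw k; rewrite size_cat.
case: (ltnP k (size (tow i))) => [ki _|ki kw]; first by exists [::], i, w, k.
have [|u [i' [v [l [-> li E]]]]] := IHw (k - size (tow i)).
  by rewrite ltn_subLR.
exists (i :: u), i', v, l; split=> //=.
by rewrite size_cat -addnA -E subnKC.
Qed.

Lemma nth_flatten_pos I (tow : I -> seq (set X)) u i v l : l < size (tow i) ->
  nth set0 (flatten [seq tow i | i <- u ++ i :: v])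
    (size (flatten [seq tow i | i <- u]) + l) = nth set0 (tow i) l.
Proof.
move=> li; rewrite map_cat flatten_cat nth_cat ltnNge leq_addr /= addKn.
by rewrite nth_cat li.
Qed.

End Readings.

Definition ftop X I (tow : I -> seq (set X)) : set X := [set x | exists i, last set0 (tow i) x].
Definition fbot X I (tow : I -> seq (set X)) : set X := [set x | exists i, head set0 (tow i) x].

(* What remains of [KR_partition] for the towers of a preimage partition, indexed
   because several towers may become the same sequence of empty sets. *)
Record tower_family X (phi : X -> X) I (tow : I -> seq (set X)) : Prop := {
  tf_height : forall i, tow i != [::];
  tf_disjoint : forall i j k l x, k < size (tow i) -> l < size (tow j) ->
    nth set0 (tow i) k x -> nth set0 (tow j) l x -> i = j /\ k = l;
  tf_shift : forall i k x, k.+1 < size (tow i) ->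
    nth set0 (tow i) k x -> nth set0 (tow i) k.+1 (phi x);
  tf_top : forall x, ftop tow x -> fbot tow (phi x) }.

Section TowerFamily.
Variables (X : Type) (phi : X -> X) (I : eqType) (tow : I -> seq (set X)).
Hypothesis tf : tower_family phi tow.

Lemma tf_size i : 0 < size (tow i).
Proof. by rewrite lt0n size_eq0; exact: tf_height tf i. Qed.

(** A point of the first floor of [Y] lies in the bottom floors of the first towers of both words,
    so these towers agree; dropping their common length leaves a shorter instance. *)
Lemma reads_unique w w' Y : (forall i, i < size Y -> nth set0 Y i !=set0) ->
  reads tow w Y -> reads tow w' Y -> w = w'.
Proof.
elim: w w' Y => [|i w IHw] [|j w'] Y Y0 //.
- by move=> [/= s _] [/=]; rewrite s size_cat; have := tf_size j; case: size.
- by move=> [/= + _] [/= s _]; rewrite s size_cat; have := tf_size i; case: size.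
move=> r r'.
have Ygt0 : 0 < size Y by case: r => /= -> _; rewrite size_cat ltn_addr // tf_size.
have [x Yx] := Y0 0 Ygt0.
have [ij _] : i = j /\ 0 = 0.
  have /= := r.2 0 Ygt0 _ Yx; have /= := r'.2 0 Ygt0 _ Yx.
  rewrite !nth_cat !tf_size => xj xi.
  exact: (tf_disjoint tf (tf_size i) (tf_size j) xi xj).
subst j; congr (_ :: _).
apply: (IHw _ (drop (size (tow i)) Y)).
- by move=> k; rewrite size_drop nth_drop ltn_subRL; exact: Y0.
- by have := floorwise_drop (size (tow i)) r; rewrite /= drop_size_cat.
- by have := floorwise_drop (size (tow i)) r'; rewrite /= drop_size_cat.
Qed.

(** The word is found greedily. A floor of [Y] inside the bottom of a coarse tower is followed by
    floors that climb this tower to its top, and from there the dynamics leads into the bottom of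
    the family, where the next tower starts. *)
Lemma reads_exist Y : (forall i, i < size Y -> nth set0 Y i !=set0) ->
  (forall i x, i.+1 < size Y -> nth set0 Y i x -> nth set0 Y i.+1 (phi x)) ->
  (forall i, i < size Y -> exists j k, k < size (tow j) /\
    nth set0 Y i `<=` nth set0 (tow j) k) ->
  head set0 Y `<=` fbot tow -> last set0 Y `<=` ftop tow ->
  exists w, reads tow w Y.
Proof.
move=> Y0 Yphi Yref Yb Yt.
(* A floor of [Y] lies in some coarse floor, and any one of its points decides in which. *)
have inside i j k x : i < size Y -> nth set0 Y i x -> k < size (tow j) ->
    nth set0 (tow j) k x -> nth set0 Y i `<=` nth set0 (tow j) k.
  move=> iY Yx kj jx; have [j' [k' [k'j' sub]]] := Yref i iY.
  by have [-> ->] := tf_disjoint tf kj k'j' jx (sub _ Yx).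
(* [Y] cannot end strictly inside the tower [j]: its last floor lies in [ftop tow], so by
   disjointness it would be the top floor of [j]. *)
have block k j : k < size Y -> nth set0 Y k `<=` head set0 (tow j) ->
    forall l, l < size (tow j) -> k + l < size Y /\
      nth set0 Y (k + l) `<=` nth set0 (tow j) l.
  move=> kY sub; elim=> [|l IHl] lj; first by rewrite addn0 nth0.
  have [klY kl] := IHl (ltnW lj); have [x Yx] := Y0 _ klY.
  have klY' : k + l.+1 < size Y.
    rewrite addnS ltn_neqAle klY andbT; apply/eqP => E.
    have /Yt[j'] : last set0 Y x by rewrite (last_nth set0) -E.
    rewrite (last_nth set0); have := tf_size j'; case S : (size _) => [//|n] _ /= xj'.
    have nj' : n < size (tow j') by rewrite S.
    have xj'' : nth set0 (tow j') n x.
      by move: xj' S; case: (tow j').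
    have [? ln] := tf_disjoint tf (ltnW lj) nj' (kl _ Yx) xj''; subst j'.
    by rewrite S ln ltnn in lj.
  split=> //; apply: (inside _ _ _ (phi x)) => //.
    by rewrite addnS; apply: Yphi => //; rewrite -addnS.
  by apply: tf_shift tf _ _ _ _ _ => //; exact: kl.
have start k : k < size Y -> forall x, nth set0 Y k x -> fbot tow x -> exists j,
    nth set0 Y k `<=` head set0 (tow j).
  move=> kY x Yx [j]; rewrite -nth0 => jx; exists j; rewrite -nth0.
  exact: (inside k j 0 x kY Yx (tf_size j) jx).
(* Induction on a bound [n] for the length still to be read. The invariant is that the next floor,
   if there is one, lies in the bottom of the family. *)
suff main n : forall k, size Y - k <= n -> k <= size Y ->
    (k < size Y -> nth set0 Y k `<=` fbot tow) -> exists w, reads tow w (drop k Y).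
  have [|||w] := main (size Y) 0; rewrite ?subn0 ?drop0 //.
  by move=> r; exists w.
elim: n => [|n IHn] k nk kY kb.
  exists [::]; rewrite drop_oversize; first exact: floorwise_refl.
  by rewrite -subn_eq0 -leqn0.
case: (ltnP k (size Y)) => [kltY|Ylek]; last first.
  by exists [::]; rewrite drop_oversize //; exact: floorwise_refl.
have [x Yx] := Y0 k kltY.
have [j jsub] := start k kltY x Yx (kb kltY x Yx).
have bl := block k j kltY jsub; have sj := tf_size j.
have lj : (size (tow j)).-1 < size (tow j) by rewrite prednK.
have kjY : k + size (tow j) <= size Y.
  by have [+ _] := bl _ lj; rewrite -[X in k + X <= _](prednK sj) addnS.
have [||w rw] := IHn (k + size (tow j)) _ kjY.
- rewrite leq_subLR; rewrite leq_subLR in nk; apply: leq_trans nk _.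
  by rewrite -addnA leq_add2l -add1n leq_add2r.
- move=> kjltY.
  have [_ sub] := bl _ lj; have [z Yz] := Y0 _ (bl _ lj).1.
  have E : k + size (tow j) = (k + (size (tow j)).-1).+1 by rewrite -addnS prednK.
  have Yphiz : nth set0 Y (k + size (tow j)) (phi z).
    by rewrite E; apply: Yphi => //; rewrite -E.
  have [] := start _ kjltY (phi z) Yphiz.
    apply: tf_top tf _ _; exists j; rewrite (last_nth set0).
    have := sub _ Yz; case: (tow j) sj => //.
  by move=> j' jsub' u /jsub' ?; exists j'.
exists (j :: w); rewrite -[drop k Y](cat_take_drop (size (tow j))) drop_drop addnC.
rewrite /reads /=; apply: floorwise_cat; last exact: rw.
have S : size (take (size (tow j)) (drop k Y)) = size (tow j).
  by rewrite size_takel // size_drop leq_subRL.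
split=> // i; rewrite S => ij; rewrite nth_take // nth_drop.
exact: (bl i ij).2.
Qed.

End TowerFamily.

(** * Edges into a partition and the itineraries that they spell *)

Section TowerEdges.
Variables (X : Type) (phi : X -> X) (I : finType) (tow : I -> seq (set X)).
Variable Q : towers X.
Hypothesis tf : tower_family phi tow.
Hypothesis Q0 : forall T : Q, forall i, i < size (val T) -> nth set0 (val T) i !=set0.

Let E := tower_edges tow Q.

Definition fits (T : seq (set X)) (i : I) (k : nat) : Prop :=
  k + size (tow i) <= size T /\
  forall j, j < size (tow i) -> nth set0 T (k + j) `<=` nth set0 (tow i) j.

Definition offset (e : E) : nat := tagged (val e).2.

Lemma edge_fits (e : E) : fits (val (rng E e)) (src E e) (offset e).
Proof. by case: e => [[i [T k]] /= H]; exact/asboolP. Qed.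

Lemma edge_of_fits (T : Q) i k : fits (val T) i k ->
  exists e : E, [/\ rng E e = T, src E e = i & offset e = k].
Proof.
move=> H; have kT : k < size (val T).
  by apply: leq_trans H.1; rewrite -addn1 leq_add2l (tf_size tf).
by exists (exist _ (i, Tagged (fun T : Q => 'I_(size (val T))) (Ordinal kT)) (asboolT H)).
Qed.

(** The source is recovered from the other two data: the floor of the range at the offset is
    nonempty and lies in the bottom floor of the source, and disjointness leaves only one such
    tower. *)
Lemma edge_inj (e e' : E) : rng E e = rng E e' -> offset e = offset e' -> e = e'.
Proof.
move=> r o; have f := edge_fits e; have f' := edge_fits e'; rewrite -r -o in f'.
have sE : src E e = src E e'.
  have oT : offset e < size (val (rng E e)).
    by apply: leq_trans f.1; rewrite -addn1 leq_add2l (tf_size tf).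
  have [x Tx] := Q0 oT.
  have := f'.2 0 (tf_size tf _) x; have := f.2 0 (tf_size tf _) x.
  rewrite addn0 => /(_ Tx) ex /(_ Tx) e'x.
  by have [] := tf_disjoint tf (tf_size tf _) (tf_size tf _) ex e'x.
apply: val_inj; move: r o sE; rewrite /offset /=.
case: (val e) (val e') => [i [T k]] [i' [T' k']] /= TT; subst T'.
by move=> /val_inj -> ->.
Qed.

Lemma tower_edges_ordered : ordered E.
Proof.
split=> /=.
- by move=> e /=; rewrite eqxx leqnn.
- move=> e e' /andP[/andP[/eqP r le] /andP[_ le']]; apply: edge_inj => //.
  by apply/eqP; rewrite eqn_leq le le'.
- move=> e e' e'' /andP[/eqP r l] /andP[/eqP r' l'].
  by apply/andP; split; [apply/eqP; rewrite r r' | exact: leq_trans l l'].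
- move=> e e'; rewrite [tag (val e').2 == _]eq_sym; case: eqVneq => //= _.
  exact: leq_total.
Qed.

(** The edges into [T], listed as pairs of source and offset, and the blocks of [w] are both
    strictly increasing in the second component, so comparing members is enough. An edge must start
    where a block starts, since the floor at its offset lies in the bottom floor of its source and,
    by the reading, in a floor of a block. *)
Lemma reads_word (T : Q) w : reads tow w (val T) -> word E T = w.
Proof.
move=> r; rewrite -[RHS](offsets_fst tow 0 w).
suff <- : [seq (src E e, offset e) | e <- fibre E T] = offsets tow 0 w.
  by rewrite -map_comp.
have oE := tower_edges_ordered; have [_ aE tE _] := oE.
apply: (@irr_sorted_eq _ (fun p q : I * nat => p.2 < q.2)).
- by move=> q p s; exact: ltn_trans.
- by move=> p; rewrite /= ltnn.
- rewrite sorted_map.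
  have := fibre_sorted oE T; have := fibre_uniq E T.
  rewrite (sorted_pairwise tE) uniq_pairwise => u s.
  apply: pairwise_sorted; have : pairwise (fun e e' => (e != e') && ele E e e') (fibre E T).
    by rewrite pairwise_relI u s.
  apply: sub_in_pairwise (allss _) => e e'; rewrite !mem_fibre => /eqP eT /eqP e'T.
  move=> /andP[ne /andP[_ le]] /=; rewrite ltn_neqAle le andbT.
  by apply: contraNneq ne => oo; apply/eqP/edge_inj; rewrite ?eT.
- exact: offsets_sorted (tf_height tf) 0 w.
move=> [i k]; apply/mapP/idP => [[e] | /mem_offsets[u [v [wE kE]]]].
  rewrite mem_fibre => /eqP eT [-> ->]; apply/mem_offsets.
  have [le sub] := edge_fits e; rewrite eT in le sub.
  have oT : offset e < size (val T).
    by apply: leq_trans le; rewrite -addn1 leq_add2l (tf_size tf).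
  have [x Tx] := Q0 oT.
  have [|u [j [v [l [wE lj oE']]]]] := @flatten_pos _ _ tow w (offset e).
    by rewrite -r.1.
  have := r.2 _ oT _ Tx; rewrite wE oE' nth_flatten_pos // => jx.
  have := sub 0 (tf_size tf _) x; rewrite addn0 => /(_ Tx) ix.
  have [ij l0] := tf_disjoint tf lj (tf_size tf _) jx ix; subst j l.
  by exists u, v; rewrite add0n addn0.
have [|e [eT es eo]] := @edge_of_fits T i k.
  have [s h] := r; rewrite wE in s h.
  have S : k + size (tow i) <= size (val T).
    by rewrite s kE add0n map_cat flatten_cat size_cat leq_add2l /= size_cat leq_addr.
  split=> // j ji; have kj : k + j < size (val T).
    by apply: leq_trans S; rewrite -addnS leq_add2l.
  by have := h _ kj; rewrite kE add0n nth_flatten_pos.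
by exists e; rewrite ?mem_fibre ?eT ?es ?eo.
Qed.

End TowerEdges.

(** * Partitions as tower families, and pairs of a family and a finer partition *)

Section KRFamily.
Variables (X : topologicalType) (phi : X -> X) (x0 : X).
Implicit Types P Q : towers X.

Lemma KR_nonempty P T i : KR_partition phi x0 P -> T \in P -> i < size T ->
  nth set0 T i !=set0.
Proof. by move=> KR TP iT; have [] := KR_clopen KR TP (mem_nth set0 iT). Qed.

Lemma ftopE P : ftop (fun T : P => val T) = top_of P.
Proof.
apply/seteqP; split=> x /=; first by move=> [T Tx]; exists (val T) => //; exact: valP.
by move=> [T TP Tx]; exists [` TP]%fset.
Qed.

Lemma fbotE P : fbot (fun T : P => val T) = bottom_of P.
Proof.
apply/seteqP; split=> x /=; first by move=> [T Tx]; exists (val T) => //; exact: valP.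
by move=> [T TP Tx]; exists [` TP]%fset.
Qed.

Lemma KR_family P : KR_partition phi x0 P -> tower_family phi (fun T : P => val T).
Proof.
move=> KR; split.
- by move=> T; apply: (KR_height KR); exact: valP.
- move=> S T k l x kS lT Sx Tx.
  have [|/val_inj -> ->] // := KR_disjoint KR (valP S) (valP T) kS lT.
  by exists x.
- by move=> T i x iT Tx; rewrite -(KR_shift KR (valP T) iT); exists x.
- by move=> x; rewrite ftopE fbotE -(KR_top KR) => ?; exists x.
Qed.

(** The setting in which [tower_edges tow Q] behaves like the edge set between two comparable
    partitions. It occurs for two levels of one system ([system_adapted]) and for preimages of
    towers ([level_adapted]). *)
Record adapted (I : finType) (tow : I -> seq (set X)) (Q : towers X) : Prop := {
  ad_KR : KR_partition phi x0 Q;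
  ad_family : tower_family phi tow;
  ad_refines : forall T Y, T \in Q -> Y \in T -> exists i k, k < size (tow i) /\
    Y `<=` nth set0 (tow i) k;
  ad_top : top_of Q `<=` ftop tow }.

Section Adapted.
Variables (I : finType) (tow : I -> seq (set X)) (Q : towers X).
Hypothesis ad : adapted tow Q.

Lemma adapted_nonempty (T : Q) i : i < size (val T) -> nth set0 (val T) i !=set0.
Proof. exact: KR_nonempty (ad_KR ad) (valP T). Qed.

Lemma adapted_ordered : ordered (tower_edges tow Q).
Proof. exact: tower_edges_ordered (ad_family ad) adapted_nonempty. Qed.

Lemma adapted_reads (T : Q) : reads tow (word (tower_edges tow Q) T) (val T).
Proof.
have KR := ad_KR ad; have [||||w r] := reads_exist (ad_family ad) (@adapted_nonempty T).
- exact: tf_shift (KR_family KR) T.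
- by move=> i iT; apply: (ad_refines ad (valP T)); exact: mem_nth.
(* Only tops are assumed to be comparable; for bottoms, the bottom of [Q] is the image of its top,
   and the dynamics maps the top of the family into its bottom. *)
- move=> y Ty; have : bottom_of Q y by exists (val T) => //; exact: valP.
  by rewrite -(KR_top KR) => -[x /(ad_top ad) /(tf_top (ad_family ad)) + <-].
- by move=> y Ty; apply: (ad_top ad); exists (val T) => //; exact: valP.
by rewrite (reads_word (ad_family ad) adapted_nonempty r).
Qed.

Lemma adapted_word (T : Q) w : reads tow w (val T) -> word (tower_edges tow Q) T = w.
Proof. exact: reads_word (ad_family ad) adapted_nonempty _ _. Qed.

Lemma adapted_rng_onto : rng_onto (tower_edges tow Q).
Proof.
apply/rng_onto_word => T; apply/eqP => w0; have [+ _] := adapted_reads T.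
rewrite w0 /= => /eqP; rewrite size_eq0; apply/negP.
exact: KR_height (ad_KR ad) _ (valP T).
Qed.

(** A point in a floor of the tower [i] lies in some tower [T] of [Q]. The reading of [T] places
    this point in a floor of a tower of its word, which disjointness identifies as [i]. *)
Lemma adapted_src_onto : (forall i, exists k, k < size (tow i) /\
  nth set0 (tow i) k !=set0) -> src_onto (tower_edges tow Q).
Proof.
move=> H; apply/src_onto_word => i; have [k [ki [x ix]]] := H i.
have [T [Z [TQ ZT Zx]]] := KR_cover (ad_KR ad) x.
exists [` TQ]%fset; have := adapted_reads [` TQ]%fset; set w := word _ _ => -[s h].
have iT : index Z T < size T by rewrite index_mem.
have := h _ iT x; rewrite nth_index // => /(_ Zx).
have [|u [j [v [l [wE lj ->]]]]] := @flatten_pos _ _ tow w (index Z T).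
  by rewrite -s.
rewrite wE nth_flatten_pos // => jx.
by have [-> _] := tf_disjoint (ad_family ad) ki lj ix jx; rewrite mem_cat mem_head orbT.
Qed.

End Adapted.
End KRFamily.

(** * Systems of Kakutani-Rokhlin partitions *)

Lemma nested_nonempty (T : topologicalType) (C : nat -> set T) : compact [set: T] ->
  (forall n, closed (C n)) -> (forall n, C n.+1 `<=` C n) -> (forall n, C n !=set0) ->
  exists x, forall n, C n x.
Proof.
move=> cT clC decC C0.
have decC' i j : i <= j -> C j `<=` C i.
  elim: j => [|j IHj]; first by rewrite leqn0 => /eqP ->.
  rewrite leq_eqVlt => /predU1P[-> //|/IHj]; exact: subset_trans.
have FF : Filter (filter_from [set: nat] C).
  apply: filter_from_filter; first by exists 0.
  move=> i j _ _; exists (maxn i j) => //.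
  by move=> y Cy; split; apply: decC' Cy; rewrite ?leq_maxl ?leq_maxr.
have PF : ProperFilter (filter_from [set: nat] C) by exact: filter_from_proper.
have [|x [_ clx]] := cT _ PF; first by exists 0.
exists x => n; apply: clC => B xB; apply: clx => //.
by exists n.
Qed.

Definition located X (P : towers X) (T : P) (i : nat) (x : X) : Prop :=
  i < size (val T) /\ nth set0 (val T) i x.

Section Located.
Variables (X : topologicalType) (phi : X -> X) (x0 : X) (P : towers X).
Hypothesis KR : KR_partition phi x0 P.
Implicit Types (T : P) (x y : X).

Lemma located_exists x : exists T i, located T i x.
Proof.
have [T [Z [TP ZT Zx]]] := KR_cover KR x.
by exists [` TP]%fset, (index Z T); split; rewrite ?index_mem ?nth_index.
Qed.

Lemma located_unique T T' i i' x : located T i x -> located T' i' x -> T = T' /\ i = i'.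
Proof.
move=> [iT Tx] [iT' T'x].
have [|/val_inj -> ->] // := KR_disjoint KR (valP T) (valP T') iT iT'.
by exists x.
Qed.

Lemma tower_size T : 0 < size (val T).
Proof. by rewrite lt0n size_eq0; apply: (KR_height KR); exact: valP. Qed.

Lemma top_located x : top_of P x <-> exists T, located T (size (val T)).-1 x.
Proof.
split=> [[T TP Tx]|[T [sT Tx]]].
  exists [` TP]%fset; split; first by rewrite prednK // (tower_size [` TP]%fset).
  by rewrite nth_last.
by exists (val T); [exact: valP | rewrite -nth_last].
Qed.

Lemma bottom_located x : bottom_of P x <-> exists T, located T 0 x.
Proof.
split=> [[T TP Tx]|[T [sT Tx]]].
  by exists [` TP]%fset; split; [exact: tower_size | rewrite nth0].
by exists (val T); [exact: valP | rewrite -nth0].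
Qed.

Lemma located_top T i x : located T i x -> top_of P x -> i = (size (val T)).-1.
Proof. by move=> l /top_located[T' /(located_unique l)[-> ->]]. Qed.

Lemma located_bottom T i x : located T i x -> bottom_of P x -> i = 0.
Proof. by move=> l /bottom_located[T' /(located_unique l)[_ ->]]. Qed.

Lemma located_nbhs T i x : located T i x -> nbhs x (located T i).
Proof.
move=> [iT Tx]; apply: open_nbhs_nbhs; split=> //.
rewrite (_ : located T i = nth set0 (val T) i).
  by have [[]] := KR_clopen KR (valP T) (mem_nth set0 iT).
by apply/seteqP; split=> // y [].
Qed.

(** The hypothesis says that [A] is a union of floors; so is its complement, and floors are open. *)
Lemma saturated_closed (A : set X) :
  (forall T i x y, located T i x -> located T i y -> A x -> A y) -> closed A.
Proof.
move=> sat; rewrite -[A]setCK; apply: open_closedC; rewrite openE => x nAx.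
have [T [i lx]] := located_exists x.
apply: filterS (located_nbhs lx) => y ly Ay; exact: nAx (sat _ _ _ _ ly lx Ay).
Qed.

Lemma top_closed : closed (top_of P).
Proof.
apply: saturated_closed => T i x y lx ly /(located_top lx) E.
by apply/top_located; exists T; rewrite -E.
Qed.

Lemma located_shift T i x : i.+1 < size (val T) -> located T i x -> located T i.+1 (phi x).
Proof.
by move=> iT [_ Tx]; split=> //; rewrite -(KR_shift KR (valP T) iT); exists x.
Qed.

Lemma located_inhabited T i : i < size (val T) -> exists x, located T i x.
Proof. by move=> iT; have [x Tx] := KR_nonempty KR (valP T) iT; exists x. Qed.

End Located.

Section System.
Variables (X : topologicalType) (phi : X -> X) (x0 : X) (R : nat -> towers X).
Hypotheses (cX : compact [set: X]) (phiH : homeomorphism phi).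
Hypothesis KRS : KR_system phi x0 R.

Let KR n := KRs_part KRS n.

Lemma top_le n m : n <= m -> top_of (R m) `<=` top_of (R n).
Proof.
elim: m => [|m IHm]; first by rewrite leqn0 => /eqP ->.
rewrite leq_eqVlt => /predU1P[-> //|nm].
case: m nm IHm => [|m] nm IHm; last first.
  by apply: subset_trans (IHm nm); exact: (KRs_top KRS).
(* [KRs_top] compares tops from level 1 on; at level 0 the top is the whole space. *)
move: nm; rewrite ltnS leqn0 => /eqP -> x _.
rewrite (KRs_0 KRS); exists [:: setT] => //; exact: fset11.
Qed.

Lemma bottom_le n m : n <= m -> bottom_of (R m) `<=` bottom_of (R n).
Proof. by move=> nm; rewrite -!(KR_top (KR _)); apply: image_subset; exact: top_le. Qed.

Lemma system_adapted n m : n <= m -> adapted phi x0 (fun S : R n => val S) (R m).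
Proof.
move=> nm; split=> //; first exact: KR_family; last by rewrite ftopE; exact: top_le.
have same k (T : seq (set X)) Y : T \in R k -> Y \in T -> exists (S : R k) l,
    l < size (val S) /\ Y `<=` nth set0 (val S) l.
  move=> TR YT; exists [` TR]%fset, (index Y T) => /=.
  by rewrite index_mem YT nth_index //; split=> // x.
elim: m nm => [|m IHm]; first by rewrite leqn0 => /eqP ->; exact: same.
rewrite leq_eqVlt => /predU1P[->|]; first exact: same.
move=> /IHm H T Y /(KRs_refines KRS) /[apply] -[S [Z [SR ZS YZ]]].
have [i [k [ki Zk]]] := H _ _ SR ZS.
by exists i, k; split=> //; apply: subset_trans YZ Zk.
Qed.

Lemma adapted_located (I : finType) (tow : I -> seq (set X)) m (T : R m) i :
  adapted phi x0 tow (R m) -> i < size (val T) -> exists s k, k < size (tow s) /\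
    forall x, located T i x -> nth set0 (tow s) k x.
Proof.
move=> ad iT; have [s [k [ks sub]]] := ad_refines ad (valP T) (mem_nth set0 iT).
by exists s, k; split=> // x [_ /sub].
Qed.

Lemma top_cap x : (forall n, top_of (R n) x) -> x = x0.
Proof.
move=> H; have : (\bigcap_(n in [set n | 0 < n]) top_of (R n)) x by move=> n _.
by rewrite (KRs_cap KRS).
Qed.

Lemma top_base n : top_of (R n) x0. Proof. exact: KR_base (KR n). Qed.

Lemma bottom_cap x : (forall n, bottom_of (R n) x) -> x = phi x0.
Proof.
have [_ [psi [_ K1 K2]]] := phiH.
move=> H; rewrite -[x]K2; congr phi; apply: top_cap => n.
by have := H n; rewrite -(KR_top (KR n)) => -[y yn <-]; rewrite K1.
Qed.

Lemma bottom_base n : bottom_of (R n) (phi x0).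
Proof. by rewrite -(KR_top (KR n)); exists x0 => //; exact: top_base. Qed.

Lemma floor_nbhs x A : nbhs x A -> exists n T i, located (P := R n) T i x /\
  located T i `<=` A.
Proof.
move=> /(KRs_basis KRS).2 [Z [[n [T TR ZT]] Zx] ZA].
exists n, [` TR]%fset, (index Z T); split.
  by split; rewrite ?index_mem ?nth_index.
by move=> y [_]; rewrite /= nth_index // => /ZA.
Qed.

(** Let [C n] be the union of the floors of level [n] that meet both [U] and its complement. If none
    of these closed decreasing sets were empty, compactness would give a common point, no floor
    around which is contained in [U] or in its complement; but floors form a basis and both sets are
    open. *)
Lemma small_floors (U : set X) : clopen U -> exists N, forall n, N <= n ->
  forall (T : R n) i, i < size (val T) ->
    located T i `<=` U \/ located T i `<=` ~` U.
Proof.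
move=> [oU cU]; apply: contrapT => /forallNP big.
pose C n := [set x | exists (T : R n) i, located T i x /\
  exists y z, [/\ located T i y, located T i z, U y & ~ U z]].
have dec n m : n <= m -> C m `<=` C n.
  move=> nm x [T [i [lx [y [z [ly lz Uy Uz]]]]]].
  have [S [k [kS sub]]] := adapted_located (system_adapted nm) lx.1.
  exists S, k; split; first by split=> //; exact: sub.
  by exists y, z; split=> //; split=> //; exact: sub.
have [||n|x Cx] := nested_nonempty cX (C := C).
- move=> n; apply: (saturated_closed (KR n)) => T i x y lx ly [T' [i' [lx' H]]].
  by have [E E'] := located_unique (KR n) lx' lx; subst T' i'; exists T, i.
- by move=> n; exact: dec.
- have [m /not_implyP[nm /existsNP[T /existsNP[i /not_implyP[iT]]]]] := (existsNP _).2 (big n).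
  move=> /not_orP[/existsNP[z /not_implyP[lz Uz]] /existsNP[y /not_implyP[ly /contrapT Uy]]].
  by exists y; apply: (dec _ _ nm); exists T, i; split=> //; exists y, z.
have no n (T : R n) i : located T i x -> ~ (located T i `<=` U) /\ ~ (located T i `<=` ~` U).
  move=> lx; have [T' [i' [lx' [y [z [ly lz Uy Uz]]]]]] := Cx n.
  have [E E'] := located_unique (KR n) lx' lx; subst T' i'.
  by split=> [/(_ z lz)|/(_ y ly)].
case: (pselect (U x)) => Ux.
  have [n [T [i [lx sub]]]] := floor_nbhs (open_nbhs_nbhs (conj oU Ux)).
  by have [] := no n T i lx.
have oCU : open (~` U) by exact: closed_openC.
have [n [T [i [lx sub]]]] := floor_nbhs (open_nbhs_nbhs (conj oCU Ux)).
by have [] := no n T i lx.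
Qed.

Lemma small_tops (U : set X) : open U -> U x0 -> exists N, forall n, N <= n ->
  top_of (R n) `<=` U.
Proof.
move=> oU Ux0; apply: contrapT => /forallNP big.
have [||n|x Cx] := nested_nonempty cX (C := fun n => top_of (R n) `&` ~` U).
- by move=> n; apply: closedI; [exact: top_closed (KR n) | exact: open_closedC].
- by move=> n; apply: setSI; exact: top_le.
- have [m /not_implyP[nm /existsNP[x /not_implyP[tx Ux]]]] := (existsNP _).2 (big n).
  by exists x; split=> //; exact: top_le tx.
by have [_] := Cx 0; rewrite (top_cap (fun n => (Cx n).1)).
Qed.

(** Every nonempty closed invariant set contains [x0]: following one of its points up a tower shows
    that it meets the top of each level, and by compactness it meets the intersection of the tops.
    Hence the intersection of all such sets is nonempty and is the only minimal set. *)
Lemma system_essentially_minimal : essentially_minimal phi x0.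
Proof.
have [phiC [psi [_ K1 K2]]] := phiH.
have inx0 A : closed_invariant phi A -> A x0.
  move=> [[a Aa] cA iA].
  have Aphi y : A y -> A (phi y) by move=> Ay; rewrite -iA; exists y.
  have [||n|x Cx] := nested_nonempty cX (C := fun n => top_of (R n) `&` A).
  - by move=> n; apply: closedI; [exact: top_closed (KR n) | exact: cA].
  - by move=> n; apply: setSI; exact: top_le.
  - have [T [i li]] := located_exists (KR n) a.
    suff H k : forall y i, located T i y -> A y -> (size (val T)).-1 - i = k ->
        exists z, A z /\ located T (size (val T)).-1 z.
      have [z [Az lz]] := H _ a i li Aa erefl; exists z; split=> //.
      by apply/(top_located (KR n)); exists T.
    elim: k => [|k IHk] y j lj Ay jk.
      exists y; split=> //.
      suff -> : (size (val T)).-1 = j by [].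
      apply/eqP; rewrite eqn_leq -subn_eq0 jk eqxx /=.
      by rewrite -ltnS prednK ?(tower_size (KR n)) //; exact: lj.1.
    apply: (IHk (phi y) j.+1); last by rewrite subnS jk.
      apply: (located_shift (KR n)) => //.
      have : j < (size (val T)).-1 by rewrite -subn_gt0 jk.
      by case: (size (val T)).
    exact: Aphi.
  by have [_] := Cx 0; rewrite (top_cap (fun n => (Cx n).1)).
pose M := [set x | forall A, closed_invariant phi A -> A x].
have Mci : closed_invariant phi M.
  split; first by exists x0.
    have -> : M = \bigcap_(A in closed_invariant phi) A by [].
    by apply: closed_bigI => A [].
  apply/seteqP; split=> [_ [x Mx <-] A cA|x Mx].
    by have [_ _ <-] := cA; exists x => //; exact: Mx.
  exists (psi x) => // A cA; have := Mx A cA; have [_ _ {1}<-] := cA.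
  by move=> [y Ay <-]; rewrite K1.
exists M; split=> // [|M' [M'ci minM']].
  split=> // A cA AM; apply/seteqP; split=> // x; exact.
by apply/esym/minM' => // x; exact.
Qed.

End System.

(** * The diagram of a system *)

Section ExtremeEdges.
Variables (X : topologicalType) (phi : X -> X) (x0 : X).
Variables (I : finType) (tow : I -> seq (set X)) (Q : towers X).
Hypothesis ad : adapted phi x0 tow Q.

Let E := tower_edges tow Q.
Let tfI := ad_family ad.

Implicit Types e : E.

Lemma edge_cover (T : Q) i : i < size (val T) ->
  exists e, rng E e = T /\ offset e <= i < offset e + size (tow (src E e)).
Proof.
move=> iT; have [s h] := adapted_reads ad T; move: s h; set w := word _ _ => s h.
have [|u [j [v [l [wE lj iE]]]]] := @flatten_pos _ _ tow w i; first by rewrite -s.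
have [|e [eT ej eo]] := @edge_of_fits _ _ _ tow Q tfI T j (size (flatten [seq tow k | k <- u])).
  split.
    rewrite s wE map_cat flatten_cat size_cat leq_add2l /= size_cat.
    exact: leq_addr.
  move=> k kj; have kT : size (flatten [seq tow k | k <- u]) + k < size (val T).
    rewrite s wE map_cat flatten_cat size_cat ltn_add2l /= size_cat.
    exact: ltn_addr.
  by have := h _ kT; rewrite wE nth_flatten_pos.
by exists e; rewrite eT ej eo iE leq_addr ltn_add2l.
Qed.

Lemma edge_floor e i : offset e <= i < offset e + size (tow (src E e)) ->
  nth set0 (val (rng E e)) i `<=` nth set0 (tow (src E e)) (i - offset e).
Proof.
move=> /andP[le lt]; rewrite -{1}(subnKC le).
by apply: (edge_fits e).2; rewrite ltn_subLR.
Qed.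

(** A point of the floor at a common position is placed by both edges in the coarse family.
    Disjointness equates its heights above the two offsets, hence the offsets. *)
Lemma edge_overlap e e' i : rng E e = rng E e' ->
  offset e <= i < offset e + size (tow (src E e)) ->
  offset e' <= i < offset e' + size (tow (src E e')) -> e = e'.
Proof.
move=> r ei e'i.
have iT : i < size (val (rng E e)).
  by case/andP: ei => _ lt; apply: leq_trans lt _; exact: (edge_fits e).1.
have [x Tx] := adapted_nonempty ad iT.
have ex := edge_floor ei Tx; rewrite r in Tx; have e'x := edge_floor e'i Tx.
move/andP: ei => [le lt]; move/andP: e'i => [le' lt'].
have [||_ o] := tf_disjoint tfI _ _ ex e'x; rewrite ?ltn_subLR //.
apply: (edge_inj tfI (adapted_nonempty ad)) => //.
by rewrite -[LHS](subKn le) o subKn.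
Qed.

Lemma offset_lt e : offset e < offset e + size (tow (src E e)).
Proof. by rewrite -addn1 leq_add2l (tf_size tfI). Qed.

(** The edges into a tower cut it into blocks ([edge_cover], [edge_overlap]), and the last block is
    the one that contains the top floor. *)
Lemma max_edge_offset e :
  max_edge e <-> offset e + size (tow (src E e)) = size (val (rng E e)).
Proof.
have ltT e' : offset e' < size (val (rng E e')).
  by apply: leq_trans (offset_lt e') _; exact: (edge_fits e').1.
split=> [me | o e' /andP[/eqP r le]].
  have T0 : 0 < size (val (rng E e)) by exact: leq_ltn_trans (ltT e).
  have [|e' [r /andP[le lt]]] := @edge_cover (rng E e) (size (val (rng E e))).-1.
    by rewrite prednK.
  suff ee : e' = e.
    subst e'; rewrite prednK // in lt.
    by apply/eqP; rewrite eqn_leq (edge_fits e).1.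
  case: (leqP (offset e) (offset e')) => oo.
    by apply: me; apply/andP; split=> //; apply/eqP.
  have := @edge_overlap e' e (offset e) r; rewrite (ltnW oo) leqnn offset_lt.
  apply=> //; apply: leq_trans lt.
  by rewrite prednK // -ltnS.
apply/esym; apply: (@edge_overlap e e' (offset e')) => //.
  by rewrite le o (r : rng E e = rng E e') ltT.
by rewrite leqnn offset_lt.
Qed.

Lemma min_edge_offset e : min_edge e <-> offset e = 0.
Proof.
split=> [me|o e' /andP[/eqP r le]].
  have [|e' [r /andP[le lt]]] := @edge_cover (rng E e) 0.
    exact: leq_ltn_trans (leq0n _) (leq_trans (offset_lt e) (edge_fits e).1).
  have o : offset e' = 0 by apply/eqP; rewrite -leqn0.
  by rewrite -(me e') //; apply/andP; split; [apply/eqP|rewrite [X in X <= _]o].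
apply: (edge_inj tfI (adapted_nonempty ad)) => //.
by rewrite o; apply/eqP; rewrite -leqn0 -o.
Qed.

End ExtremeEdges.

Lemma ipath_eq (B : diagram) (x y : ipath B) : (forall n, x n = y n) -> x = y.
Proof.
case: x y => [x xP] [y yP] /= E; have xy := functional_extensionality_dep E; subst y.
by congr IPath; exact: Prop_irrelevance.
Qed.

Lemma dep_choice (I : Type) (T : I -> Type) (R : forall i, T i -> Prop) :
  (forall i, exists t, R i t) -> exists f : forall i, T i, forall i, R i (f i).
Proof. by move=> H; exists (fun i => sval (cid (H i))) => i; exact: svalP (cid (H i)). Qed.

Section SystemDiagram.
Variable X : sds.

Definition sds_KRS := sds_parts (sysP X).
Definition sds_KR n := KRs_part sds_KRS n.
Definition sds_adapted n m (nm : n <= m) := system_adapted sds_KRS nm.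

Lemma Pdiagram_bratteli : ordered_bratteli (Pdiagram X).
Proof.
split=> [|n].
  by rewrite /= -cardfE (KRs_0 sds_KRS) cardfs1.
have ad := sds_adapted (leqnSn n).
have ro := adapted_rng_onto ad.
have [T _] := located_exists (sds_KR n.+1) (base X).
have [e _] := ro T.
split=> //.
- by apply/card_gt0P; exists (src _ e).
- by apply/card_gt0P; exists e.
- apply: (adapted_src_onto ad) => S; exists 0.
  have S0 := tower_size (sds_KR n) S; split=> //.
  exact: KR_nonempty (sds_KR n) (valP S) S0.
- exact: adapted_ordered ad.
Qed.

(* [pos s] is the position of an extreme floor in a tower of height [s]: the top for
   [predn], the bottom for [fun=> 0]. *)
Lemma extreme_path (pos : nat -> nat) (good : forall n, arr (Pdiagram X) n -> Prop) (z : X) :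
  (forall s, 0 < s -> pos s < s) ->
  (forall n (e : arr (Pdiagram X) n), good n e <->
     offset e + pos (size (val (src _ e))) = pos (size (val (rng _ e)))) ->
  (forall y, (forall n, exists T : parts X n, located T (pos (size (val T))) y) -> y = z) ->
  (forall n, exists T : parts X n, located T (pos (size (val T))) z) ->
  exists! x : ipath (Pdiagram X), forall n, good n (x n).
Proof.
move=> posP goodP cap base.
have pos_lt n (T : parts X n) : pos (size (val T)) < size (val T).
  by apply: posP; exact: tower_size (sds_KR n) T.
have [T Tz] : exists T : forall n, parts X n, forall n, located (T n) (pos (size (val (T n)))) z.
  exact: (dep_choice base).
(* The edge wanted is the one whose block contains the extreme floor of [T n.+1]. As [z] lies there
   and also in the extreme floor of [T n], uniqueness of its position at level [n] gives the source
   and the extremality. *)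
have ex n : exists e : arr (Pdiagram X) n, [/\ src _ e = T n, rng _ e = T n.+1 & good n e].
  have ad := sds_adapted (leqnSn n).
  have [e [r c]] := edge_cover ad (pos_lt n.+1 (T n.+1)).
  have := edge_floor c; rewrite r => /(_ _ (Tz n.+1).2) ez.
  have le : pos (size (val (T n.+1))) - offset e < size (val (src _ e)).
    by move/andP: c => [le lt]; rewrite ltn_subLR.
  have lez : located (src _ e) (pos (size (val (T n.+1))) - offset e) z by [].
  have [S o] := located_unique (sds_KR n) lez (Tz n).
  exists e; split=> //; apply/goodP; rewrite S r -o subnKC //.
  by case/andP: c.
have [x0 x0P] : exists x0 : forall n, arr (Pdiagram X) n, forall n,
    [/\ src _ (x0 n) = T n, rng _ (x0 n) = T n.+1 & good n (x0 n)].
  exact: (dep_choice ex).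
have x0path n : rng _ (x0 n) = src _ (x0 n.+1).
  by have [_ -> _] := x0P n; have [-> _ _] := x0P n.+1.
exists (IPath x0path); split=> [n|y good_y] /=; first by have [_ _] := x0P n.
(* The extreme floors of the sources of [y] decrease, so by compactness they share a point. By [cap]
   it is [z], whose position at level [n] determines the tower. *)
have srcE n : src _ (y n) = T n.
  pose C n := located (src _ (y n)) (pos (size (val (src _ (y n))))).
  have [||n'|p Cp] := nested_nonempty (sds_compact (sysP X)) (C := C).
  - move=> k; apply: (saturated_closed (sds_KR k)) => S i a b la lb Ca.
    by have [E E'] := located_unique (sds_KR k) la Ca; rewrite /C -E' -E.
  - move=> k a [_ Ca]; split; first exact: pos_lt.
    have := edge_fits (y k); rewrite (ipathP y k) => -[_ f].
    apply: (f _ (pos_lt _ _)); have := good_y k; rewrite goodP (ipathP y k) => ->.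
    exact: Ca.
  - exact: (located_inhabited (sds_KR n') (pos_lt _ _)).
  have pz : p = z by apply: cap => k; exists (src _ (y k)); exact: Cp.
  by have := Cp n; rewrite pz => l; have [] := located_unique (sds_KR n) l (Tz n).
apply: ipath_eq => n /=.
have [s r g] := x0P n.
have r' : rng _ (y n) = T n.+1 by rewrite (ipathP y n).
have ad := sds_adapted (leqnSn n).
apply: (edge_inj (ad_family ad) (adapted_nonempty ad)); first by rewrite r'.
have ey := (goodP n _).1 (good_y n); have ex0 := (goodP n _).1 g.
rewrite s r in ex0; rewrite srcE r' in ey.
by apply/eqP; rewrite -(eqn_add2r (pos (size (val (T n))))) ex0 ey.
Qed.

Lemma Pdiagram_properly_ordered : properly_ordered (Pdiagram X).
Proof.
split.
  apply: (@extreme_path predn (fun n => @max_edge _ _ (arr (Pdiagram X) n)) (base X)).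
  - by case.
  - move=> n e; have ad := sds_adapted (leqnSn n).
    have := tower_size (sds_KR n) (src _ e); have := tower_size (sds_KR n.+1) (rng _ e).
    move=> r0 s0; apply: iff_trans (max_edge_offset ad e) _.
    by rewrite -[in X in X <-> _](prednK s0) -[in X in X <-> _](prednK r0) addnS; split=> [[]|->].
  - by move=> y H; apply: (top_cap sds_KRS) => n; apply/(top_located (sds_KR n)).
  - by move=> n; apply/(top_located (sds_KR n)); exact: (top_base sds_KRS).
apply: (@extreme_path (fun=> 0) (fun n => @min_edge _ _ (arr (Pdiagram X) n)) (dyn (base X))).
- by [].
- move=> n e; have ad := sds_adapted (leqnSn n).
  by rewrite (min_edge_offset ad) addn0.
- move=> y H; apply: (bottom_cap (sds_homeo (sysP X)) sds_KRS) => n.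
  exact/(bottom_located (sds_KR n)).
- by move=> n; apply/(bottom_located (sds_KR n)); exact: (bottom_base sds_KRS).
Qed.

End SystemDiagram.

Lemma P_wd : P_well_defined.
Proof. by move=> X; split; [exact: Pdiagram_bratteli|exact: Pdiagram_properly_ordered]. Qed.

(** * The functor P *)

Lemma reads_word_comp X (I J U : finType) (tow : I -> seq (set X)) (tow' : J -> seq (set X))
    (F : eset I J) (G : eset J U) Y u : ordered F -> ordered G ->
  (forall j, reads tow (word F j) (tow' j)) -> reads tow' (word G u) Y ->
  reads tow (word (F \oe G) u) Y.
Proof. by move=> oF oG rF rG; rewrite word_comp //; exact: reads_flatten rG. Qed.

(** Uniqueness of readings in the form of an isomorphism. It settles all comparisons between the
    edge sets that maps induce, with no need to look at edges. *)
Lemma reading_iso (X : topologicalType) (phi : X -> X) (x0 : X) (I : finType)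
    (tow : I -> seq (set X)) (Q : towers X) (F G : eset I Q) :
  tower_family phi tow -> KR_partition phi x0 Q -> ordered F -> ordered G ->
  (forall T, reads tow (word F T) (val T)) -> (forall T, reads tow (word G T) (val T)) ->
  F \iso G.
Proof.
move=> tf KR oF oG rF rG; apply/word_iso => // T.
apply: (reads_unique tf _ (rF T) (rG T)) => i iT.
exact: KR_nonempty KR (valP T) iT.
Qed.

Lemma parts0 (X : sds) (T : parts X 0) : val T = [:: setT].
Proof. by case: T => T TP /=; move: (TP); rewrite (KRs_0 (sds_KRS X)) inE => /eqP. Qed.

(** Substituting one level at a time, a composite of edge sets still spells an itinerary; [epath]
    thus plays the role of the edge set between the partitions of levels [n] and [m]. *)
Lemma sds_epath_reads (X : sds) n m (T : parts X m) : n <= m ->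
  reads (fun S : parts X n => val S) (word (epath (Pdiagram X) n m) T) (val T).
Proof.
have bP := Pdiagram_bratteli X; move=> nm.
have self k (S : parts X k) :
    reads (fun S : parts X k => val S) (word (epath (Pdiagram X) k k) S) (val S).
  by rewrite epath_id word_eid /reads /= cats0; exact: floorwise_refl.
elim: m nm T => [|m IHm]; first by rewrite leqn0 => /eqP ->; exact: self.
rewrite leq_eqVlt => /predU1P[-> //|nm T]; rewrite epathS //.
have ad := sds_adapted X (leqnSn m).
apply: reads_word_comp (IHm nm) _; [exact: epath_ordered|exact: adapted_ordered ad|].
exact: adapted_reads ad T.
Qed.

Section Morphism.
Variables (strict : bool) (X Y : sds) (alpha : sds_hom strict X Y).

Let tow n (S : parts Y n) := preimage_tower alpha (val S).

Lemma preimage_nth (S : seq (set Y)) i x :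
  nth set0 (preimage_tower alpha S) i x <-> nth set0 S i (alpha x).
Proof.
case: (ltnP i (size S)) => iS; first by rewrite (nth_map set0).
by rewrite !nth_default // size_map.
Qed.

Lemma preimage_family n : tower_family (@dyn X) (@tow n).
Proof.
have tf := KR_family (sds_KR Y n); split.
- by move=> S; rewrite -size_eq0 size_map size_eq0; exact: (tf_height tf S).
- move=> S S' k l x; rewrite !size_map => kS lS' /preimage_nth Sx /preimage_nth S'x.
  by have := tf_disjoint tf kS lS' Sx S'x.
- move=> S k x; rewrite size_map => kS /preimage_nth Sx; apply/preimage_nth.
  by rewrite sds_map_dyn; exact: (tf_shift tf).
- move=> x [S]; rewrite -nth_last => /preimage_nth Sx.
  have [|S' S'x] := tf_top tf (x := alpha x).
    by exists S; rewrite -nth_last -(size_map (preimage alpha)).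
  by exists S'; rewrite -nth0; apply/preimage_nth; rewrite nth0 sds_map_dyn.
Qed.

Lemma preimage_towersP n (T : seq (set X)) :
  T \in preimage_towers alpha (parts Y n) <-> exists S : parts Y n, T = tow S.
Proof.
split=> [/imfsetP[S /= SY ->]|[S ->]]; first by exists [` SY]%fset.
by apply/imfsetP; exists (val S) => //; exact: valP.
Qed.

Lemma preimage_top n x : top_of (preimage_towers alpha (parts Y n)) x <-> ftop (@tow n) x.
Proof.
split=> [[T /preimage_towersP[S ->]]|[S Sx]]; first by exists S.
by exists (tow S) => //; apply/preimage_towersP; exists S.
Qed.

Lemma preimage_ftop n x : ftop (@tow n) x <-> top_of (parts Y n) (alpha x).
Proof.
rewrite -ftopE; split=> -[S]; rewrite -nth_last => H; exists S; rewrite -nth_last.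
  by move/preimage_nth: H; rewrite size_map.
by apply/preimage_nth; rewrite size_map.
Qed.

Lemma level_adapted n m :
  refines (preimage_towers alpha (parts Y n)) (parts X m) ->
  top_of (parts X m) `<=` top_of (preimage_towers alpha (parts Y n)) ->
  adapted (@dyn X) (base X) (@tow n) (parts X m).
Proof.
move=> ref tops; split.
- exact: sds_KR.
- exact: preimage_family.
- move=> T Z TX /(ref _ _ TX)[T' [Z' [/preimage_towersP[S ->] Z'S ZZ']]].
  by exists S, (index Z' (tow S)); rewrite index_mem nth_index.
- by move=> x /tops /preimage_top.
Qed.

Lemma admissible_adapted f : admissible alpha f ->
  forall n, adapted (@dyn X) (base X) (@tow n) (parts X (f n)).
Proof. by move=> [_ _ _ ref tops] n; apply: level_adapted. Qed.

(** The floors of [Y] at level [n] are finitely many and have clopen preimages, so far enough every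
    floor of [X] lies inside or outside each of them. It lies inside the preimage of the floor that
    contains the image of one of its points. *)
Lemma level_fine n : exists N, forall m, N <= m ->
  refines (preimage_towers alpha (parts Y n)) (parts X m) /\
  top_of (parts X m) `<=` top_of (preimage_towers alpha (parts Y n)).
Proof.
have cX := sds_compact (sysP X); have KX := sds_KRS X; have KY := sds_KR Y n.
have pre_clopen (A : set Y) : clopen A -> clopen (alpha @^-1` A).
  move=> [oA cA]; split; first by apply: open_comp => // x _; exact: sds_map_cont.
  by apply: preimage_closed => // x _; exact: sds_map_cont.
have [N1 H1] : exists N, forall m, N <= m -> top_of (parts X m) `<=` alpha @^-1` top_of (parts Y n).
  apply: (small_tops cX KX) => //=; last by rewrite sds_map_base; exact: KR_base KY.
  apply: (pre_clopen _ _).1; split; last exact: top_closed KY.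
  rewrite openE => y /(top_located KY)[T ly]; apply: filterS (located_nbhs KY ly) => z lz.
  by apply/(top_located KY); exists T.
have clopen_floor (p : {S : parts Y n & 'I_(size (val S))}) :
    exists N, forall m, N <= m -> forall (T : parts X m) i, i < size (val T) ->
      located T i `<=` alpha @^-1` nth set0 (val (tag p)) (tagged p) \/
      located T i `<=` ~` (alpha @^-1` nth set0 (val (tag p)) (tagged p)).
  apply: (small_floors cX KX); apply: pre_clopen.
  by have [] := KR_clopen KY (valP (tag p)) (mem_nth set0 (ltn_ord (tagged p))).
have [N HN] := choice clopen_floor.
exists (maxn N1 (\max_p N p)) => m; rewrite geq_max => /andP[N1m Nm].
split; last by move=> x /(H1 m N1m) H; apply/preimage_top/preimage_ftop.
move=> T Z TX ZT; have KXm := sds_KR X m.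
have iT : index Z T < size T by rewrite index_mem.
have [x lx] := located_inhabited KXm (T := [` TX]%fset) iT.
have [S [i [iS Sx]]] := located_exists KY (alpha x).
pose p : {S : parts Y n & 'I_(size (val S))} := Tagged (fun S => 'I_(size (val S))) (Ordinal iS).
have pm : N p <= m by apply: leq_trans Nm; exact: leq_bigmax.
exists (tow S), (alpha @^-1` nth set0 (val S) i); split.
- by apply/preimage_towersP; exists S.
- by apply: map_f; exact: mem_nth.
have [sub|sub] := HN p m pm [` TX]%fset _ iT; last by have := sub x lx Sx.
by move=> y Zy; apply: sub; split=> //=; rewrite nth_index.
Qed.

Lemma admissible_exists : exists f, admissible alpha f.
Proof.
have [N HN] := choice level_fine.
(* The three entries of the maximum serve monotonicity, unboundedness and fineness. At 0 the value
   is prescribed, and [H0] uses instead that the partition of [Y] of level 0 is trivial. *)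
pose f := fix f n := if n is k.+1 then maxn (f k) (maxn n (N n)) else 0.
have H0 m : refines (preimage_towers alpha (parts Y 0)) (parts X m) /\
    top_of (parts X m) `<=` top_of (preimage_towers alpha (parts Y 0)).
  have SY : [:: [set: Y]] \in parts Y 0 by rewrite (KRs_0 (sds_KRS Y)) fset11.
  have M : preimage_tower alpha [:: [set: Y]] \in preimage_towers alpha (parts Y 0).
    by apply/preimage_towersP; exists [` SY]%fset.
  split=> [T Z _ _|x _]; last by exists (preimage_tower alpha [:: setT]).
  by exists (preimage_tower alpha [:: setT]), setT; rewrite mem_head.
have H n : refines (preimage_towers alpha (parts Y n)) (parts X (f n)) /\
    top_of (parts X (f n)) `<=` top_of (preimage_towers alpha (parts Y n)).
  by case: n => [|n]; [exact: H0 | apply: HN; rewrite /= !leq_max leqnn !orbT].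
exists f; split=> // [n|m|n|n]; [exact: leq_maxl | | by case: (H n) | by case: (H n)].
by exists m; case: m => //= m; rewrite !leq_max leqnn orbT.
Qed.

Lemma Parrow_reads f n T : admissible alpha f ->
  reads (@tow n) (word (pre (Parrow alpha f) n) T) (val T).
Proof. by move=> /admissible_adapted/(_ n) ad; exact: adapted_reads ad T. Qed.

Lemma Parrow_ordered f n : admissible alpha f -> ordered (pre (Parrow alpha f) n).
Proof. by move=> /admissible_adapted/(_ n) ad; exact: adapted_ordered ad. Qed.

(* Both sides of any commuting square spell the itinerary of a tower of [X] through
   the preimages of the towers of [Y]. *)
Lemma arr_Parrow_reads f n m T : admissible alpha f -> n <= m ->
  reads (@tow n) (word (epath (Pdiagram Y) n m \oe pre (Parrow alpha f) m) T) (val T).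
Proof.
move=> adm nm; have bY := Pdiagram_bratteli Y.
apply: reads_word_comp (Parrow_reads T adm); [exact: epath_ordered|exact: Parrow_ordered|].
by move=> S; apply: reads_preimage; exact: sds_epath_reads.
Qed.

Lemma Parrow_epath_reads f n k T : admissible alpha f -> f n <= k ->
  reads (@tow n) (word (pre (Parrow alpha f) n \oe epath (Pdiagram X) (f n) k) T) (val T).
Proof.
move=> adm nk; have bX := Pdiagram_bratteli X.
apply: reads_word_comp (sds_epath_reads T nk); [exact: Parrow_ordered|exact: epath_ordered|].
by move=> S; exact: Parrow_reads.
Qed.

Lemma Parrow_premorphism f : admissible alpha f -> is_premorphism strict (Parrow alpha f).
Proof.
move=> adm; have [f0 fS fN _ _] := adm.
have bX := Pdiagram_bratteli X; have bY := Pdiagram_bratteli Y.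
have ro n : rng_onto (pre (Parrow alpha f) n) := adapted_rng_onto (admissible_adapted adm n).
have ex n : exists e : pre (Parrow alpha f) n, True.
  have [T _] := located_exists (sds_KR X (f n)) (base X).
  by have [e _] := ro n T; exists e.
split=> //.
- by move=> n; have [e _] := ex n; apply/card_gt0P; exists e.
- by move=> n; exact: Parrow_ordered.
- move=> s n; apply: adapted_src_onto (admissible_adapted adm n) _ => S.
  have S0 := tower_size (sds_KR Y n) S; have [y Sy] := KR_nonempty (sds_KR Y n) (valP S) S0.
  have [x xy] := sds_map_onto alpha s y; exists 0; rewrite size_map; split=> //.
  by exists x; apply/preimage_nth; rewrite xy.
- apply/eqP; rewrite eqn_leq; apply/andP; split; last first.
    by have [e _] := ex 0; apply/card_gt0P; exists e.
  (* The range of the edges is at level [f 0], which equals 0 only propositionally, hence the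
     variable [k]. Towers of height one leave 0 as the only offset. *)
  have one k : k = 0 -> forall T : parts X k, val T = [:: setT].
    by move=> -> T; exact: parts0.
  have ad := admissible_adapted adm 0.
  apply/card_le1_eqP => e e' _ _; apply: (edge_inj (ad_family ad) (adapted_nonempty ad)).
    by apply: val_inj; rewrite !(one _ f0).
  have o (a : pre (Parrow alpha f) 0) : offset a = 0.
    have lt := leq_trans (offset_lt ad a) (edge_fits a).1.
    by apply/eqP; rewrite -leqn0 -ltnS; apply: leq_trans lt _; rewrite (one _ f0).
  by rewrite !o.
- move=> n; apply: eiso_trans (ecomp_iso (eiso_sym (epath1 bY n)) (eiso_refl _)) _.
  apply: (reading_iso (preimage_family n) (sds_KR X (f n.+1))).
  + by apply: ecomp_ordered; [exact: epath_ordered | exact: Parrow_ordered].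
  + by apply: ecomp_ordered; [exact: Parrow_ordered | exact: epath_ordered].
  + by move=> T; exact: arr_Parrow_reads.
  + by move=> T; exact: Parrow_epath_reads.
Qed.

Lemma Parrow_pequiv f g (Hf : admissible alpha f) (Hg : admissible alpha g) :
  pequiv (Parrow alpha f) (Parrow alpha g).
Proof.
have bX := Pdiagram_bratteli X; have bY := Pdiagram_bratteli Y.
have half f' g' (Hf' : admissible alpha f') (Hg' : admissible alpha g') :
    @dominated (Obd bY) (Obd bX) (Parrow alpha f') (Parrow alpha g').
  pose pf := @Premorphism strict (Obd bY) (Obd bX) _ (Parrow_premorphism Hf').
  pose pg := @Premorphism strict (Obd bY) (Obd bX) _ (Parrow_premorphism Hg').
  apply: (@square_dominated strict _ _ pf pg) => N.
  have [m Nm fm] := lev_large pg (lev pf N) N.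
  exists N, m; split=> //; first exact: ltnW.
  apply: (reading_iso (preimage_family N) (sds_KR X (g' m))).
  + by apply: ecomp_ordered; [exact: epath_ordered | exact: Parrow_ordered].
  + by apply: ecomp_ordered; [exact: Parrow_ordered | apply: epath_ordered => //; exact: ltnW].
  + by move=> T; exact: arr_Parrow_reads.
  + by move=> T; apply: Parrow_epath_reads => //; exact: ltnW.
apply: (@pequivP strict _ _ (@Premorphism strict (Obd bY) (Obd bX) _ (Parrow_premorphism Hf))
  (@Premorphism strict (Obd bY) (Obd bX) _ (Parrow_premorphism Hg))).2.
by split; apply: half.
Qed.

End Morphism.

Section FunctorP.
Variable strict : bool.
Local Notation Pob := (@Pob strict P_wd).

Definition Pmor (X Y : SDS strict) (alpha : hom X Y) f (adm : @admissible X Y (sds_map alpha) f) :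
  premorphism strict (sval (Pob Y)) (sval (Pob X)) :=
  @Premorphism strict (sval (Pob Y)) (sval (Pob X)) _ (Parrow_premorphism adm).

Definition Pmap (X Y : SDS strict) (alpha : hom X Y) : hom (Pob Y) (Pob X) :=
  pclass (Pmor (svalP (cid (admissible_exists alpha)))).

Lemma PmapE (X Y : SDS strict) (alpha : hom X Y) f
    (adm : @admissible X Y (sds_map alpha) f) :
  Pmap alpha = pclass (Pmor adm).
Proof. by apply/pclassP; exact: (Parrow_pequiv (svalP (cid (admissible_exists alpha))) adm). Qed.

Lemma Pmap_id (X : SDS strict) : Pmap (idm X) = idm (Pob X).
Proof.
have tow_id n (S : parts X n) : preimage_tower id (val S) = val S.
  by rewrite /preimage_tower -[RHS]map_id; apply: eq_map => Z.
have towers_id n : preimage_towers (sds_map (idm X)) (parts X n) = parts X n.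
  apply/fsetP => T; apply/idP/idP => [/(preimage_towersP (sds_id strict X))[S ->]|TX].
    by rewrite tow_id; exact: valP.
  by apply/(preimage_towersP (sds_id strict X)); exists [` TX]%fset; rewrite tow_id.
have adm : @admissible X X (sds_map (idm X)) id.
  split=> // [N|n|n]; [by exists N | | by rewrite towers_id].
  by rewrite towers_id => T Y TX YT; exists T, Y; split=> // x.
rewrite (PmapE adm); apply/pclassP.
apply: (@pequiv_levelwise strict _ _ (Pmor adm) (pid strict _) _ _ _ erefl erefl) => n.
apply: (reading_iso (preimage_family (sds_id strict X) n) (sds_KR X n)).
- exact: (Parrow_ordered n adm).
- exact: eid_ordered.
- by move=> T; exact: (Parrow_reads T adm).
- move=> T; rewrite word_eid /reads /= cats0 -[X in floorwise X _](tow_id n).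
  exact: floorwise_refl.
Qed.

Lemma Pmap_comp (X Y Z : SDS strict) (beta : hom Y Z) (alpha : hom X Y) :
  Pmap (beta \oc alpha) = Pmap alpha \oc Pmap beta.
Proof.
have [f af] := admissible_exists alpha; have [g bg] := admissible_exists beta.
have tow_comp (S : seq (set Z)) : preimage_tower (sds_map (beta \oc alpha)) S =
    preimage_tower alpha (preimage_tower beta S).
  by rewrite /preimage_tower -map_comp.
have reads_comp n (T : parts X (f (g n))) :
    reads (fun S : parts Z n => preimage_tower (sds_map (beta \oc alpha)) (val S))
      (word (pre (Parrow beta g) n \oe pre (Parrow alpha f) (g n)) T) (val T).
  apply: (reads_word_comp _ _ _ (Parrow_reads T af)); [exact: Parrow_ordered..|].
  move=> S; have := reads_preimage alpha (Parrow_reads S bg).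
  by rewrite /reads (eq_map (fun S : parts Z n => esym (tow_comp (val S)))).
have adc : @admissible X Z (sds_map (beta \oc alpha)) (f \o g).
  have [f0 fS fN fref ftop] := af; have [g0 gS gN gref gtop] := bg.
  have fle i j : i <= j -> f i <= f j.
    by move: i j; apply: (@homo_leq _ _ leq) => // ? ? ?; exact: leq_trans.
  split.
  - by rewrite /= g0.
  - by move=> n; exact: fle.
  - move=> N; have [m Nm] := fN N; have [n mn] := gN m; exists n.
    exact: leq_trans Nm (fle _ _ mn).
  (* Refinement is read off the composite itinerary: a floor of [T] lies in the floor found at its
     position. *)
  - move=> n T W TX WT; have := reads_comp n [` TX]%fset; set w := word _ _ => -[s h].
    have iT : index W T < size T by rewrite index_mem.
    have := h _ iT; rewrite /= nth_index //.
    have [|u [S [v [l [wE lS ->]]]]] := @flatten_pos _ _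
        (fun S : parts Z n => preimage_tower (sds_map (beta \oc alpha)) (val S))
        w (index W T).
      by rewrite -s.
    rewrite wE nth_flatten_pos // => sub.
    pose S' := preimage_tower (sds_map (beta \oc alpha)) (val S).
    exists S', (nth set0 S' l); split; [|exact: mem_nth lS|exact: sub].
    by apply/(preimage_towersP (sds_comp beta alpha)); exists S.
  - move=> n x tx; apply/(preimage_top (sds_comp beta alpha))/(preimage_ftop (sds_comp beta alpha)).
    apply/(preimage_ftop beta)/(preimage_top beta)/gtop.
    by apply/(preimage_ftop alpha)/(preimage_top alpha)/ftop.
rewrite (PmapE af) (PmapE bg) (PmapE adc) [RHS]obd_compE; apply/pclassP.
apply: (@pequiv_levelwise strict _ _ (Pmor adc) (pcomp (Pmor af) (Pmor bg)) _ _ _ erefl erefl) => n.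
apply: (reading_iso (preimage_family (sds_comp beta alpha) n) (sds_KR X (f (g n)))).
- exact: (Parrow_ordered n adc).
- by apply: ecomp_ordered; [exact: (Parrow_ordered n bg) | exact: (Parrow_ordered (g n) af)].
- by move=> T; exact: (Parrow_reads T adc).
- exact: reads_comp.
Qed.

Definition Pfun : cofunctor Pob := Cofunctor Pmap_id Pmap_comp.

Lemma Pfun_spec : P_spec Pfun.
Proof.
move=> X Y alpha; split; first exact: admissible_exists.
by move=> f adm; exists (Parrow_premorphism adm); exact: (PmapE adm).
Qed.

End FunctorP.

(** * P is fully faithful *)

Lemma flatten_map_flatten (I J K : Type) (f : J -> seq K) (g : I -> seq J) w :
  flatten [seq f j | j <- flatten [seq g i | i <- w]] =
  flatten [seq flatten [seq f j | j <- g i] | i <- w].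
Proof. by elim: w => //= i w IHw; rewrite map_cat flatten_cat IHw. Qed.

(** The dichotomy behind equivariance of the limit map: one step up in a concatenation either stays
    within a tower or leaves a top floor, for a bottom floor if anything follows. *)
Lemma flatten_next X I (tow : I -> seq (set X)) w k :
  (forall i, tow i != [::]) -> k < size (flatten [seq tow i | i <- w]) ->
  let Y := flatten [seq tow i | i <- w] in
  (exists i l, [/\ l.+1 < size (tow i), k.+1 < size Y, nth set0 Y k = nth set0 (tow i) l &
     nth set0 Y k.+1 = nth set0 (tow i) l.+1]) \/
  (exists i, nth set0 Y k = nth set0 (tow i) (size (tow i)).-1 /\
     (k.+1 < size Y -> exists j, nth set0 Y k.+1 = nth set0 (tow j) 0)).
Proof.
move=> tow0; have tow_gt0 i : 0 < size (tow i) by rewrite lt0n size_eq0.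
elim: w k => //= i w IHw k; rewrite size_cat => kY.
case: (ltnP k (size (tow i))) => [ki|ik]; last first.
  have catl m : size (tow i) <= m ->
      nth set0 (tow i ++ flatten [seq tow i | i <- w]) m =
      nth set0 (flatten [seq tow i | i <- w]) (m - size (tow i)).
    by move=> im; rewrite nth_cat ltnNge im.
  have sub m : size (tow i) <= m -> m - size (tow i) < size (flatten [seq tow i | i <- w]) ->
      m < size (tow i) + size (flatten [seq tow i | i <- w]).
    by move=> im; rewrite ltn_subLR.
  rewrite !catl ?(leqW ik) // subSn //.
  have [|[j [l [lj kl E1 E2]]]|[j [E1 E2]]] := IHw (k - size (tow i)).
  - by rewrite ltn_subLR.
  - by left; exists j, l; split=> //; apply: sub; rewrite ?(leqW ik) // subSn.
  - right; exists j; split=> // kY'; apply: E2.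
    by rewrite -subSn // ltn_subLR // (leqW ik).
rewrite !nth_cat ki; case: (ltnP k.+1 (size (tow i))) => [ki'|ik].
  by left; exists i, k; rewrite ltn_addr ?nth_cat ?ki'.
have E : size (tow i) = k.+1 by apply/eqP; rewrite eqn_leq ik.
right; exists i; split; first by rewrite E.
rewrite E subnn => kY'; case: w kY' {IHw kY} => [|j w] /=; first by rewrite addn0 ltnn.
by exists j; rewrite nth_cat tow_gt0.
Qed.

Lemma flatten_head X I (tow : I -> seq (set X)) w :
  (forall i, tow i != [::]) -> 0 < size (flatten [seq tow i | i <- w]) ->
  exists i, nth set0 (flatten [seq tow i | i <- w]) 0 = nth set0 (tow i) 0.
Proof.
by case: w => //= i w tow0 _; exists i; rewrite nth_cat lt0n size_eq0 tow0.
Qed.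

Definition same_floor (X : sds) n (x y : X) : Prop :=
  exists (T : parts X n) i, located T i x /\ located T i y.

Lemma same_floor_le (X : sds) n m (x y : X) : n <= m -> same_floor m x y -> same_floor n x y.
Proof.
move=> nm [T [i [lx ly]]].
have [S [k [kS sub]]] := adapted_located (sds_adapted X nm) lx.1.
by exists S, k; split; split=> //; exact: sub.
Qed.

(** The metric gives a neighbourhood of [x] that avoids [y], and floors form a basis. A common floor
    at a fine level gives one at every coarser level, so cofinally many levels suffice. *)
Lemma sds_separated (X : sds) (x y : X) :
  (forall N, exists2 n, N <= n & same_floor n x y) -> x = y.
Proof.
move=> H; have [d [d0 dC dT dnbhs]] := sds_metrizable (sysP X).
apply: contrapT => xy; have dxy : (0 < d x y)%R.
  rewrite lt_neqAle eq_sym; apply/andP; split; first by apply/eqP => /d0.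
  have := dT x y x; rewrite (dC y x) ((d0 x x).2 erefl).
  by rewrite -mulr2n pmulrn_lge0.
have nx : nbhs x [set z | (d x z < d x y)%R] by rewrite dnbhs; exists (d x y).
have [n [T [i [lx sub]]]] := floor_nbhs (sds_KRS X) nx.
have [m nm /(same_floor_le nm)[T' [i' [lx' ly']]]] := H n.
have [E E'] := located_unique (sds_KR X n) lx' lx; subst T' i'.
by have := sub y ly'; rewrite /= ltxx.
Qed.

Section Faithful.
Variables (strict : bool) (X Y : SDS strict).

(** Equality of the classes provides, for each [n], a single word that reads a tower around [x] both
    through preimages under [alpha] and through preimages under [beta]. At the position of [x] it
    names one floor of [Y], which contains both images. *)
Lemma Pmap_faithful (alpha beta : hom X Y) : Pmap alpha = Pmap beta -> alpha = beta.
Proof.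
have [f af] := admissible_exists alpha; have [g bg] := admissible_exists beta.
rewrite (PmapE af) (PmapE bg) => /pclassP /pequivP[dom _].
apply: sds_homP => x; apply: sds_separated => n; exists n => //.
have [m /(_ m (leqnn m))[nm [fg sq]]] := dom n.
have bX := Pdiagram_bratteli X; have bY := Pdiagram_bratteli Y.
have [T [i [iT Tx]]] := located_exists (sds_KR X (g m)) x.
have rb := arr_Parrow_reads T bg nm; have ra := Parrow_epath_reads T af fg.
have E : word (epath (Pdiagram Y) n m \oe pre (Parrow beta g) m) T =
         word (pre (Parrow alpha f) n \oe epath (Pdiagram X) (f n) (g m)) T.
  apply: ((word_iso _ _).1 sq T); apply: ecomp_ordered;
    by [exact: epath_ordered | exact: Parrow_ordered].
rewrite E in rb; move: rb ra; set w := word _ _ => -[s h] [s' h'].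
have := h _ iT _ Tx; have := h' _ iT _ Tx.
have [|u [S [v [l [wE lS iE]]]]] := @flatten_pos _ _
    (fun S : parts Y n => preimage_tower alpha (val S)) w i.
  by rewrite -s'.
have lS' : l < size (preimage_tower beta (val S)) by move: lS; rewrite !size_map.
have iE' : i = size (flatten [seq preimage_tower beta (val s0) | s0 <- u]) + l.
  rewrite iE; congr (_ + l); rewrite !size_flatten /shape -!map_comp; congr sumn.
  by apply: eq_map => S' /=; rewrite !size_map.
rewrite wE {1}iE nth_flatten_pos // {1}iE' nth_flatten_pos //.
move=> /preimage_nth Sa /preimage_nth Sb; exists S, l.
by rewrite size_map in lS.
Qed.

End Faithful.

(** * Fullness: the map determined by a premorphism *)

Section Full.
Variables (strict : bool) (X Y : sds) (lv : nat -> nat).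
Variable F : forall n, eset (parts Y n) (parts X (lv n)).
Hypothesis Fpre : is_premorphism strict (@Prearrow (Pdiagram Y) (Pdiagram X) lv F).

Let bX := Pdiagram_bratteli X.
Let bY := Pdiagram_bratteli Y.
Let oF n : ordered (F n) := pre_ordered Fpre n.

Let height_neq0 n (S : parts Y n) : val S != [::] := tf_height (KR_family (sds_KR Y n)) S.

(* The floors of [Y] through which the premorphism makes the tower [T] of [X] pass. *)
Definition itinerary n (T : parts X (lv n)) : seq (set Y) :=
  flatten (map (fun S : parts Y n => val S) (word (F n) T)).

(** This is the commuting square of the premorphism: reading the towers of [Y] in the itinerary of
    [T] one level lower spells the same word as going down in [X] first. *)
Lemma itinerary_step n (T : parts X (lv n.+1)) :
  floorwise (itinerary T)
    (flatten [seq itinerary t | t <- word (epath (Pdiagram X) (lv n) (lv n.+1)) T]).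
Proof.
have oA : ordered (arr (Pdiagram Y) n) by case: bY => _ /(_ n) [].
have oE := epath_ordered bX (lev_mono Fpre n).
have := (word_iso (ecomp_ordered oA (oF n.+1)) (ecomp_ordered (oF n) oE)).1 (pre_comm Fpre n) T.
rewrite (word_comp _ oA (oF n.+1)) (word_comp _ (oF n) oE) => E.
rewrite /itinerary -flatten_map_flatten -E.
apply: (reads_flatten (tow' := fun S : parts Y n.+1 => val S)); last exact: floorwise_refl.
by move=> S; exact: adapted_reads (sds_adapted Y (leqnSn n)) S.
Qed.

(** A premorphism says nothing about heights. They match at level 0, where there is one edge between
    towers of height one, and the commuting squares carry the equality upwards. *)
Lemma itinerary_size n (T : parts X (lv n)) : size (itinerary T) = size (val T).
Proof.
elim: n T => [|n IHn] T.
  have [F1] : exists e, forall e' : F 0, e' = e.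
    have /card_le1_eqP H : #|F 0| <= 1 by rewrite (pre0 Fpre).
    have /card_gt0P[e _] := pre_nonempty Fpre 0.
    by exists e => e'; exact: H.
  move=> F1P; have : size (word (F 0) T) = 1.
    rewrite size_map -[RHS]/(size [:: F1]); apply/perm_size/uniq_perm => //.
      exact: fibre_uniq.
    move=> e; rewrite mem_fibre inE (F1P e) eqxx; apply/eqP.
    by have [e' <-] := @pre_rng _ _ _ _ Fpre 0 T; rewrite (F1P e').
  rewrite /itinerary; case: (word _ _) => [|S [|? ?]] //= _.
  rewrite cats0 parts0 /=.
  have one k : k = 0 -> forall T : parts X k, val T = [:: setT].
    by move=> -> U; exact: parts0.
  by rewrite (one _ (lev0 Fpre)).
have [-> _] := itinerary_step T.
have [-> _] := sds_epath_reads T (lev_mono Fpre n).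
rewrite !size_flatten /shape -!map_comp; congr sumn.
by apply: eq_map => t /=; exact: IHn.
Qed.

(** The approximation of level [n] to the graph of the map to be constructed; the set of all [y]
    related to a given [x] is one floor of [Y]. *)
Definition meets n (x : X) (y : Y) : Prop :=
  exists (T : parts X (lv n)) i, located T i x /\ nth set0 (itinerary T) i y.

Lemma itinerary_floor n (T : parts X (lv n)) i : i < size (val T) ->
  exists (S : parts Y n) l, [/\ l < size (val S), S \in word (F n) T &
    nth set0 (itinerary T) i = nth set0 (val S) l].
Proof.
rewrite -itinerary_size => /flatten_pos[u [S [v [l [wE lS ->]]]]].
exists S, l; split=> //; first by rewrite wE mem_cat mem_head orbT.
by rewrite /itinerary wE nth_flatten_pos.
Qed.

Lemma meets_floor n x y : meets n x y <->
  exists (T : parts X (lv n)) i (S : parts Y n) l, [/\ located T i x, located S l y &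
    nth set0 (itinerary T) i = nth set0 (val S) l].
Proof.
split=> [[T [i [lx Ly]]]|[T [i [S [l [lx [_ ly] E]]]]]].
  have [S [l [lS _ E]]] := itinerary_floor lx.1.
  by exists T, i, S, l; split=> //; split=> //; rewrite -E.
by exists T, i; rewrite E.
Qed.

(** By [itinerary_size], the reading of [T] by towers of level [lv n] and the concatenation of their
    itineraries break at the same positions, so [x] and [y] fall into the same block at the same
    height. *)
Lemma meets_le n x y : meets n.+1 x y -> meets n x y.
Proof.
move=> [T [i [[iT Tx] Ly]]].
have [sE E] := sds_epath_reads T (lev_mono Fpre n).
have [sL EL] := itinerary_step T.
set w := word _ _ in sE E sL EL.
have := E _ iT _ Tx; have := EL i; rewrite itinerary_size => /(_ iT _ Ly).
have [|u [S [v [l [wE lS iE]]]]] := @flatten_pos _ _ (fun S : parts X (lv n) => val S) w i.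
  by rewrite -sE.
have iE' : i = size (flatten [seq itinerary t | t <- u]) + l.
  rewrite iE; congr (_ + l); rewrite !size_flatten /shape -!map_comp; congr sumn.
  by apply: eq_map => t /=; rewrite itinerary_size.
rewrite wE {1}iE' nth_flatten_pos ?itinerary_size // {1}iE nth_flatten_pos // => Sy Sx.
by exists S, l.
Qed.

Lemma meets_ex n x : exists y, meets n x y.
Proof.
have [T [i lx]] := located_exists (sds_KR X (lv n)) x.
have [S [l [lS _ E]]] := itinerary_floor lx.1.
have [y ly] := located_inhabited (sds_KR Y n) lS.
by exists y; apply/meets_floor; exists T, i, S, l.
Qed.

(** By the source condition the tower through [y] occurs in the word of some [T], and the floor of
    [T] at the matching position is nonempty. *)
Lemma meets_onto n y : strict -> exists x, meets n x y.
Proof.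
move=> s; have [S [l ly]] := located_exists (sds_KR Y n) y.
have [T] := (src_onto_word _).1 (@pre_src _ _ _ _ Fpre s n) S.
move=> ST; have [u [v E]] : exists u v, word (F n) T = u ++ S :: v.
  by case/splitPr: ST => u v; exists u, v.
have sT := itinerary_size T; rewrite /itinerary E in sT.
set i := size (flatten (map (fun S : parts Y n => val S) u)) + l.
have iT : i < size (val T).
  rewrite -sT map_cat flatten_cat size_cat ltn_add2l /= size_cat.
  by rewrite ltn_addr //; exact: ly.1.
have [x lx] := located_inhabited (sds_KR X (lv n)) iT.
exists x; apply/meets_floor; exists T, i, S, l; split=> //.
by rewrite /itinerary E nth_flatten_pos //; exact: ly.1.
Qed.

Lemma meets_same_floor n x y y' : meets n x y -> meets n x y' -> same_floor n y y'.
Proof.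
move=> /meets_floor[T [i [S [l [lx [lS ly] E]]]]] [T' [i' [lx' Ly']]].
have [? ?] := located_unique (sds_KR X (lv n)) lx lx'; subst T' i'.
by exists S, l; rewrite E in Ly'.
Qed.

Lemma meets_closedr n x : closed (meets n x).
Proof.
apply: (saturated_closed (sds_KR Y n)) => S l y y' ly ly'.
move=> /meets_floor[T [i [S' [l' [lx ly'' E]]]]]; apply/meets_floor.
have [? ?] := located_unique (sds_KR Y n) ly ly''; subst S' l'.
by exists T, i, S, l.
Qed.

Lemma meets_locatedl n (T : parts X (lv n)) i x x' y :
  located T i x -> located T i x' -> meets n x y -> meets n x' y.
Proof.
move=> lx lx' [T' [i' [lx'' Ly]]].
have [? ?] := located_unique (sds_KR X (lv n)) lx lx''; subst T' i'.
by exists T, i.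
Qed.

Lemma meets_limit x : exists y, forall n, meets n x y.
Proof.
apply: (nested_nonempty (sds_compact (sysP Y))); first by move=> n; exact: meets_closedr.
  by move=> n y; exact: meets_le.
by move=> n; exact: meets_ex.
Qed.

Definition limit_map (x : X) : Y := sval (cid (meets_limit x)).

Lemma limit_mapP x n : meets n x (limit_map x).
Proof. exact: (svalP (cid (meets_limit x)) n). Qed.

Lemma limit_map_eq x y : (forall n, meets n x y) -> limit_map x = y.
Proof.
move=> H; apply: sds_separated => n; exists n => //.
exact: meets_same_floor (limit_mapP x n) (H n).
Qed.

Lemma limit_map_cont : continuous limit_map.
Proof.
move=> x A /(floor_nbhs (sds_KRS Y)) [n [S [l [ly sub]]]].
have [T [i [lx Ly]]] := limit_mapP x n.
rewrite /nbhs /=; apply: filterS (located_nbhs (sds_KR X (lv n)) lx) => x' lx' /=; apply: sub.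
have := meets_same_floor (limit_mapP x n) (meets_locatedl lx' lx (limit_mapP x' n)).
by move=> [S' [l' [/(located_unique (sds_KR Y n) ly)[<- <-]]]].
Qed.

Lemma meets_top n x y : meets n x y -> top_of (parts X (lv n)) x -> top_of (parts Y n) y.
Proof.
move=> [T [i [lx Ly]]] /(located_top (sds_KR X (lv n)) lx) E.
have iL : i < size (itinerary T) by rewrite itinerary_size; exact: lx.1.
have [[S [l [_ + _ _]]]|[S [E' _]]] := flatten_next (@height_neq0 n) iL.
  by rewrite -/(itinerary T) itinerary_size E prednK ?ltnn //; exact: leq_ltn_trans lx.1.
apply/(top_located (sds_KR Y n)); exists S; split; last by rewrite -E'.
by rewrite prednK ?(tower_size (sds_KR Y n)).
Qed.

Lemma meets_bottom n x y : meets n x y -> bottom_of (parts X (lv n)) x -> bottom_of (parts Y n) y.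
Proof.
move=> [T [i [lx Ly]]] /(located_bottom (sds_KR X (lv n)) lx) E; subst i.
have iL : 0 < size (itinerary T) by rewrite itinerary_size; exact: lx.1.
have [S E'] := flatten_head (@height_neq0 n) iL.
apply/(bottom_located (sds_KR Y n)); exists S; split; last by rewrite -E'.
exact: tower_size (sds_KR Y n) S.
Qed.

(** Inside a coarse tower the itinerary moves with the dynamics. At the end of one, be it inside [T]
    or at the top of [T], only the passage from a top floor to a bottom floor is known. *)
Lemma meets_dyn n x y y' : meets n x y -> meets n (dyn x) y' ->
  same_floor n (dyn y) y' \/ (top_of (parts Y n) y /\ bottom_of (parts Y n) y').
Proof.
move=> xy xy'; have [T [i [lx Ly]]] := xy.
have KX := sds_KR X (lv n); have KY := sds_KR Y n.
have [ltT|] := ltnP i.+1 (size (val T)); last first.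
  move=> Ti; right; have tx : top_of (parts X (lv n)) x.
    apply/(top_located KX); exists T; suff <- : i = (size (val T)).-1 by [].
    by apply/eqP; rewrite eqn_leq -ltnS prednK ?(tower_size KX) // lx.1 /= -subn1 leq_subLR add1n.
  split; first exact: meets_top xy tx.
  by apply: meets_bottom xy' _; rewrite -(KR_top KX); exists x.
have lx' := located_shift KX ltT lx.
have [T' [i' [lx'' Ly']]] := xy'.
have [? ?] := located_unique KX lx' lx''; subst T' i'.
have iL : i < size (itinerary T) by rewrite itinerary_size; exact: lx.1.
have [[S [l [lS _ E1 E2]]]|[S [E1 E2]]] := flatten_next (@height_neq0 n) iL.
  left; exists S, l.+1; split; last by split=> //; rewrite -E2.
  by apply: (located_shift KY) => //; split; [exact: ltnW | rewrite -E1].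
right; split.
  apply/(top_located KY); exists S; split; last by rewrite -E1.
  by rewrite prednK ?(tower_size KY).
have [|S' E'] := E2; first by rewrite -/(itinerary T) itinerary_size.
apply/(bottom_located KY); exists S'; split; last by rewrite -E'.
exact: tower_size KY S'.
Qed.

Lemma limit_map_dyn x : limit_map (dyn x) = dyn (limit_map x).
Proof.
have KS := sds_KRS Y; set y := limit_map x; set y' := limit_map _.
(* If the second alternative of [meets_dyn] holds cofinally, then [y] is in all tops and [y'] in all
   bottoms, which leaves [base Y] and its image. Otherwise the first alternative holds from some
   level on and [sds_separated] applies. *)
case: (pselect (forall N, exists2 n, N <= n &
    top_of (parts Y n) y /\ bottom_of (parts Y n) y')) => [H|].
  have -> : y = base Y.
    by apply: (top_cap KS) => N; have [n Nn [ty _]] := H N; exact: top_le KS _ _ Nn _ ty.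
  apply: (bottom_cap (sds_homeo (sysP Y)) KS) => N.
  by have [n Nn [_ b]] := H N; exact: bottom_le KS _ _ Nn _ b.
move=> /existsNP[N HN]; apply/esym/sds_separated => M.
exists (maxn M N); first exact: leq_maxl.
have [//|tb] := meets_dyn (limit_mapP x (maxn M N)) (limit_mapP (dyn x) (maxn M N)).
by case: HN; exists (maxn M N); first exact: leq_maxr.
Qed.

Lemma limit_map_base : limit_map (base X) = base Y.
Proof.
apply: (top_cap (sds_KRS Y)) => n; apply: meets_top (limit_mapP _ n) _.
exact: top_base (sds_KRS X) _.
Qed.

Lemma limit_map_onto : strict -> forall y, exists x, limit_map x = y.
Proof.
move=> s y; have [||n|x Hx] := nested_nonempty (sds_compact (sysP X)) (C := fun n x => meets n x y).
- move=> n; apply: (saturated_closed (sds_KR X (lv n))) => T i x x'.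
  exact: meets_locatedl.
- by move=> n x; exact: meets_le.
- exact: meets_onto.
by exists x; exact: limit_map_eq.
Qed.

Definition limit_hom : sds_hom strict X Y :=
  SdsHom limit_map_cont limit_map_dyn limit_map_base limit_map_onto.

(** With [reading_iso] this makes [F n] isomorphic to the edge set that the limit map induces at the
    same levels, so that the given premorphism represents its image under [P]. *)
Lemma limit_hom_reads n (T : parts X (lv n)) :
  reads (fun S : parts Y n => preimage_tower limit_hom (val S)) (word (F n) T) (val T).
Proof.
have E : flatten (map (fun S : parts Y n => preimage_tower limit_hom (val S)) (word (F n) T)) =
    preimage_tower limit_hom (itinerary T).
  by rewrite /itinerary [RHS]map_flatten -[in RHS]map_comp.
rewrite /reads E; split; first by rewrite size_map itinerary_size.
move=> i iT x Tx; apply/preimage_nth.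
have [T' [i' [lx Lx]]] := limit_mapP x n.
have lx' : located T i x by [].
by have [? ?] := located_unique (sds_KR X (lv n)) lx' lx; subst T' i'.
Qed.

Lemma limit_hom_admissible : admissible limit_hom lv.
Proof.
split.
- exact: lev0 Fpre.
- exact: lev_mono Fpre.
- exact: lev_unbounded Fpre.
- move=> n T Z TX ZT.
  have iT : index Z T < size T by rewrite index_mem.
  have [S [l [lS Sw E]]] := itinerary_floor (T := [` TX]%fset) iT.
  exists (preimage_tower limit_hom (val S)), (limit_hom @^-1` nth set0 (val S) l); split.
  + by apply/preimage_towersP; exists S.
  + by apply: map_f; exact: mem_nth.
  move=> x Zx; have lx : located [` TX]%fset (index Z T) x by split=> //=; rewrite nth_index.
  have [T' [i' [lx' Lx]]] := limit_mapP x n.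
  have [? ?] := located_unique (sds_KR X (lv n)) lx lx'; subst T' i'.
  by rewrite E in Lx.
- move=> n x tx; apply/preimage_top/preimage_ftop.
  exact: meets_top (limit_mapP x n) tx.
Qed.

End Full.

Lemma Pmap_full (strict : bool) (X Y : SDS strict)
    (h : hom (@Pob strict P_wd Y) (@Pob strict P_wd X)) :
  exists alpha : hom X Y, Pmap alpha = h.
Proof.
rewrite -[h]reprK; case: (repr h) => [[lv F] Fpre].
have adm := limit_hom_admissible Fpre.
exists (limit_hom Fpre); rewrite (@PmapE _ _ _ (limit_hom Fpre) _ adm); apply/pclassP.
apply: (@pequiv_levelwise strict _ _ (Pmor adm) (Premorphism Fpre) _ _ _ erefl erefl) => n.
apply: (reading_iso (preimage_family (limit_hom Fpre) n) (sds_KR X (lv n))).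
- exact: (Parrow_ordered n adm).
- exact: (pre_ordered Fpre n).
- by move=> T; exact: (Parrow_reads T adm).
- exact: (limit_hom_reads Fpre).
Qed.

(** * Successors in composite edge sets *)

(** Range and rank determine an edge, which reduces extreme edges and successors to arithmetic. *)
Definition rank S T (F : eset S T) (e : F) : nat := index e (fibre F (rng F e)).

Section Rank.
Variables (S T : finType) (F : eset S T).
Hypothesis oF : ordered F.
Implicit Types e : F.

Lemma rank_lt e : rank e < size (fibre F (rng F e)).
Proof. by rewrite index_mem mem_fibre. Qed.

Lemma rank_inj e e' : rng F e = rng F e' -> rank e = rank e' -> e = e'.
Proof.
by rewrite /rank => r; rewrite -r => i; apply: (index_inj e) i; rewrite mem_fibre // r.
Qed.

Lemma nth_fibre_rank e0 e : nth e0 (fibre F (rng F e)) (rank e) = e.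
Proof. by rewrite nth_index // mem_fibre. Qed.

Lemma rank_surj t i : i < size (fibre F t) -> exists e, rng F e = t /\ rank e = i.
Proof.
case E : (fibre F t) => [//|e0 s]; rewrite -E => it.
have r : rng F (nth e0 (fibre F t) i) = t by apply/eqP; rewrite -mem_fibre mem_nth.
by exists (nth e0 (fibre F t) i); rewrite /rank r index_uniq ?fibre_uniq.
Qed.

Lemma eleE e e' : ele F e e' = (rng F e == rng F e') && (rank e <= rank e').
Proof.
have [_ _ _ cF] := oF; case: (eqVneq (rng F e) (rng F e')) => r /=.
  by rewrite (ele_index oF (erefl _) (esym r)) /rank r.
by apply: contraNF r => le; rewrite -cF le.
Qed.

Lemma max_edge_rank e : max_edge e <-> (rank e).+1 = size (fibre F (rng F e)).
Proof.
split=> [me|re e'].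
  apply/eqP; rewrite eqn_leq rank_lt leqNgt; apply/negP => /rank_surj[e' [r rr]].
  have := me e'; rewrite eleE r eqxx rr leqnSn => /(_ isT) ee.
  by have := rr; rewrite ee => /n_Sn.
rewrite eleE => /andP[/eqP r le]; apply: rank_inj => //.
by apply/eqP; rewrite eqn_leq le andbT -ltnS re r rank_lt.
Qed.

Lemma min_edge_rank e : min_edge e <-> rank e = 0.
Proof.
split=> [me|re e'].
  have [|e' [r rr]] := @rank_surj (rng F e) 0; first exact: leq_ltn_trans (rank_lt e).
  by have := me e'; rewrite eleE r eqxx rr => /(_ isT) <-.
by rewrite eleE re leqn0 => /andP[/eqP r /eqP rr]; apply: rank_inj => //; rewrite re.
Qed.

Lemma succ_edge_rank e e' :
  succ_edge e e' <-> rng F e' = rng F e /\ rank e' = (rank e).+1.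
Proof.
split=> [[]|[r re]].
  rewrite eleE => /andP[/eqP r le] ne H; split=> //.
  have lt : rank e < rank e'.
    by rewrite ltn_neqAle le andbT; apply: contra ne => /eqP /(rank_inj r) ->.
  apply/eqP; rewrite eqn_leq lt andbT.
  have [|e'' [r'' re'']] := @rank_surj (rng F e) (rank e).+1.
    by apply: leq_ltn_trans lt _; rewrite r rank_lt.
  have ne'' : e'' != e by apply/eqP => E; move: re''; rewrite E => /n_Sn.
  by have := H e''; rewrite !eleE r'' eqxx re'' leqnSn => /(_ isT ne'') /andP[].
split; first by rewrite eleE r eqxx re leqnSn.
  by apply/eqP => E; move: re; rewrite E => /n_Sn.
move=> e''; rewrite !eleE r re => /andP[/eqP r'' le] ne.
rewrite r'' eqxx ltn_neqAle le andbT.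
by apply: contra ne => /eqP rr; apply/eqP/rank_inj.
Qed.

Lemma succ_edge_fun e e' e'' : succ_edge e e' -> succ_edge e e'' -> e' = e''.
Proof.
move=> /succ_edge_rank[r1 r2] /succ_edge_rank[r3 r4].
by apply: rank_inj; rewrite ?r1 ?r2.
Qed.

Lemma succ_edge_inj e e' e'' : succ_edge e e'' -> succ_edge e' e'' -> e = e'.
Proof.
move=> /succ_edge_rank[r1 r2] /succ_edge_rank[r3 r4].
by apply: rank_inj; [rewrite -r1 | apply: succn_inj; rewrite -r2].
Qed.

Lemma succ_edge_ex e : ~ max_edge e -> exists e', succ_edge e e'.
Proof.
move=> /max_edge_rank /eqP ne.
have [|e' [r rr]] := @rank_surj (rng F e) (rank e).+1.
  by rewrite ltn_neqAle ne rank_lt.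
by exists e'; apply/succ_edge_rank.
Qed.

Lemma pred_edge_ex e : ~ min_edge e -> exists e', succ_edge e' e.
Proof.
move=> /min_edge_rank /eqP; rewrite -lt0n => e0.
have [|e' [r rr]] := @rank_surj (rng F e) (rank e).-1.
  by apply: leq_ltn_trans (rank_lt e); exact: leq_pred.
by exists e'; apply/succ_edge_rank; rewrite rr prednK.
Qed.

Lemma succ_not_max e e' : succ_edge e e' -> ~ max_edge e.
Proof. by move=> [le ne _] me; rewrite (me e' le) eqxx in ne. Qed.

Lemma succ_not_min e e' : succ_edge e e' -> ~ min_edge e'.
Proof. by move=> [le ne _] me; rewrite (me e le) eqxx in ne. Qed.

End Rank.

Section CompositeOrder.
Variables (S T U : finType) (F : eset S T) (G : eset T U).
Hypotheses (oF : ordered F) (oG : ordered G) (rF : rng_onto F).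
Implicit Types p q : F \oe G.

Let min_ex t : exists e, rng F e = t /\ min_edge e.
Proof.
have [e0 <-] := rF t.
have [|e [r re]] := @rank_surj _ _ F (rng F e0) 0; first exact: leq_ltn_trans (rank_lt e0).
by exists e; split=> //; apply/min_edge_rank.
Qed.

Let max_ex t : exists e, rng F e = t /\ max_edge e.
Proof.
have [e0 <-] := rF t.
have lt := leq_ltn_trans (leq0n _) (rank_lt e0).
have [|e [r re]] := @rank_surj _ _ F (rng F e0) (size (fibre F (rng F e0))).-1.
  by rewrite prednK.
by exists e; split=> //; apply/max_edge_rank; rewrite ?re ?r ?prednK.
Qed.

Let pair_edge (e : F) (g : G) : rng F e = src G g -> exists p, val p = (e, g).
Proof. by move=> /eqP eg; exists (exist _ (e, g) eg). Qed.

(** An edge above the second component yields a pair above [p] only if some edge of [F] ends at its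
    source; this is where [rng_onto F] enters. *)
Lemma ecomp_max p : max_edge p <-> max_edge (val p).1 /\ max_edge (val p).2.
Proof.
have [reF _ _ cF] := oF; have [reG _ _ _] := oG.
split=> [mp|[m1 m2] q /=].
  split=> e le.
    have [|q qE] := pair_edge (e := e) (g := (val p).2).
      apply/eqP; rewrite -(eqP (valP p)) eq_sym -cF.
      by rewrite le.
    by rewrite -(mp q) ?qE //= qE eqxx /= le.
  have [e' [r _]] := min_ex (src G e); have [q qE] := pair_edge r.
  case: (eqVneq e (val p).2) => // ne.
  by rewrite -(mp q) ?qE //= qE /= eq_sym ne le.
case: eqVneq => [E|ne] /= le.
  apply: val_inj; rewrite [LHS]surjective_pairing [RHS]surjective_pairing -E.
  by rewrite (m1 _ le).
by rewrite orbF in le; rewrite (m2 _ le) eqxx in ne.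
Qed.

Lemma ecomp_min p : min_edge p <-> min_edge (val p).1 /\ min_edge (val p).2.
Proof.
have [reF _ _ cF] := oF; have [reG _ _ _] := oG.
split=> [mp|[m1 m2] q /=].
  split=> e le.
    have [|q qE] := pair_edge (e := e) (g := (val p).2).
      by apply/eqP; rewrite -(eqP (valP p)) -cF le.
    by rewrite -(mp q) ?qE //= qE eqxx /= le.
  have [e' [r _]] := max_ex (src G e); have [q qE] := pair_edge r.
  case: (eqVneq e (val p).2) => // ne.
  by rewrite -(mp q) ?qE //= qE /= ne le.
case: eqVneq => [E|ne] /= le.
  apply: val_inj; rewrite [LHS]surjective_pairing [RHS]surjective_pairing E.
  by rewrite (m1 _ le).
by rewrite orbF in le; rewrite (m2 _ le) eqxx in ne.
Qed.

(** Adding one with carry: the second component moves only when the first is exhausted, and the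
    first is then reset. For the forward implication, the expected successor of [p] is built and
    [succ_edge_fun] identifies it with [q]. *)
Lemma ecomp_succ p q : succ_edge p q <->
  ((val p).2 = (val q).2 /\ succ_edge (val p).1 (val q).1) \/
  [/\ succ_edge (val p).2 (val q).2, max_edge (val p).1 & min_edge (val q).1].
Proof.
have oFG := ecomp_ordered oF oG.
have [reF aF tF cF] := oF; have [reG aG tG cG] := oG.
have back p' q' : ((val p').2 = (val q').2 /\ succ_edge (val p').1 (val q').1) \/
    [/\ succ_edge (val p').2 (val q').2, max_edge (val p').1 & min_edge (val q').1] ->
    succ_edge p' q'.
  move=> [[E [le ne H]]|[[le ne H] mp mq]].
    split=> /=; first by rewrite E eqxx le.
      by apply: contraNneq ne => ->.
    move=> r; case: eqVneq => [E'|ne'] /=.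
      move=> ler nr; rewrite -E E' eqxx /= H //.
      apply: contraNneq nr => E1; apply/eqP/val_inj.
      by rewrite [LHS]surjective_pairing [RHS]surjective_pairing E1 E'.
    by rewrite orbF -E ne' /= => -> _.
  split=> /=; first by rewrite eq_sym ne le.
    by apply: contraNneq ne => ->.
  move=> r; case: eqVneq => [E'|ne'] /=.
    move=> /mp E1; case/eqP; apply: val_inj.
    by rewrite [LHS]surjective_pairing [RHS]surjective_pairing E1 E'.
  rewrite orbF => ler _; have := H _ ler; rewrite eq_sym ne' => /(_ isT) leq.
  case: (eqVneq (val q').2 (val r).2) => [E2|_] /=; last by rewrite leq.
  have : ele F (val q').1 (val r).1 || ele F (val r).1 (val q').1.
    by rewrite cF (eqP (valP q')) (eqP (valP r)) E2.
  by case/orP => [|/mq ->].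
split; last exact: back.
move=> pq.
case: (pselect (max_edge (val p).1)) => [m1|nm1].
  case: (pselect (max_edge (val p).2)) => [m2|nm2].
    by case: (succ_not_max pq); apply/ecomp_max.
  have [g pg] := succ_edge_ex oG nm2; have [e [re me]] := min_ex (src G g).
  have [q' q'E] := pair_edge re.
  have pq' : succ_edge p q' by apply: back; right; rewrite q'E.
  by right; rewrite (succ_edge_fun oFG pq pq') q'E.
have [e pe] := succ_edge_ex oF nm1.
have [|q' q'E] := pair_edge (e := e) (g := (val p).2).
  by have [-> _] := (succ_edge_rank oF _ _).1 pe; rewrite (eqP (valP p)).
have pq' : succ_edge p q' by apply: back; left; rewrite q'E.
by left; rewrite (succ_edge_fun oFG pq pq') q'E.
Qed.

End CompositeOrder.

(** * Infinite paths and the Vershik map *)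

Section Paths.
Variable B : diagram.
Hypothesis bB : ordered_bratteli B.
Implicit Types x y : ipath B.

Let arr_ordered n : ordered (arr B n). Proof. by case: bB => _ /(_ n) []. Qed.
Let arr_src_onto n : src_onto (arr B n). Proof. by case: bB => _ /(_ n) []. Qed.

Lemma path_ordered n : ordered (epath B 0 n).
Proof. exact: epath_ordered. Qed.

Lemma path_rng_onto n : rng_onto (epath B 0 n).
Proof. exact: epath_rng_onto. Qed.

Lemma vert0_eq (v w : vert B 0) : v = w.
Proof.
have [b0 _] := bB; have /card_le1_eqP H : #|vert B 0| <= 1 by rewrite b0.
exact: H.
Qed.

Lemma path0_eq (p q : epath B 0 0) : p = q.
Proof.
by apply: val_inj; apply/eqP; rewrite -pair_eqE /= (vert0_eq (val p).1 (val q).1)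
  (vert0_eq (val p).2 (val q).2) !eqxx.
Qed.

Lemma prefix_exists x n : exists p : epath B 0 n, begins x p /\ rng _ p = src _ (x n).
Proof.
elim: n => [|n [p [bp rp]]].
  have Q : Tagged (fun n => vert B n : Type) (src _ (x 0), src _ (x 0)).1 ==
      Tagged (fun n => vert B n : Type) (src _ (x 0), src _ (x 0)).2 by [].
  by exists (exist _ (src _ (x 0), src _ (x 0)) Q).
have Q : rng _ p == src _ (x n) by apply/eqP.
by exists (exist _ (p, x n) Q); split; [split | exact: ipathP].
Qed.

Definition prefix x n : epath B 0 n := sval (cid (prefix_exists x n)).

Lemma prefix_begins x n : begins x (prefix x n).
Proof. exact: (svalP (cid (prefix_exists x n))).1. Qed.

Lemma prefix_rng x n : rng _ (prefix x n) = src _ (x n).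
Proof. exact: (svalP (cid (prefix_exists x n))).2. Qed.

Lemma begins_prefix x n (p : epath B 0 n) : begins x p <-> prefix x n = p.
Proof.
split=> [|<-]; last exact: prefix_begins.
have := prefix_begins x n; move: (prefix x n) => q.
elim: n p q => [|n IHn] p q; first by move=> _ _; exact: path0_eq.
move=> [bq eq] [bp ep]; apply: val_inj; rewrite [LHS]surjective_pairing [RHS]surjective_pairing.
by rewrite (IHn _ _ bq bp) -eq -ep.
Qed.

Lemma prefixS x n : val (prefix x n.+1) = (prefix x n, x n).
Proof.
have [b e] := prefix_begins x n.+1.
by rewrite [LHS]surjective_pairing -e -((begins_prefix _ _).1 b).
Qed.

Lemma prefix_eq x y n : prefix x n = prefix y n <-> forall i, i < n -> x i = y i.
Proof.
rewrite -(begins_eq x (prefix_begins y n)); exact: iff_sym (begins_prefix _ _).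
Qed.

Lemma prefix_le x y m n : m <= n -> prefix x n = prefix y n -> prefix x m = prefix y m.
Proof.
by move=> mn /prefix_eq H; apply/prefix_eq => i im; apply: H; exact: leq_trans mn.
Qed.

(** [z] has to be a path from [n] on only. The induction overwrites its earlier entries by the edges
    of [p], beginning with the last one. *)
Lemma splice n (p : epath B 0 n) (z : forall i, arr B i) :
  (forall i, n <= i -> rng _ (z i) = src _ (z i.+1)) -> rng _ p = src _ (z n) ->
  exists x, prefix x n = p /\ forall i, n <= i -> x i = z i.
Proof.
elim: n p z => [|n IHn] p z zP pz.
  by exists (IPath (fun i => zP i (leq0n i))); split=> //; exact: path0_eq.
pose z' := dfwith z (val p).2.
have z'n : z' n = (val p).2 by exact: dfwith_in.
have z'i i : n < i -> z' i = z i by move=> ni; apply: dfwith_out; rewrite neq_ltn ni.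
have [||x [xp xz]] := IHn (val p).1 z'.
- move=> i; rewrite leq_eqVlt => /predU1P[<-|ni].
    by rewrite z'n z'i.
  by rewrite !z'i //; [exact: zP|exact: ltnW].
- by rewrite z'n; exact/eqP/(valP p).
exists x; split; last by move=> i ni; rewrite xz ?z'i //; exact: ltnW.
by apply: val_inj; rewrite prefixS [RHS]surjective_pairing xp xz // z'n.
Qed.

Lemma splice_path n (p : epath B 0 n) x : rng _ p = src _ (x n) ->
  exists y, prefix y n = p /\ forall i, n <= i -> y i = x i.
Proof. by apply: splice => i _; exact: ipathP. Qed.

Lemma extend n (p : epath B 0 n) : exists x, prefix x n = p.
Proof.
have [next nextP] : exists next : forall i, vert B i -> arr B i,
    forall i v, src _ (next i v) = v.
  have H i : exists f : vert B i -> arr B i, forall v, src _ (f v) = v.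
    by have [f fP] := choice (@arr_src_onto i : forall v, exists e, src (arr B i) e = v); exists f.
  exact: dep_choice H.
have v0 i : vert B i.
  by have [_ /(_ i) [+ _ _ _ _]] := bB; move=> /card_gt0P/cid[v _]; exact: v.
(* The vertices [g i] are arbitrary below [n], equal to the range of [p] at [n], and follow the
   chosen edges afterwards; [splice] looks at them from [n] on. *)
pose u := dfwith v0 (rng _ p).
pose g := fix g i : vert B i :=
  if i is j.+1 then if j < n then u j.+1 else rng _ (next j (g j)) else u 0.
have gn : g n = rng _ p.
  have -> : g n = u n by case: n p @u @g => //= n p; rewrite ltnSn.
  exact: dfwith_in.
have [||x [xp _]] := @splice n p (fun i => next i (g i)).
- by move=> i ni; rewrite [in RHS]nextP /= ltnNge ni.
- by rewrite nextP gn.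
by exists x.
Qed.

Lemma max_prefixS x n : max_edge (prefix x n.+1) <-> max_edge (prefix x n) /\ max_edge (x n).
Proof.
have := ecomp_max (path_ordered n) (arr_ordered n) (@path_rng_onto n) (prefix x n.+1).
by rewrite prefixS.
Qed.

Lemma min_prefixS x n : min_edge (prefix x n.+1) <-> min_edge (prefix x n) /\ min_edge (x n).
Proof.
have := ecomp_min (path_ordered n) (arr_ordered n) (@path_rng_onto n) (prefix x n.+1).
by rewrite prefixS.
Qed.

Lemma succ_prefixS x y n : succ_edge (prefix x n.+1) (prefix y n.+1) <->
  (x n = y n /\ succ_edge (prefix x n) (prefix y n)) \/
  [/\ succ_edge (x n) (y n), max_edge (prefix x n) & min_edge (prefix y n)].
Proof.
have := ecomp_succ (path_ordered n) (arr_ordered n) (@path_rng_onto n)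
  (prefix x n.+1) (prefix y n.+1).
by rewrite !prefixS.
Qed.

Lemma extreme0 (p : epath B 0 0) : max_edge p /\ min_edge p.
Proof. by split=> q _; exact: path0_eq. Qed.

Lemma max_prefix_le x m n : m <= n -> max_edge (prefix x n) -> max_edge (prefix x m).
Proof.
elim: n => [|n IHn]; first by rewrite leqn0 => /eqP ->.
by rewrite leq_eqVlt => /predU1P[-> //|/IHn H /max_prefixS[/H]].
Qed.

Lemma min_prefix_le x m n : m <= n -> min_edge (prefix x n) -> min_edge (prefix x m).
Proof.
elim: n => [|n IHn]; first by rewrite leqn0 => /eqP ->.
by rewrite leq_eqVlt => /predU1P[-> //|/IHn H /min_prefixS[/H]].
Qed.

Lemma max_pathP x : max_path x <-> forall n, max_edge (prefix x n).
Proof.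
split=> mx n; last by have /max_prefixS[] := mx n.+1.
by elim: n => [|n IHn]; [exact: (extreme0 _).1 | apply/max_prefixS].
Qed.

Lemma min_pathP x : min_path x <-> forall n, min_edge (prefix x n).
Proof.
split=> mx n; last by have /min_prefixS[] := mx n.+1.
by elim: n => [|n IHn]; [exact: (extreme0 _).2 | apply/min_prefixS].
Qed.

(* A description of [vershik_spec] level by level, invariant under reversing the orders
   and exchanging [x] and [y]. *)
Definition step_at n x y : Prop :=
  succ_edge (prefix x n) (prefix y n) \/
  (max_edge (prefix x n) /\ min_edge (prefix y n)).

Lemma step_at_le m n x y : m <= n -> step_at n x y -> step_at m x y.
Proof.
elim: n => [|n IHn]; first by rewrite leqn0 => /eqP ->.
rewrite leq_eqVlt => /predU1P[-> //|/IHn H].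
move=> [/succ_prefixS[[_ s]|[_ ma mi]]|[/max_prefixS[ma _] /min_prefixS[mi _]]]; apply: H.
- by left.
- by right.
- by right.
Qed.

Lemma step_at_tail n x y : succ_edge (prefix x n) (prefix y n) ->
  (forall i, n <= i -> x i = y i) -> forall m, step_at m x y.
Proof.
move=> s t m; case: (leqP m n) => [mn|nm]; first by apply: (step_at_le mn); left.
left; have {nm} : n <= m := ltnW nm; elim: m => [|m IHm].
  by rewrite leqn0 => /eqP n0; subst n.
rewrite leq_eqVlt => /predU1P[<- //|nm]; apply/succ_prefixS; left.
by split; [exact: t | exact: IHm].
Qed.

Lemma vershik_stepP x y : vershik_spec x y <-> forall n, step_at n x y.
Proof.
split=> [[[/max_pathP ma /min_pathP mi] n|[k [lt nmk sk gt]]]|H]; first by right.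
  apply: (@step_at_tail k.+1) => [|i ki]; last by rewrite gt.
  apply/succ_prefixS; right; split=> //.
    suff P n : n <= k -> max_edge (prefix x n) by exact: P.
    elim: n => [|n IHn] nk; first exact: (extreme0 _).1.
    by apply/max_prefixS; split; [exact/IHn/ltnW | have [] := lt n nk].
  suff P n : n <= k -> min_edge (prefix y n) by exact: P.
  elim: n => [|n IHn] nk; first exact: (extreme0 _).2.
  by apply/min_prefixS; split; [exact/IHn/ltnW | have [] := lt n nk].
case: (pselect (exists n, ~ max_edge (prefix x n))) => [|/forallNP nex]; last first.
  left; split; [apply/max_pathP => n | apply/min_pathP => n]; first exact: contrapT (nex n).
  case: (H n) => [s|[_ //]].
  by case: (nex n); exact: succ_not_max s.
move=> exn.
have exb : exists n, `[< ~ max_edge (prefix x n) >] by have [n] := exn; exists n; exact/asboolP.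
(* The empty prefix is maximal, so the shortest prefix that is not maximal has the form [k.+1]; its
   last edge, of index [k], is the one that moves to its successor. *)
case: (ex_minnP exb) => -[|k] /asboolP nmk kmin; first by case: nmk; exact: (extreme0 _).1.
have mk : max_edge (prefix x k).
  by apply: contrapT => /asboolP /kmin; rewrite ltnn.
have [/succ_prefixS[[_ s]|[sk _ mi]]|[//]] := H k.+1.
  by case: (succ_not_max s mk).
right; exists k; split.
- move=> i ik; split.
    by have /max_prefixS[] := max_prefix_le ik mk.
  by have /min_prefixS[] := min_prefix_le ik mi.
- exact: succ_not_max sk.
- by [].
move=> i ki; have [|[ma _]] := H i.+1; last first.
  by case: nmk; apply: max_prefix_le ma; exact: leqW.
move=> /succ_prefixS[[-> //]|[_ ma _]]; case: nmk; exact: max_prefix_le ma.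
Qed.

End Paths.

(** * The topology of the path space *)

Section PathTopology.
Variable B : diagram.
Hypothesis bB : ordered_bratteli B.
Implicit Types x y : ipath B.

Let begP := @begins_prefix B bB.
Let preE := @prefix_eq B bB.

Lemma ipath_nbhs x (A : set (ipath B)) :
  nbhs x A <-> exists n, forall y, prefix y n = prefix x n -> A y.
Proof.
rewrite nbhsE; split.
  move=> [C [oC Cx] CA]; have [n [p [px pC]]] := oC x Cx.
  exists n => y yx; apply/CA/pC; apply/begP; rewrite yx.
  exact/begP.
move=> [n H]; exists (cylinder (prefix x n)).
  split; last exact: prefix_begins.
  by move=> y /begP <-; exists n, (prefix y n); split; [exact: prefix_begins|].
by move=> y /begP /H.
Qed.

Lemma prefix_clopen n (P : epath B 0 n -> Prop) : clopen [set x | P (prefix x n)].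
Proof.
have op (Q : epath B 0 n -> Prop) : open [set x | Q (prefix x n)].
  by rewrite openE => x Qx; apply/ipath_nbhs; exists n => y /= ->.
by split=> //; rewrite -[X in closed X]setCK; apply: open_closedC; exact: (op (fun p => ~ P p)).
Qed.

Lemma cylinderE n (p : epath B 0 n) : cylinder p = [set x | prefix x n = p].
Proof. by apply/seteqP; split=> x /begP. Qed.

Lemma ipath_neq x y : x <> y -> exists n, prefix x n <> prefix y n.
Proof.
move=> xy; apply: contrapT => /forallNP H; apply/xy/ipath_eq => n.
by have /preE := contrapT (H n.+1); apply.
Qed.

Lemma ipath_zero_dimensional : zero_dimensional (ipath B).
Proof.
move=> x y /eqP /ipath_neq[n xy]; exists [set z | prefix z n = prefix x n].
by split=> //=; [exact: (prefix_clopen (fun p => p = prefix x n)) | exact/nesym].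
Qed.

(** An ultrafilter selects one edge at each level, the edge sets being finite. Two consecutive
    selected edges occur together in some path, hence are composable, and the path that they form is
    the limit. *)
Lemma ipath_compact : compact [set: ipath B].
Proof.
rewrite compact_ultra => U UU _.
have ex n : exists e : arr B n, U [set x : ipath B | x n = e].
  apply: contrapT => /forallNP no.
  have : U [set x : ipath B | forall e : arr B n, x n <> e].
    apply: filter_forall => e.
    by have [/no|] := in_ultra_setVsetC [set x : ipath B | x n = e] UU.
  by move=> /filter_ex[x /= /(_ (x n))].
have [e Ue] := dep_choice ex.
have eP n : rng _ (e n) = src _ (e n.+1).
  have [x [/= <- <-]] := filter_ex (filterI (Ue n) (Ue n.+1)).
  exact: ipathP.
exists (IPath eP); split=> // A /ipath_nbhs[n nA].
have : U [set x : ipath B | forall i, i < n -> x i = e i].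
  elim: n {nA} => [|n IHn]; first by apply: filterS filterT => x _ i.
  apply: filterS (filterI IHn (Ue n)) => x [/= H xn] i.
  by rewrite ltnS leq_eqVlt => /predU1P[->|/H].
by apply: filterS => x H; apply: nA; apply/preE.
Qed.

Definition agree n x y := forall i, i <= n -> x i = y i.

(** The distance is $1/(k+1)$, where [k] is the first index at which the paths differ. The stated
    properties reduce the metric axioms to facts about [agree]. *)
Lemma ipath_distance : exists d : ipath B -> ipath B -> Rdefinitions.R,
  [/\ forall x y, d x y = 0%R <-> x = y,
      forall x y, x <> y -> exists k, d x y = (k.+1%:R^-1)%R &
      forall x y n, (d x y < n.+1%:R^-1)%R <-> agree n x y].
Proof.
have H x y : exists r : Rdefinitions.R,
    [/\ r = 0%R <-> x = y, x <> y -> exists k, r = (k.+1%:R^-1)%R &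
        forall n, (r < n.+1%:R^-1)%R <-> agree n x y].
  case: (pselect (x = y)) => [->|xy].
    by exists 0%R; split=> // n; split=> // _; rewrite invr_gt0 ltr0n.
  have ex : exists n, x n != y n.
    apply: contrapT => /forallNP no; apply/xy/ipath_eq => n.
    by apply/eqP/negbNE/negP/no.
  case: (ex_minnP ex) => k xyk kmin; exists (k.+1%:R^-1)%R; split.
  - by split=> // /eqP; rewrite invr_eq0 pnatr_eq0.
  - by exists k.
  move=> n; rewrite ltf_pV2 ?posrE ?ltr0n // ltr_nat ltnS; split=> [nk i im|ag].
    apply/eqP/negbNE/negP => /kmin; rewrite leqNgt.
    by rewrite (leq_ltn_trans im nk).
  rewrite ltnNge; apply/negP => kn.
  by rewrite ag ?eqxx in xyk.
have [d dP] := choice (fun p : ipath B * ipath B => H p.1 p.2).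
exists (fun x y => d (x, y)); split=> [x y|x y|x y n].
- by have [] := dP (x, y).
- by have [] := dP (x, y).
- by have [_ _] := dP (x, y).
Qed.

Lemma ipath_metrizable : metrizable (ipath B).
Proof.
have [d [d0 dV dlt]] := ipath_distance; exists d.
(* Since 0 and the inverses of positive integers are the only distances, an upper bound can be
   tested against these inverses. *)
have dle x y r : (forall k, (r < k.+1%:R^-1)%R -> agree k x y) -> (0 <= r)%R -> (d x y <= r)%R.
  move=> H r0; case: (pselect (x = y)) => [/d0 -> //|/dV[k dk]].
  by rewrite leNgt; apply/negP; rewrite dk => /H /dlt; rewrite dk ltxx.
have dge0 x y : (0 <= d x y)%R.
  case: (pselect (x = y)) => [/d0 -> //|/dV[k ->]].
  by rewrite invr_ge0 ler0n.
have dS x y : (d x y <= d y x)%R.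
  by apply: dle => // k /dlt H i ik; rewrite H.
split=> //; first by move=> x y; apply/eqP; rewrite eq_le !dS.
  move=> x y z; apply: dle; last exact: addr_ge0.
  move=> k lt i ik.
  have /dlt -> // : (d x y < k.+1%:R^-1)%R by apply: le_lt_trans lt; rewrite lerDl.
  by have /dlt -> : (d y z < k.+1%:R^-1)%R by apply: le_lt_trans lt; rewrite lerDr.
move=> x; apply/seteqP; split=> A.
  move=> /ipath_nbhs[n H]; exists (n.+1%:R^-1)%R; first by rewrite /= invr_gt0 ltr0n.
  by move=> y /dlt ag; apply: H; apply/preE => i ni; rewrite ag // ltnW.
move=> [e /= e0 H]; apply/ipath_nbhs.
have [k] := ltr_add_invr e0; rewrite add0r => ke.
exists k.+1 => y /preE yx; apply: H; apply: lt_trans ke; apply/dlt => i ik.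
by rewrite yx.
Qed.

End PathTopology.

Lemma compact_homeo (X Y : topologicalType) (f : X -> Y) (g : Y -> X) :
  compact [set: X] -> hausdorff_space Y -> continuous f -> cancel f g -> cancel g f ->
  continuous g.
Proof.
move=> cX hY cf K1 K2; apply/continuous_closedP => A cA.
have -> : g @^-1` A = f @` A.
  apply/seteqP; split=> [y /= Ay|_ [x Ax <-]] /=; last by rewrite K1.
  by exists (g y).
apply: compact_closed => //; apply: continuous_compact; last exact: subclosed_compact cX _.
exact: continuous_subspaceT.
Qed.

(** * The Vershik map and its partitions *)

Section Vershik.
Variable B : diagram.
Hypotheses (bB : ordered_bratteli B) (poB : properly_ordered B).
Implicit Types x y : ipath B.

Let begP := @begins_prefix B bB.
Let preE := @prefix_eq B bB.
Let pathO := @path_ordered B bB.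
Let stepP := @vershik_stepP B bB.
Let maxP := @max_pathP B bB.
Let minP := @min_pathP B bB.

Lemma max_prefix_eq x y : (forall n, max_edge (prefix x n)) ->
  (forall n, max_edge (prefix y n)) -> x = y.
Proof. by have [[z [_ Hz]] _] := poB; move=> /maxP/Hz <- // /maxP/Hz. Qed.

Lemma min_prefix_eq x y : (forall n, min_edge (prefix x n)) ->
  (forall n, min_edge (prefix y n)) -> x = y.
Proof. by have [_ [z [_ Hz]]] := poB; move=> /minP/Hz <- // /minP/Hz. Qed.

Lemma cofinal_prefix_eq x y N : (forall n, N <= n -> prefix x n = prefix y n) -> x = y.
Proof.
move=> H; apply: ipath_eq => i; have := H (maxn N i.+1) (leq_maxl _ _).
by move=> /preE; apply; exact: leq_maxr.
Qed.

(** If some prefix of [x] is not maximal, all longer prefixes of [y] are the successors of those of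
    [x]. Otherwise [y] consists of minimal edges, and proper ordering leaves one such path. *)
Lemma step_fun x y y' : (forall n, step_at n x y) -> (forall n, step_at n x y') -> y = y'.
Proof.
move=> H H'; case: (pselect (exists n, ~ max_edge (prefix x n))) => [[N nm]|/forallNP mx].
  apply: (@cofinal_prefix_eq _ _ N) => n Nn.
  have nmx : ~ max_edge (prefix x n) by move=> /(max_prefix_le bB Nn).
  case: (H n) (H' n) => [s|[//]] [s'|[//]]; exact: (succ_edge_fun (pathO n) s s').
have mi z : (forall n, step_at n x z) -> forall n, min_edge (prefix z n).
  by move=> Hz n; case: (Hz n) => [/succ_not_max/(_ (contrapT (mx n)))|[]].
by apply: min_prefix_eq; exact: mi.
Qed.

Lemma step_inj x x' y : (forall n, step_at n x y) -> (forall n, step_at n x' y) -> x = x'.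
Proof.
move=> H H'; case: (pselect (exists n, ~ min_edge (prefix y n))) => [[N nm]|/forallNP mi].
  apply: (@cofinal_prefix_eq _ _ N) => n Nn.
  have nmi : ~ min_edge (prefix y n) by move=> /(min_prefix_le bB Nn).
  case: (H n) (H' n) => [s|[//]] [s'|[//]]; exact: (succ_edge_inj (pathO n) s s').
have ma z : (forall n, step_at n z y) -> forall n, max_edge (prefix z n).
  by move=> Hz n; case: (Hz n) => [/succ_not_min/(_ (contrapT (mi n)))|[]].
by apply: max_prefix_eq; exact: ma.
Qed.

Lemma step_splice n x (q : epath B 0 n) : succ_edge (prefix x n) q ->
  exists y, prefix y n = q /\ forall m, step_at m x y.
Proof.
move=> s; have [|y [yq yx]] := @splice_path B bB n q x.
  by have [-> _] := (succ_edge_rank (pathO n) _ _).1 s; rewrite prefix_rng.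
exists y; split=> //; apply: (step_at_tail bB (n := n)); first by rewrite yq.
by move=> i ni; rewrite yx.
Qed.

Lemma pred_splice n y (q : epath B 0 n) : succ_edge q (prefix y n) ->
  exists x, prefix x n = q /\ forall m, step_at m x y.
Proof.
move=> s; have [|x [xq xy]] := @splice_path B bB n q y.
  by have [<- _] := (succ_edge_rank (pathO n) _ _).1 s; rewrite prefix_rng.
exists x; split=> //; apply: (step_at_tail bB (n := n)); first by rewrite xq.
by move=> i ni; rewrite xy.
Qed.

Lemma xmaxP n : max_edge (prefix (xmax poB) n).
Proof. by move: n; apply/maxP => //; have [] := svalP (cid poB.1). Qed.

Lemma step_ex x : exists y, forall n, step_at n x y.
Proof.
case: (pselect (exists n, ~ max_edge (prefix x n))) => [[n nm]|/forallNP mx].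
  by have [q /step_splice[y [_ H]]] := succ_edge_ex (pathO n) nm; exists y.
have [_ [z [/minP mz _]]] := poB; exists z => n; right.
by split; [exact: contrapT (mx n) | exact: mz].
Qed.

Lemma step_onto y : exists x, forall n, step_at n x y.
Proof.
case: (pselect (exists n, ~ min_edge (prefix y n))) => [[n nm]|/forallNP mi].
  by have [q /pred_splice[x [_ H]]] := pred_edge_ex (pathO n) nm; exists x.
by exists (xmax poB) => n; right; split; [exact: xmaxP | exact: contrapT (mi n)].
Qed.

(** By [step_ex] the specification can be met, so the default value in [vershik] is never taken. *)
Lemma vershik_step x n : step_at n x (vershik x).
Proof.
have [y Hy] := step_ex x.
by have /stepP := xgetPex x (ex_intro (vershik_spec x) y ((stepP x y).2 Hy)).
Qed.

Lemma vershik_eq x y : (forall n, step_at n x y) -> vershik x = y.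
Proof. by apply: step_fun; exact: vershik_step. Qed.

(** Otherwise compactness would give a path whose prefixes are all minimal and which differs from
    [z]. This provides continuity of the Vershik map at the maximal path. *)
Lemma min_prefix_converge n z : (forall m, min_edge (prefix z m)) ->
  exists m, forall y, min_edge (prefix y m) -> prefix y n = prefix z n.
Proof.
move=> mz; apply: contrapT => /forallNP no.
have [||m|y Hy] := nested_nonempty (ipath_compact bB)
    (C := fun m => [set y | min_edge (prefix y m)] `&` [set y | prefix y n <> prefix z n]).
- move=> m; apply: closedI; first exact: (prefix_clopen bB (@min_edge _ _ _)).2.
  exact: (prefix_clopen bB (fun p => p <> prefix z n)).2.
- by move=> m y [/= mi ne]; split=> //; exact: min_prefix_le bB _ _ _ (leqnSn m) mi.
- apply: contrapT => /forallNP no'; apply: (no m) => y my.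
  by apply: contrapT => ne; apply: (no' y).
have yz : y = z by apply: min_prefix_eq => // m; have [] := Hy m.
by have [_] := Hy 0; rewrite yz.
Qed.

Lemma vershik_cont : continuous (@vershik B).
Proof.
move=> x A /(ipath_nbhs bB)[n H]; apply/(ipath_nbhs bB).
case: (pselect (exists N, ~ max_edge (prefix x N))) => [[N nm]|/forallNP mx].
  exists (maxn N n) => y yx; apply: H.
  apply: (prefix_le bB (leq_maxr N n)).
  have nmx : ~ max_edge (prefix x (maxn N n)).
    by move=> /(max_prefix_le bB (leq_maxl N n)).
  have := vershik_step y (maxn N n); rewrite /step_at yx.
  case: (vershik_step x (maxn N n)) => [s|[//]] [s'|[//]].
  exact: (succ_edge_fun (pathO _) s' s).
have mv m : min_edge (prefix (vershik x) m).
  by case: (vershik_step x m) => [/succ_not_max/(_ (contrapT (mx m)))|[]].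
have [m Hm] := @min_prefix_converge n _ mv.
exists m => y yx; apply: H; apply: Hm.
case: (vershik_step y m) => [s|[] //]; rewrite yx in s.
by case: (succ_not_max s (contrapT (mx m))).
Qed.

Lemma vershik_homeo : homeomorphism (@vershik B).
Proof.
split; first exact: vershik_cont.
have [psi psiP] := choice step_onto.
have K1 : cancel (@vershik B) psi.
  by move=> x; apply: step_inj (psiP _) _ => n; exact: vershik_step.
have K2 : cancel psi (@vershik B) by move=> y; exact: vershik_eq.
exists psi; split=> //; apply: compact_homeo (ipath_compact bB) _ vershik_cont K1 K2.
move=> p q clpq; apply: contrapT => /eqP pq.
have [U [[oU cU] Up Uq]] := ipath_zero_dimensional bB pq.
have oCU : open (~` U) by exact: closed_openC.
have [z [Uz nUz]] := clpq _ _ (open_nbhs_nbhs (conj oU Up)) (open_nbhs_nbhs (conj oCU Uq)).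
exact: nUz Uz.
Qed.

Lemma size_Vtower n (v : vert B n) : size (Vtower v) = size (fibre (epath B 0 n) v).
Proof. exact: size_map. Qed.

Lemma Vtower_size_gt0 n (v : vert B n) : 0 < size (Vtower v).
Proof.
rewrite size_Vtower lt0n size_eq0 -(size_eq0 _) -(size_map (src (epath B 0 n))) size_eq0.
exact: epath_onto_word.
Qed.

Lemma Vtower_nth n (v : vert B n) i x : i < size (Vtower v) ->
  nth set0 (Vtower v) i x <-> rng _ (prefix x n) = v /\ rank (prefix x n) = i.
Proof.
rewrite size_Vtower => iv; have [p [pv pi]] := rank_surj iv.
rewrite (nth_map p) // -/(fibre _ _) -pi -pv nth_fibre_rank; split=> [/begP -> //|[r rr]].
by apply/begP; apply: rank_inj.
Qed.

(** Floors are nonempty because finite paths extend, and any path in a floor reveals the vertex. The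
    set [Vparts B n] thus has one tower per vertex, which [tau] needs. *)
Lemma Vtower_inj n : injective (@Vtower B n).
Proof.
move=> v w E; have [x] : exists x, nth set0 (Vtower v) 0 x.
  have [p [pv pi]] := rank_surj (leq_trans (Vtower_size_gt0 v) (eq_leq (size_Vtower v))).
  by have [x xp] := extend bB p; exists x; apply/Vtower_nth; rewrite ?Vtower_size_gt0 ?xp.
move=> vx; have [<- _] := (Vtower_nth _ (Vtower_size_gt0 v)).1 vx.
by rewrite E in vx; have [<- _] := (Vtower_nth _ (Vtower_size_gt0 w)).1 vx.
Qed.

Lemma VpartsP n (T : seq (set (ipath B))) : T \in Vparts B n <-> exists v : vert B n, T = Vtower v.
Proof.
split=> [/imfsetP[v _ ->]|[v ->]]; first by exists v.
exact: Vtower_mem.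
Qed.

Lemma Vtop x n : top_of (Vparts B n) x <-> max_edge (prefix x n).
Proof.
have E v : (size (Vtower v)).-1 < size (Vtower (v : vert B n)).
  by rewrite prednK // Vtower_size_gt0.
split=> [[T /VpartsP[v ->]]|mx].
  rewrite -nth_last => /(Vtower_nth _ (E v))[r rr]; apply/max_edge_rank => //.
  by rewrite rr r -size_Vtower prednK // Vtower_size_gt0.
exists (Vtower (rng _ (prefix x n))); first by apply/VpartsP; eexists.
rewrite -nth_last; apply/Vtower_nth; first exact: E.
by split=> //; rewrite size_Vtower -((max_edge_rank (pathO n) _).1 mx).
Qed.

Lemma Vbottom x n : bottom_of (Vparts B n) x <-> min_edge (prefix x n).
Proof.
split=> [[T /VpartsP[v ->]]|mi].
  rewrite -nth0 => /(Vtower_nth _ (Vtower_size_gt0 v))[r rr].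
  by apply/min_edge_rank.
exists (Vtower (rng _ (prefix x n))); first by apply/VpartsP; eexists.
rewrite -nth0; apply/Vtower_nth; first exact: Vtower_size_gt0.
by split=> //; apply/min_edge_rank.
Qed.

Lemma Vtower_cylinder n (v : vert B n) Z : Z \in Vtower v ->
  exists2 p : epath B 0 n, rng _ p = v & Z = cylinder p.
Proof.
by move=> /mapP[p]; rewrite -/(fibre _ _) mem_fibre => /eqP pv ->; exists p.
Qed.

Lemma cylinder_Vtower n (p : epath B 0 n) : cylinder p \in Vtower (rng _ p).
Proof. by apply: map_f; rewrite -/(fibre _ _) mem_fibre. Qed.

Lemma Vparts_KR n : KR_partition (@vershik B) (xmax poB) (Vparts B n).
Proof.
split.
- by move=> T /VpartsP[v ->]; rewrite -size_eq0 -lt0n Vtower_size_gt0.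
- move=> T Z /VpartsP[v ->] /Vtower_cylinder[p _ ->]; split.
    by rewrite (cylinderE bB); exact: (prefix_clopen bB (fun q => q = p)).
  by have [x xp] := extend bB p; exists x; apply/begP.
- move=> T T' i j /VpartsP[v ->] /VpartsP[w ->] iv jw [x [/(Vtower_nth _ iv)[<- <-]]].
  by move=> /(Vtower_nth _ jw)[<- <-].
- move=> x; exists (Vtower (rng _ (prefix x n))), (cylinder (prefix x n)); split.
  + by apply/VpartsP; eexists.
  + exact: cylinder_Vtower.
  + exact/begP.
- move=> T i /VpartsP[v ->] iv; apply/seteqP; split=> [_ [x /(Vtower_nth _ (ltnW iv))[r rr] <-]|y].
    apply/(Vtower_nth _ iv); case: (vershik_step x n) => [/(succ_edge_rank (pathO n))[-> ->]|[]].
      by rewrite r rr.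
    move=> /(max_edge_rank (pathO n)); rewrite r rr -size_Vtower => E.
    by rewrite E ltnn in iv.
  move=> /(Vtower_nth _ iv)[r rr].
  have [|q qy] := pred_edge_ex (pathO n) (e := prefix y n).
    by move=> /(min_edge_rank (pathO n)); rewrite rr.
  have [x [xq H]] := pred_splice qy; exists x; last exact: vershik_eq.
  have [r' rr'] := (succ_edge_rank (pathO n) _ _).1 qy.
  apply/(Vtower_nth _ (ltnW iv)); rewrite xq -r r'; split=> //.
  by apply: succn_inj; rewrite -rr'.
- exact/Vtop/xmaxP.
- apply/seteqP; split=> [_ [x /Vtop mx <-]|y /Vbottom mi].
    apply/Vbottom; case: (vershik_step x n) => [s|[] //].
    by case: (succ_not_max s mx).
  have [x Hx] := step_onto y; exists x; last exact: vershik_eq.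
  apply/Vtop; case: (Hx n) => [s|[] //].
  by case: (succ_not_min s mi).
Qed.

Lemma Vparts_system : KR_system (@vershik B) (xmax poB) (@Vparts B).
Proof.
split.
- have v0 : vert B 0.
    have [b0 _] := bB.
    by have /card_gt0P/cid[v _] : 0 < #|vert B 0| by rewrite b0.
  have E v : Vtower (v : vert B 0) = [:: setT].
    have : size (Vtower v) = 1.
      rewrite size_Vtower -[RHS](congr1 size (word_eid v)) size_map.
      by [].
    case: (Vtower v) (@Vtower_cylinder 0 v) => [|Z [|? ?]] //= H _.
    by have [p _ ->] := H Z (mem_head _ _); congr [:: _]; apply/seteqP.
  apply/fsetP => T; rewrite inE; apply/idP/eqP => [/VpartsP[v ->]|->]; first exact: E.
  by rewrite -(E v0) Vtower_mem.
- exact: Vparts_KR.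
- move=> n T Y /VpartsP[v ->] /Vtower_cylinder[p _ ->].
  exists (Vtower (rng _ (val p).1)), (cylinder (val p).1); split.
  + by apply/VpartsP; eexists.
  + exact: cylinder_Vtower.
  + by move=> x [].
- move=> n _ x /Vtop mx; apply/Vtop; exact: max_prefix_le bB _ _ _ (leqnSn n) mx.
- apply/seteqP; split=> [x H|_ -> n _]; last exact/Vtop/xmaxP.
  (* The intersection runs over positive levels, so level [n] is reached from [n.+1]. *)
  apply: max_prefix_eq xmaxP => n; apply: (max_prefix_le bB (leqnSn n)).
  by apply/Vtop; exact: H.
split=> [Z [n [T /VpartsP[v ->] /Vtower_cylinder[p _ ->]]]|x A /(ipath_nbhs bB)[n H]].
  by rewrite (cylinderE bB); exact: (prefix_clopen bB (fun q => q = p)).1.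
exists (cylinder (prefix x n)); last by move=> y /begP /H.
split; last exact/begP.
exists n, (Vtower (rng _ (prefix x n))); last exact: cylinder_Vtower.
by apply/VpartsP; eexists.
Qed.

End Vershik.

Lemma V_wd : V_well_defined.
Proof.
move=> B poB; have bB := diagP B.
have cB := ipath_compact bB; have hB := vershik_homeo bB poB; have sB := Vparts_system bB poB.
split=> //.
- exact: ipath_metrizable.
- exact: zero_dimension_totally_disconnected (ipath_zero_dimensional bB).
- exact: system_essentially_minimal cB hB sB.
Qed.

(** * The natural isomorphisms *)

Section Tau.
Variables (strict : bool) (B : obd) (poB : properly_ordered B).

Let bB := diagP B.
Let X : sds := Sds (V_wd poB).
Let bP : ordered_bratteli (Pdiagram X) := (P_wd X).1.
Let arrO n : ordered (arr B n). Proof. by case: bB => _ /(_ n) []. Qed.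
Let arrPO n : ordered (arr (Pdiagram X) n). Proof. by case: bP => _ /(_ n) []. Qed.

Let Vt n (v : vert B n) : parts X n := [` Vtower_mem v]%fset.

Let Vt_inj n : injective (@Vt n).
Proof. by move=> v w /(congr1 val) /= /(Vtower_inj bB). Qed.

Let Vt_onto n (T : parts X n) : exists v, Vt v = T.
Proof. by have /VpartsP[v E] := valP T; exists v; exact: val_inj. Qed.

Definition tau_inv_arrow : prearrow (Pdiagram X) B :=
  @Prearrow (Pdiagram X) B id
    (fun n => @ESet (parts X n) (vert B n) (vert B n) (@Vt n) id (fun v w => v == w)).

Lemma tau_ordered n : ordered (pre (tau_arrow poB) n).
Proof.
split=> /=; first by move=> v; exact: eqxx.
- by move=> v w /andP[/eqP].
- by move=> w v u /eqP ->.
- move=> v w; rewrite [w == v]eq_sym orbb; apply/esym/(inj_eq (@Vt_inj n)).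
Qed.

Lemma tau_inv_ordered n : ordered (pre tau_inv_arrow n).
Proof.
split=> /=; first by move=> v; exact: eqxx.
- by move=> v w /andP[/eqP].
- by move=> w v u /eqP ->.
- by move=> v w; rewrite [w == v]eq_sym orbb.
Qed.

Lemma tau_word n (v : vert B n) : word (pre (tau_arrow poB) n) (Vt v) = [:: v].
Proof.
rewrite /word (fibre_eq (tau_ordered n) (L := [:: v])) // => w.
by rewrite inE -(inj_eq (@Vt_inj n)).
Qed.

Lemma tau_inv_word n (v : vert B n) : word (pre tau_inv_arrow n) v = [:: Vt v].
Proof. by rewrite /word (fibre_eq (tau_inv_ordered n) (L := [:: v])) // => w; rewrite inE. Qed.

(* A cylinder of length [n.+1] lies in the cylinder of its first [n] edges, and the
   order of [T_v] is lexicographic from the last edge. *)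
Lemma Vtower_arr n (v : vert B n.+1) :
  word (arr (Pdiagram X) n) (Vt v) = map (@Vt n) (word (arr B n) v).
Proof.
have ad := sds_adapted X (leqnSn n); apply: (adapted_word ad).
have oE : ordered (epath B 0 n) by exact: epath_ordered.
rewrite /reads -map_comp.
have -> : flatten [seq ((fun S : parts X n => val S) \o @Vt n) u | u <- word (arr B n) v] =
    [seq cylinder (val p).1 | p <- fibre (epath B 0 n.+1) v].
  rewrite (map_comp (fun p => cylinder p.1) val) (fibre_comp v oE (arrO n)).
  rewrite map_flatten -map_comp /word -map_comp; congr flatten.
  by apply: eq_map => g /=; rewrite -map_comp.
split; first by rewrite !size_map.
have [p0 _] := path_rng_onto bB v.
by move=> i; rewrite size_map => iv; rewrite !(nth_map p0) // => x [].
Qed.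

Lemma tau_premorphism : is_premorphism strict (tau_arrow poB).
Proof.
have [b0 bn] := bB.
split=> //.
- by move=> N; exists N.
- by move=> n; case: (bn n).
- exact: tau_ordered.
- by move=> _ n v; exists v.
- move=> n; apply: eiso_trans (eiso_sym (ecomp_iso (eiso_refl _) (epath1 bP n))).
  apply/word_iso => [||T]; [exact: ecomp_ordered (arrO n) (tau_ordered n.+1)|
    exact: ecomp_ordered (tau_ordered n) (arrPO n)|].
  have [v <-] := Vt_onto T.
  rewrite (word_comp _ (arrO n) (tau_ordered n.+1)) (word_comp _ (tau_ordered n) (arrPO n)).
  rewrite tau_word /= cats0 Vtower_arr -map_comp.
  rewrite (eq_map (@tau_word n)).
  by elim: (word _ _) => //= u w <-.
Qed.

Lemma tau_inv_premorphism : is_premorphism strict tau_inv_arrow.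
Proof.
have [b0 bn] := bB.
split=> //.
- by move=> N; exists N.
- by move=> n; case: (bn n).
- exact: tau_inv_ordered.
- by move=> n v; exists v.
- move=> n; apply: eiso_trans (eiso_sym (ecomp_iso (eiso_refl _) (epath1 bB n))).
  apply/word_iso => [||v]; [exact: ecomp_ordered (arrPO n) (tau_inv_ordered n.+1)|
    exact: ecomp_ordered (tau_inv_ordered n) (arrO n)|].
  rewrite (word_comp _ (arrPO n) (tau_inv_ordered n.+1)) (word_comp _ (tau_inv_ordered n) (arrO n)).
  rewrite tau_inv_word /= cats0 Vtower_arr.
  rewrite (eq_map (@tau_inv_word n)).
  by elim: (word _ _) => //= u w <-.
Qed.

Definition tau_pre : premorphism strict B (Obd bP) :=
  @Premorphism strict B (Obd bP) _ tau_premorphism.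
Definition tau_inv_pre : premorphism strict (Obd bP) B :=
  @Premorphism strict (Obd bP) B _ tau_inv_premorphism.

Lemma tau_invK : pequiv (pcomp tau_inv_pre tau_pre) (pid strict B).
Proof.
apply: (@pequiv_levelwise strict _ _ (pcomp tau_inv_pre tau_pre) (pid strict B) _ _ _
  erefl erefl) => n /=.
apply/word_iso => [||v]; [exact: ecomp_ordered (tau_ordered n) (tau_inv_ordered n)|
  exact: eid_ordered|].
rewrite (word_comp _ (tau_ordered n) (tau_inv_ordered n)) tau_inv_word /= cats0.
by rewrite tau_word word_eid.
Qed.

Lemma tau_homK : pequiv (pcomp tau_pre tau_inv_pre) (pid strict (Obd bP)).
Proof.
apply: (@pequiv_levelwise strict _ _ (pcomp tau_pre tau_inv_pre) (pid strict (Obd bP)) _ _ _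
  erefl erefl) => n /=.
apply/word_iso => [||T]; [exact: ecomp_ordered (tau_inv_ordered n) (tau_ordered n)|
  exact: eid_ordered|].
have [v <-] := Vt_onto T.
rewrite (word_comp _ (tau_inv_ordered n) (tau_ordered n)) tau_word /= cats0.
by rewrite tau_inv_word word_eid.
Qed.

End Tau.

(** * The functor V and the isomorphism sigma from full faithfulness of P *)

Section Assembly.
Variable strict : bool.
Local Notation Pob := (@Pob strict P_wd).
Local Notation Vob := (@Vob strict V_wd).
Local Notation P := (Pfun strict).

Definition tau_hom (B : OBDpo strict) : hom B (Pob (Vob B)) :=
  pclass (tau_pre strict (svalP B)).
Definition tau_inv (B : OBDpo strict) : hom (Pob (Vob B)) B :=
  pclass (tau_inv_pre strict (svalP B)).

Lemma tau_hom_invK (B : OBDpo strict) : tau_inv B \oc tau_hom B = idm B.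
Proof. by rewrite [LHS]obd_compE; apply/pclassP; exact: tau_invK. Qed.

Lemma tau_inv_homK (B : OBDpo strict) : tau_hom B \oc tau_inv B = idm (Pob (Vob B)).
Proof. by rewrite [LHS]obd_compE; apply/pclassP; exact: tau_homK. Qed.

Definition tau (B : OBDpo strict) : iso B (Pob (Vob B)) := Iso (tau_hom_invK B) (tau_inv_homK B).

Lemma V_exists (B C : OBDpo strict) (h : hom B C) :
  exists alpha : hom (Vob C) (Vob B), fmap P alpha = tau_hom C \oc h \oc tau_inv B.
Proof. exact: Pmap_full. Qed.

(** The choice is unique by [Pmap_faithful]. Functoriality can thus be checked after applying [P],
    which turns [Vmap h] into the conjugate of [h] by [tau]. *)
Definition Vmap (B C : OBDpo strict) (h : hom B C) : hom (Vob C) (Vob B) := sval (cid (V_exists h)).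

Lemma VmapE (B C : OBDpo strict) (h : hom B C) :
  fmap P (Vmap h) = tau_hom C \oc h \oc tau_inv B.
Proof. exact: (svalP (cid (V_exists h))). Qed.

Lemma tau_natural (B C : OBDpo strict) (h : hom B C) :
  tau_hom C \oc h = fmap P (Vmap h) \oc tau_hom B.
Proof. by rewrite VmapE -compmA tau_hom_invK compm1. Qed.

Lemma Vmap_id (B : OBDpo strict) : Vmap (idm B) = idm (Vob B).
Proof.
by apply: Pmap_faithful; rewrite [LHS]VmapE [RHS](fmap_id P) compm1 tau_inv_homK.
Qed.

Lemma Vmap_comp (B C D : OBDpo strict) (g : hom C D) (f : hom B C) :
  Vmap (g \oc f) = Vmap f \oc Vmap g.
Proof.
apply: Pmap_faithful; rewrite [LHS]VmapE [RHS](fmap_comp P) !VmapE.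
by rewrite !compmA -[_ \oc tau_inv C \oc tau_hom C]compmA tau_hom_invK compm1.
Qed.

Definition Vfun : cofunctor Vob := Cofunctor Vmap_id Vmap_comp.

Lemma sigma_exists (X : SDS strict) :
  exists s : hom X (Vob (Pob X)), fmap P s = tau_inv (Pob X).
Proof. exact: Pmap_full. Qed.

Lemma sigma_inv_exists (X : SDS strict) :
  exists s : hom (Vob (Pob X)) X, fmap P s = tau_hom (Pob X).
Proof. exact: Pmap_full. Qed.

Definition sigma_hom (X : SDS strict) := sval (cid (sigma_exists X)).
Definition sigma_inv (X : SDS strict) := sval (cid (sigma_inv_exists X)).

Lemma sigma_homE X : fmap P (sigma_hom X) = tau_inv (Pob X).
Proof. exact: (svalP (cid (sigma_exists X))). Qed.

Lemma sigma_invE X : fmap P (sigma_inv X) = tau_hom (Pob X).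
Proof. exact: (svalP (cid (sigma_inv_exists X))). Qed.

Lemma sigma_hom_invK X : sigma_inv X \oc sigma_hom X = idm X.
Proof.
apply: Pmap_faithful; rewrite [LHS](fmap_comp P) [RHS](fmap_id P) sigma_homE sigma_invE.
exact: tau_hom_invK.
Qed.

Lemma sigma_inv_homK X : sigma_hom X \oc sigma_inv X = idm (Vob (Pob X)).
Proof.
apply: Pmap_faithful; rewrite [LHS](fmap_comp P) [RHS](fmap_id P) sigma_homE sigma_invE.
exact: tau_inv_homK.
Qed.

Definition sigma (X : SDS strict) : iso X (Vob (Pob X)) :=
  Iso (sigma_hom_invK X) (sigma_inv_homK X).

End Assembly.

Theorem theorem3p15 (strict : bool) :
  exists (HP : P_well_defined) (HV : V_well_defined)
         (P : cofunctor (@Pob strict HP)) (V : cofunctor (@Vob strict HV))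
         (tau : forall B : OBDpo strict, iso B (Pob HP (Vob HV B)))
         (sigma : forall X : SDS strict, iso X (Vob HV (Pob HP X))),
    P_spec P /\ tau_spec tau /\ V_spec P V tau /\ sigma_spec P tau sigma /\
    inverse_equivalences P V sigma tau.
Proof.
exists P_wd, V_wd, (Pfun strict), (Vfun strict), (@tau strict), (@sigma strict).
split; first exact: Pfun_spec.
split; first by move=> B; exists (tau_premorphism strict (svalP B)).
split.
  move=> B C h; split=> [|alpha Ea]; first exact: VmapE.
  by apply: Pmap_faithful; rewrite [RHS]VmapE.
split.
  move=> X; split=> [|s Es]; first exact: sigma_homE.
  by apply: Pmap_faithful; rewrite [RHS]sigma_homE.
split=> [X X' f|B C g].
  (* Naturality of [sigma] is tested after applying [P]: there [VmapE] makes the image of [f] a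
     conjugate by [tau], whose left factor cancels against the [tau_inv] that comes from [sigma]. *)
  apply: Pmap_faithful.
  rewrite [LHS](fmap_comp (Pfun strict)) [RHS](fmap_comp (Pfun strict)) [in RHS]VmapE !sigma_homE.
  by rewrite !compmA tau_hom_invK comp1m.
exact: tau_natural.
Qed.
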